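(* Let $X\sim\mathrm{IP}(\mu;\delta,\beta,\gamma)$ with $\delta\le 0$, let $n$ be a positive integer and let $g\in\mathcal{H}^{n,n}(X)$. For non-negative integers $m$ let \[ S_{m,1}(g)=\sum_{i=1}^{m}\frac{\binom{m}{i}(1-(m+i)\delta)\,\mathbb{E}^2\big[q^i(X)g^{(i)}(X)\big]}{(m+1)_i\,\mathbb{E}[q^i(X)]\Big(\prod_{j=i-1}^{2i-2}(1-j\delta)\Big)(1-m\delta)}+\frac{\mathbb{E}\big[q(X)(g'(X))^2\big]}{(m+1)(1-m\delta)}, \] and define \[ S_{n,\mathrm{(str)}}=\sum_{i=1}^{n}\frac{\mathbb{E}^2[q^i(X)g^{(i)}(X)]}{i!\,\mathbb{E}[q^i(X)]\prod_{j=i-1}^{2i-2}(1-j\delta)} +\frac{\mathbb{E}\big[q^n(X)(g^{(n)}(X))^2\big]-\frac{\mathbb{E}^2[q^n(X)g^{(n)}(X)]}{\mathbb{E}[q^n(X)]}}{(n+1)!\prod_{j=n}^{2n-1}(1-j\delta)}, \] \[ S_{n,\mathrm{(weak)}}=\sum_{i=1}^{n-1}\frac{\mathbb{E}^2[q^i(X)g^{(i)}(X)]}{i!\,\mathbb{E}[q^i(X)]\prod_{j=i-1}^{2i-2}(1-j\delta)} +\frac{\mathbb{E}\big[q^n(X)(g^{(n)}(X))^2\big]}{n!\prod_{j=n-1}^{2n-2}(1-j\delta)}. \] Then: (a) $S_{n,1}(g)\le S_{n,\mathrm{(str)}}$, where equality holds when $n=1$, or when $n>1$ and $g$ is a polynomial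 of degree at most $n+1$; (b) $S_{n-1,1}(g)\le S_{n,\mathrm{(weak)}}$, where equality holds when $n=1$, or when $n>1$ and $g$ is a polynomial of degree at most $n$.
   Context: A random variable $X$ with density $f$ and finite mean $\mu=\mathbb{E}X$ belongs to the integrated Pearson family, written $X\sim\mathrm{IP}(\mu;\delta,\beta,\gamma)$, if there is a quadratic polynomial $q(x)=\delta x^2+\beta x+\gamma$ (with $|\delta|+|\beta|+|\gamma|>0$) such that $\int_{-\infty}^{x}(\mu-t)f(t)\,dt=q(x)f(x)$ for all $x\in\mathbb{R}$. Let $J(X)=(\alpha,\omega)$ denote the support of $X$. For $x\in\mathbb{R}$ and $k\in\mathbb{N}$, $(x)_k=x(x-1)\cdots(x-k+1)$ with $(x)_0=1$. For a positive integer $n$ with $\mathbb{E}|X|^{2n}<\infty$, $\mathcal{H}^{n,n}(X)$ is the class of Borel functions $g:(\alpha,\omega)\to\mathbb{R}$ such that $g\in C^{n-1}(\alpha,\omega)$, $g^{(n-1)}$ is absolutely continuous on $(\alpha,\omega)$ with a.s. derivative $g^{(n)}$, and $\mathbb{E}[q^n(X)(g^{(n)}(X))^2]<\infty$. Empty sums equal $0$, empty products equal $1$, and $\mathbb{E}^2[Y]$ means $(\mathbb{E}Y)^2$. *)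

(* Defs.v *)
From HB Require Import structures.
From mathcomp Require Import all_boot all_order all_algebra.
From mathcomp Require Import all_classical all_reals all_analysis.
Set Implicit Arguments. Unset Strict Implicit. Unset Printing Implicit Defensive.
Import Order.TTheory GRing.Theory Num.Theory.
Import numFieldNormedType.Exports.
Local Open Scope classical_set_scope.
Local Open Scope ring_scope.

Section Defs.
Context {R : realType}.
Notation leb := (@lebesgue_measure R).

Definition falling (x : R) (k : nat) : R := \prod_(j < k) (x - j%:R).

Definition qpol (delta beta gamma : R) (x : R) : R := delta * x ^+ 2 + beta * x + gamma.

Definition Exp (f h : R -> R) : R := Rintegral leb setT (fun x => h x * f x).

Definition supp_int (a w : \bar R) : set R := [set x | (a < x%:E)%E /\ (x%:E < w)%E].

Definition abs_cont_on (a b : R) (F : R -> R) : Prop :=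
  forall e : R, 0 < e -> exists2 d : R, 0 < d &
    forall (k : nat) (x y : nat -> R),
      (forall i, (i < k)%N -> a <= x i /\ x i <= y i /\ y i <= b) ->
      (forall i, (i.+1 < k)%N -> y i <= x i.+1) ->
      \sum_(i < k) (y i - x i) < d ->
      \sum_(i < k) `|F (y i) - F (x i)| < e.

Definition is_density (f : R -> R) : Prop :=
  measurable_fun setT f /\ (forall x, 0 <= f x) /\
  (\int[leb]_x (f x)%:E = 1)%E.

Definition IP (f : R -> R) (mu delta beta gamma : R) : Prop :=
  is_density f /\
  leb.-integrable setT (fun x => (x * f x)%:E) /\
  mu = Rintegral leb setT (fun x => x * f x) /\
  (`|delta| + `|beta| + `|gamma| > 0) /\
  forall x : R, Rintegral leb `]-oo, x] (fun t => (mu - t) * f t)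
                = qpol delta beta gamma x * f x.

Definition support_is (f : R -> R) (a w : \bar R) : Prop :=
  (a < w)%E /\ forall x, (0 < f x <-> supp_int a w x).

Definition Hnn (f : R -> R) (delta beta gamma : R) (a w : \bar R) (n : nat)
    (g : R -> R) (gd : nat -> R -> R) : Prop :=
  let J := supp_int a w in
  gd 0%N = g /\
  measurable_fun J g /\ measurable_fun J (gd n) /\
  (forall k, (k < n.-1)%N -> forall x, J x -> is_derive x 1 (gd k) (gd k.+1 x)) /\
  {within J, continuous (gd n.-1)} /\
  (forall s t, J s -> J t -> s < t -> abs_cont_on s t (gd n.-1)) /\
  {ae leb, forall x, J x -> is_derive x 1 (gd n.-1) (gd n x)} /\
  leb.-integrable setT
    (fun x => (qpol delta beta gamma x ^+ n * (gd n x) ^+ 2 * f x)%:E).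

Definition S1 (f : R -> R) (delta beta gamma : R) (gd : nat -> R -> R) (m : nat) : R :=
  let q := qpol delta beta gamma in
  \sum_(1 <= i < m.+1)
     ('C(m, i)%:R * (1 - (m + i)%N%:R * delta)
        * (Exp f (fun x => q x ^+ i * gd i x)) ^+ 2)
     / (falling (m.+1)%:R i * Exp f (fun x => q x ^+ i)
        * (\prod_(i.-1 <= j < (2 * i)%N.-1) (1 - j%:R * delta)) * (1 - m%:R * delta))
  + Exp f (fun x => q x * (gd 1%N x) ^+ 2) / (m.+1%:R * (1 - m%:R * delta)).

Definition Sstr (f : R -> R) (delta beta gamma : R) (gd : nat -> R -> R) (n : nat) : R :=
  let q := qpol delta beta gamma in
  \sum_(1 <= i < n.+1)
     (Exp f (fun x => q x ^+ i * gd i x)) ^+ 2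
     / (i`!%:R * Exp f (fun x => q x ^+ i)
        * \prod_(i.-1 <= j < (2 * i)%N.-1) (1 - j%:R * delta))
  + (Exp f (fun x => q x ^+ n * (gd n x) ^+ 2)
       - (Exp f (fun x => q x ^+ n * gd n x)) ^+ 2 / Exp f (fun x => q x ^+ n))
    / ((n.+1)`!%:R * \prod_(n <= j < (2 * n)%N) (1 - j%:R * delta)).

Definition Sweak (f : R -> R) (delta beta gamma : R) (gd : nat -> R -> R) (n : nat) : R :=
  let q := qpol delta beta gamma in
  \sum_(1 <= i < n)
     (Exp f (fun x => q x ^+ i * gd i x)) ^+ 2
     / (i`!%:R * Exp f (fun x => q x ^+ i)
        * \prod_(i.-1 <= j < (2 * i)%N.-1) (1 - j%:R * delta))
  + Exp f (fun x => q x ^+ n * (gd n x) ^+ 2)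
    / (n`!%:R * \prod_(n.-1 <= j < (2 * n)%N.-1) (1 - j%:R * delta)).

Definition poly_on (J : set R) (g : R -> R) (d : nat) : Prop :=
  exists p : {poly R}, (size p <= d.+1)%N /\ forall x, J x -> g x = p.[x].
End Defs.

(* Main.v *)
Require Import Defs.
From HB Require Import structures.
From mathcomp Require Import all_boot all_order all_algebra.
From mathcomp Require Import all_classical all_reals all_analysis.
From mathcomp Require Import measurable_realfun ring lra.
Set Implicit Arguments. Unset Strict Implicit. Unset Printing Implicit Defensive.
Import Order.TTheory GRing.Theory Num.Theory.
Import numFieldNormedType.Exports.
Local Open Scope classical_set_scope.
Local Open Scope ring_scope.

(* Write p for the best approximation of g by polynomials of degree < N in L2(f)
   (N = n for the weak bound, N = n + 1 for the strong one).

   By Bessel's identity, E[q g'^2] is a combination of the E^2[q^i g^(i)] with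
   i < N plus the energy E[q (g' - p')^2], so after matching coefficients the
   claim is a lower bound for E[q^n (g^(n) - p^(n))^2] by that energy. Now
   (q^k f)_k is a tower of Pearson weights, and integration by parts shows that
   g^(k) - p^(k) is orthogonal in L2(q^k f) to polynomials of degree < N - k. So
   it suffices to multiply the spectral gap inequalities

     m (kap - (m - 1) delta) int h^2 W <= int h'^2 q W,

   valid for a Pearson weight W with (q W)' = kap (x0 - x) W and h orthogonal to
   polynomials of degree < m; they are equalities when h has degree m.

   The gap is proved by induction on m over all weights at once. Set
   v = - (int_{-oo}^x h W) / (q W), so that - (v q W)' = h W. Then v is orthogonal
   to polynomials of degree < m - 1 for the next weight q W, and
     int h^2 W = int h' v q W,
     int h^2 W >= int v'^2 q^2 W + kap int v^2 q W,
   so that the inductive hypothesis for v and Cauchy-Schwarz give the claim. *)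

(** * Absolutely continuous functions *)

(** Nothing is assumed about [g] at the ends of the support, so every integration by parts must earn
    its boundary terms. They are followed along sequences exhausting the support. A Hardy-type
    estimate shows that [h'] in L2(q W) already forces [h] into L2(W) and keeps [h^2 q W] bounded;
    Cauchy-Schwarz on the tails of [h W] does the rest. The same estimate carries the single
    integrability condition on [g^(n)] down to all lower derivatives. As [g^(n)] exists only almost
    everywhere, a fundamental theorem for absolutely continuous functions comes first.

    The function v solves [A v = h], where [A v = - (v q W)' / W] is the adjoint of differentiation
    from L2(W) to L2(q W). Commuting the two operators produces the constant kap, because the affine
    factor [kap (x0 - x)] has slope [- kap]; this is the origin of the term [kap int v^2 q W].

    The sign of delta acts twice: q lies below an affine function, which yields all polynomial
    moments and the Hardy estimate, and the constant [kap - 2 delta] of the next weight remains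
    positive. *)

Section AbsolutelyContinuous.
Context {R : realType}.
Notation leb := (@lebesgue_measure R).
Implicit Types (F G D K h k : R -> R) (s t x y : R).

Lemma is_derive_linear_approx K x (l e : R) : is_derive x 1 K l -> 0 < e ->
  exists2 r : R, 0 < r & forall y, `|y - x| < r ->
    `|K y - K x - l * (y - x)| <= e * `|y - x|.
Proof.
move=> /is_derive1_caratheodory[g [Kg cg gx]] e0.
move/cvgrPdist_lt : cg => /(_ e e0)[r /= r0 rP].
exists r => // y yx; rewrite Kg -mulrBl normrM ler_wpM2r// ltW//.
rewrite distrC -gx; apply: rP => /=; rewrite /ball_/=.
by rewrite distrC.
Qed.

(* Cousin's argument: [s, t] is cut into pieces on which K varies slowly, and
   pieces inside an open set U of small measure covering the exceptional set,
   on which K varies little in total by absolute continuity. *)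
Lemma abs_cont_derive0 K s t : s < t -> abs_cont_on s t K ->
  {ae leb, forall x, s < x < t -> is_derive x 1 K 0} -> K t = K s.
Proof.
move=> st acK [N [mN N0 NP]].
apply/eqP; rewrite -subr_eq0 -normr_le0; apply/ler_addgt0Pl => e' e'0; rewrite addr0.
(* The slow pieces will cost [e * (t - s)] and the pieces inside [U] one more [e]. *)
pose e := e' / (t - s + 1).
have ts0 : 0 < t - s by rewrite subr_gt0.
have e0 : 0 < e by rewrite divr_gt0// addr_gt0.
have [d d0 dP] := acK e e0.
(* The endpoints join the exceptional set, since the derivative is known only strictly inside. *)
pose N' := N `|` [set s] `|` [set t].
have mN' : measurable N' by apply: measurableU => //; apply: measurableU.
have N'0 : leb N' = 0%E.
  have m1 (x : R) : measurable [set x] by [].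
  have n1 (x : R) : leb [set x] = 0%E by exact: lebesgue_measure_set1.
  rewrite /N'.
  rewrite [LHS](measureU0 (measurableU _ _ mN (m1 s)) (m1 t) (n1 t)).
  by rewrite [LHS](measureU0 mN (m1 s) (n1 s)).
have N'lt : (leb N' < +oo)%E by rewrite N'0 ltry.
have [U [oU N'U Ud]] : exists U : set R, [/\ open U, N' `<=` U & (leb (U `\` N') < d%:E)%E].
  exact: lebesgue_regularity_outer.
have mU : measurable U by apply: open_measurable.
have muU : (leb U < d%:E)%E.
  rewrite (measureDI leb mU mN') [X in (_ + X)%E](_ : _ = 0%E) ?adde0//.
  by apply/eqP; rewrite eq_le measure_ge0 andbT -N'0 le_measure ?inE//; exact: measurableI.
(* [C x] certifies the increment up to [x]: slope [e], plus intervals whose total length is charged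
   to the part of [U] left of [x]. The half-open [[s, x[] makes successive charges add up. *)
pose C (x : R) := s <= x <= t /\ exists (k : nat) (u v : nat -> R),
  [/\ forall i, (i < k)%N -> s <= u i /\ u i <= v i /\ v i <= x,
   forall i, (i.+1 < k)%N -> v i <= u i.+1,
   ((\sum_(i < k) (v i - u i))%:E <= leb (U `&` `[s, x[))%E &
   `|K x - K s| <= e * (x - s) + \sum_(i < k) `|K (v i) - K (u i)|].
have Cs : C s.
  split; first by rewrite lexx ltW.
  exists 0%N, (fun=> 0), (fun=> 0); split => //; first by rewrite big_ord0 measure_ge0.
  by rewrite !subrr normr0 mulr0 big_ord0 addr0.
pose step x y := `|K y - K x| <= e * (y - x) \/ `[x, y] `<=` U.
have Cstep x y : C x -> x <= y -> y <= t -> step x y -> C y.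
  move=> [/andP[sx xt] [k [u [v [uv vu muk Kx]]]]] xy yt [Kxy|xyU].
  - split; first by rewrite (le_trans sx xy).
    exists k, u, v; split => //.
    + by move=> i /uv[? [? ?]]; split => //; split => //; exact: le_trans xy.
    + apply: le_trans muk _; apply: le_measure; rewrite ?inE.
      * exact: measurableI.
      * exact: measurableI.
      * by apply: setIS; apply: subset_itvl; rewrite bnd_simp.
    + rewrite (_ : K y - K s = (K y - K x) + (K x - K s)); last by ring.
      rewrite (le_trans (ler_normD _ _))// (le_trans (lerD Kxy Kx))//.
      rewrite le_eqVlt; apply/orP; left; apply/eqP; ring.
  - split; first by rewrite (le_trans sx xy).
    pose u' i := if i == k then x else u i.
    pose v' i := if i == k then y else v i.
    have u'E (i : 'I_k) : u' i = u i by rewrite /u' (ltn_eqF (ltn_ord i)).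
    have v'E (i : 'I_k) : v' i = v i by rewrite /v' (ltn_eqF (ltn_ord i)).
    exists k.+1, u', v'; split.
    + move=> i; rewrite ltnS leq_eqVlt /u' /v'; case: eqP => [_ _|_ /= /uv[? [? vx]]]; first by [].
      by split => //; split => //; exact: le_trans xy.
    + move=> i; rewrite ltnS => ik; rewrite /u' /v' (ltn_eqF ik).
      case: eqP => [|ik']; first by have /uv[_ [_]] := ik.
      apply: vu; move: ik; rewrite leq_eqVlt => /orP[/eqP//|//].
    + have muxy : ((y - x)%:E <= leb `[x, y[%classic)%E.
        rewrite lebesgue_measure_itv/= lte_fin; case: ltP => // yx.
        by rewrite lee_fin subr_le0.
      rewrite big_ord_recr/= /u' /v' eqxx -/(u' _).
      under eq_bigr do rewrite -/(u' _) -/(v' _) u'E v'E.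
      have -> : U `&` `[s, y[ = (U `&` `[s, x[) `|` (U `&` `[x, y[).
        by rewrite -setIUr -itv_bndbnd_setU// bnd_simp.
      rewrite measureU.
      * rewrite EFinD leeD//.
        have -> : U `&` `[x, y[ = `[x, y[%classic.
          apply/setIidr; apply: subset_trans xyU.
          by apply: subset_itvl; rewrite bnd_simp.
        exact: muxy.
      * exact: measurableI.
      * exact: measurableI.
      * apply/seteqP; split => z //= [[_ +] [_]]; rewrite !in_itv/= => /andP[_ zx] /andP[xz _].
        by move: zx; rewrite ltNge xz.
    + rewrite big_ord_recr/= /u' /v' eqxx.
      under eq_bigr do rewrite -/(u' _) -/(v' _) u'E v'E.
      rewrite (_ : K y - K s = (K x - K s) + (K y - K x)); last by ring.
      rewrite (le_trans (ler_normD _ _))// addrA lerD2r (le_trans Kx)// lerD2r.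
      by rewrite ler_pM2l// lerD2r.
have locstep x : s <= x <= t -> exists2 r, 0 < r &
    (forall y, s <= y <= x -> x - r < y -> step y x) /\
    (forall y, x <= y <= t -> y < x + r -> step x y).
  move=> /andP[sx xt]; have [Ux|nUx] := pselect (U x).
    have [r /= r0 rU] := (open_nbhs_nbhs (conj oU Ux) : nbhs x U).
    exists r => //; split=> y /andP[h1 h2] h3; right => z /=; rewrite in_itv/= => /andP[h4 h5];
      apply: rU; rewrite /ball_/=; rewrite ltr_norml; lra.
  have nNx : ~ N' x by move/N'U.
  have sxt : s < x < t.
    rewrite !lt_neqAle sx xt !andbT; apply/andP; split; apply/eqP => E; apply: nNx; rewrite /N'.
    - by left; right; rewrite /= E.
    - by right; rewrite /= E.
  have dx : is_derive x 1 K 0.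
    by apply: contrapT => /= ndx; apply: nNx; left; left; apply: NP => /= /(_ sxt).
  have [r r0 rP] := is_derive_linear_approx dx e0.
  exists r => //; split=> y /andP[h1 h2] h3; left.
  - have /rP : `|y - x| < r by rewrite ler0_norm; lra.
    by rewrite mul0r subr0 distrC (ler0_norm (_ : y - x <= 0)) ?opprB//; lra.
  - have /rP : `|y - x| < r by rewrite ger0_norm; lra.
    by rewrite mul0r subr0 (ger0_norm (_ : 0 <= y - x))//; lra.
have supC : has_sup C by split; [exists s|exists t => x [/andP[]]].
have supub c : C c -> c <= sup C by move=> Cc; exact: sup_upper_bound.
have ss : s <= sup C by exact: supub _ Cs.
have sst : sup C <= t by apply: ge_sup; [exists s|move=> x [/andP[]]].
have [r r0 [rl rr]] := locstep (sup C) (introT andP (conj ss sst)).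
have [y Cy yr] := sup_adherent r0 supC.
have Csup : C (sup C).
  apply: Cstep (Cy) _ _ _ => //; first exact: supub _ Cy.
  apply: rl => //; rewrite (supub _ Cy) andbT.
  by case: Cy => /andP[].
have supt : sup C = t.
  apply/eqP; rewrite eq_le sst leNgt; apply/negP => lt_sup.
  pose z := Num.min t (sup C + r / 2).
  have zs : sup C < z by rewrite lt_min lt_sup; lra.
  have zt : z <= t by rewrite ge_min lexx.
  have Cz : C z.
    apply: Cstep (Csup) _ (zt) _; first exact: ltW.
    apply: rr; first by rewrite zt ltW.
    rewrite gt_min; apply/orP; right; lra.
  by move: (supub _ Cz); rewrite leNgt zs.
move: Csup; rewrite supt => -[_ [k [u [v [uv vu muk Kt]]]]].
apply: le_trans Kt _.
have : \sum_(i < k) `|K (v i) - K (u i)| < e.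
  apply: dP => //; rewrite -lte_fin; apply: le_lt_trans muk _.
  apply: le_lt_trans muU; apply: le_measure; rewrite ?inE//; exact: measurableI.
rewrite (_ : e' = e * (t - s + 1)); last by rewrite divfK// gt_eqF// addr_gt0.
by move=> /ltW H; rewrite [leRHS]mulrDr mulr1 lerD2l.
Qed.

Lemma abs_cont_onB F G s t : abs_cont_on s t F -> abs_cont_on s t G ->
  abs_cont_on s t (fun x => F x - G x).
Proof.
move=> aF aG e e0; have e20 : 0 < e / 2 by rewrite divr_gt0.
have [d d0 dP] := aF _ e20; have [d' d'0 d'P] := aG _ e20.
exists (Num.min d d'); first by rewrite lt_min d0.
move=> k x y xy yx; rewrite lt_min => /andP[/(dP _ _ _ xy yx) H /(d'P _ _ _ xy yx) H'].
rewrite (splitr e); apply: le_lt_trans (ltrD H H'); rewrite -big_split/=.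
apply: ler_sum => i _; rewrite (_ : _ - _ = (F (y i) - F (x i)) - (G (y i) - G (x i))); last by ring.
exact: ler_normB.
Qed.

(** The increments are integrals over disjoint half-open intervals, hence bounded by the integral of
    [|D|] over their union, a set of small measure. *)
Lemma abs_cont_on_Rintegral s t D : leb.-integrable `[s, t] (EFin \o D) ->
  abs_cont_on s t (fun x => Rintegral leb `[s, x] D).
Proof.
move=> iD.
have iD' : leb.-integrable setT (EFin \o (D \_ `[s, t])).
  by rewrite -restrict_EFin; apply/(integrable_mkcond _ _).1.
move=> e e0; have [d [d0 dP]] := integral_normr_continuous iD' e0.
exists d => // k x y xy yx sd.
have sub (i : 'I_k) : `]x i, y i] `<=` `[s, t].
  have [h1 [h2 h3]] := xy i (ltn_ord i).
  by apply: subset_itv; rewrite bnd_simp.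
have E (i : 'I_k) : Rintegral leb `[s, y i] D - Rintegral leb `[s, x i] D =
    Rintegral leb `]x i, y i] D.
  have [h1 [h2 h3]] := xy i (ltn_ord i).
  rewrite Rintegral_itvB//.
  by apply: integrableS iD => //; apply: subset_itvl; rewrite bnd_simp.
pose A := \big[setU/set0]_(i < k) [set` `]x i, y i]].
have mono : forall i j, (i < j)%N -> (j < k)%N -> y i <= x j.
  move=> i j; elim: j => // j IH; rewrite ltnS leq_eqVlt => /orP[/eqP-> jk|ij jk].
    exact: yx.
  have jk' : (j < k)%N by exact: ltnW.
  apply: le_trans (IH ij jk') _; have [_ [h _]] := xy _ jk'.
  by apply: le_trans h _; exact: yx.
have tA : trivIset setT (fun i : 'I_k => `]x i, y i]%classic).
  apply/trivIsetP => i j _ _; wlog ij : i j / (i < j)%N => [H ij|_].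
    have [?|?|/val_inj/eqP] := ltngtP i j; first exact: H; last by rewrite (negbTE ij).
    by rewrite setIC; apply: H => //; rewrite eq_sym.
  apply/seteqP; split => z //= []; rewrite !in_itv/= => /andP[_ zy] /andP[xz _].
  by have := mono i j ij (ltn_ord j); rewrite leNgt (lt_le_trans xz zy).
have mA : measurable A by apply: bigsetU_measurable.
have : Rintegral leb A (fun z => `|(D \_ `[s, t]) z|) < e.
  apply: dP => //; rewrite /A measure_bigsetU_ord//=.
  apply: le_lt_trans (_ : _ <= (\sum_(i < k) (y i - x i))%:E)%E _; last by rewrite lte_fin.
  rewrite -sumEFin; apply: lee_sum => i _; rewrite lebesgue_measure_itv/= lte_fin.
  case: ltP => // yxi; rewrite lee_fin subr_ge0.
  by have [_ [h _]] := xy i (ltn_ord i).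
apply: le_lt_trans.
have iN (B : set R) : measurable B -> leb.-integrable B (EFin \o (fun z => `|(D \_ `[s, t]) z|)).
  move=> mB; apply: integrableS (integrable_norm iD') => //.
have -> : Rintegral leb A (fun z => `|(D \_ `[s, t]) z|) =
   \sum_(i < k) Rintegral leb `]x i, y i] (fun z => `|(D \_ `[s, t]) z|).
  rewrite /Rintegral (integral_bigsetU_EFin _ _ _) ?index_enum_uniq//.
  - rewrite sum_fine// => i _; apply: integrable_fin_num => //; exact: iN.
  - by apply: sub_trivIset tA.
  - by apply: measurable_int (iN _ mA).
apply: ler_sum => i _; rewrite E.
have iDi : leb.-integrable `]x i, y i] (EFin \o D) by apply: integrableS iD.
apply: le_trans (le_normr_Rintegral _ iDi) _ => //.
rewrite le_eqVlt; apply/orP; left; apply/eqP; apply: eq_Rintegral => z zx.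
by rewrite patchE mem_set//; apply: (sub i); move: zx; rewrite inE.
Qed.

(** By Lebesgue differentiation the primitive [G] of [D] also has derivative [D] almost everywhere;
    [F - G] is then absolutely continuous with zero derivative, so it has equal values at both
    ends. *)
Lemma abs_cont_FTC F D s t : s < t -> abs_cont_on s t F ->
  leb.-integrable `[s, t] (EFin \o D) ->
  {ae leb, forall x, s < x < t -> is_derive x 1 F (D x)} ->
  Rintegral leb `[s, t] D = F t - F s.
Proof.
move=> st aF iD dF.
pose D' := D \_ `[s, t].
have D'E x : s <= x <= t -> D' x = D x by move=> sxt; rewrite /D' patchE mem_set//= in_itv.
have iD' : leb.-integrable setT (EFin \o D').
  by rewrite -restrict_EFin; apply/(integrable_mkcond _ _).1.
have iD'S (A : set R) : measurable A -> leb.-integrable A (EFin \o D').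
  by move=> mA; apply: integrableS iD'.
pose G x := Rintegral leb `[s, x] D'.
have aG : abs_cont_on s t G by apply: abs_cont_on_Rintegral; exact: iD'S.
have dG : {ae leb, forall x, s < x < t -> is_derive x 1 G (D x)}.
  have := lebesgue_differentiation (open_integrable_locally openT iD').
  apply: filterS; first exact: (ae_filter_ringOfSetsType leb).
  move=> x xD /andP[sx xt].
  have [|||dGx Gx] := @FTC1_lebesgue_pt R D' (BLeft s) x t xt.
  - exact: iD'S.
  - by move: (sx); rewrite -(@lte_fin R) => /ltW.
  - exact: xD.
  - by apply: DeriveDef => //; rewrite -derive1E Gx D'E// !ltW.
have dFG : {ae leb, forall x, s < x < t -> is_derive x 1 (fun x => F x - G x) 0}.
  move: dF dG; apply: filterS2; first exact: (ae_filter_ringOfSetsType leb).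
  move=> x hF hG sxt.
  have := @is_deriveB _ _ _ _ _ _ _ _ _ (hF sxt) (hG sxt).
  by rewrite subrr.
have := abs_cont_derive0 st (abs_cont_onB aF aG) dFG.
rewrite /G set_itv1 Rintegral_set1 subr0 => <-.
rewrite opprB addrC subrK.
by apply: eq_Rintegral => z; rewrite inE/= in_itv/= => /D'E.
Qed.

Lemma abs_cont_on_continuous s t h x : abs_cont_on s t h -> s < x < t ->
  {for x, continuous h}.
Proof.
move=> ah /andP[sx xt]; apply/cvgrPdist_lt => e e0.
have [d d0 dP] := ah e e0.
have P u v : s <= u -> u <= v -> v <= t -> v - u < d -> `|h v - h u| < e.
  move=> su uv vt vud; have := dP 1%N (fun=> u) (fun=> v).
  rewrite !big_ord1; apply => // i _.
near=> y.
have sy : s <= y by near: y; apply: lt_le_nbhsr.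
have yt : y <= t by near: y; apply: lt_le_nbhsl.
have : `|x - y| < d by near: y; exact: cvgr_dist_lt.
case: (leP y x) => xy.
  by rewrite ger0_norm ?subr_ge0// => /P; apply => //; exact: ltW.
by rewrite distrC (distrC (h x)) ger0_norm ?subr_ge0 ?ltW// => /P; apply => //; exact: ltW.
Unshelve. all: by end_near. Qed.

Lemma abs_cont_onM h k s t M : abs_cont_on s t h -> abs_cont_on s t k ->
  (forall x, s <= x <= t -> `|h x| <= M) -> (forall x, s <= x <= t -> `|k x| <= M) ->
  abs_cont_on s t (fun x => h x * k x).
Proof.
move=> ah ak hM kM e e0.
pose M' := `|M| + 1.
have M'0 : 0 < M' by rewrite ltr_wpDl.
have e20 : 0 < e / M' / 2 by rewrite !divr_gt0.
have [d d0 dP] := ah _ e20; have [d' d'0 d'P] := ak _ e20.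
exists (Num.min d d'); first by rewrite lt_min d0.
move=> n x y xy yx; rewrite lt_min => /andP[/(dP _ _ _ xy yx) H /(d'P _ _ _ xy yx) H'].
rewrite (_ : e = M' * (e / M' / 2) + M' * (e / M' / 2)); last by field; rewrite gt_eqF.
have /(lt_trans _) : M' * (\sum_(i < n) `|h (y i) - h (x i)|) +
   M' * (\sum_(i < n) `|k (y i) - k (x i)|) < M' * (e / M' / 2) + M' * (e / M' / 2).
  by rewrite ltrD// ltr_pM2l.
move=> H''; apply: le_lt_trans (_ : _ <= M' * (\sum_(i < n) `|h (y i) - h (x i)|) +
   M' * (\sum_(i < n) `|k (y i) - k (x i)|)) _; last by rewrite ltrD// ltr_pM2l.
rewrite !mulr_sumr -big_split/=; apply: ler_sum => i _.
have [h1 [h2 h3]] := xy i (ltn_ord i).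
rewrite (_ : _ - _ = (h (y i) - h (x i)) * k (y i) + h (x i) * (k (y i) - k (x i))); last by ring.
rewrite (le_trans (ler_normD _ _))// !normrM lerD//.
  rewrite mulrC ler_wpM2r// (le_trans (kM _ _))//.
    by rewrite (le_trans h1 h2) h3.
  by rewrite (le_trans (ler_norm _))// lerDl.
rewrite ler_wpM2r// (le_trans (hM _ _))//.
  by rewrite h1 (le_trans h2 h3).
by rewrite (le_trans (ler_norm _))// lerDl.
Qed.

Lemma lipschitz_abs_cont_on h s t L :
  (forall x y, s <= x -> x <= y -> y <= t -> `|h y - h x| <= L * (y - x)) ->
  abs_cont_on s t h.
Proof.
move=> hL e e0; pose L' := `|L| + 1.
have L'0 : 0 < L' by rewrite ltr_wpDl.
exists (e / L'); first by rewrite divr_gt0.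
move=> n x y xy yx; rewrite ltr_pdivlMr// mulr_suml; apply: le_lt_trans.
apply: ler_sum => i _; have [h1 [h2 h3]] := xy i (ltn_ord i).
rewrite (le_trans (hL _ _ h1 h2 h3))// mulrC ler_wpM2l ?subr_ge0//.
by rewrite (le_trans (ler_norm _))// lerDl.
Qed.
End AbsolutelyContinuous.

(** * Locally absolutely continuous functions on the open support *)

Section OpenInterval.
Context {R : realType}.
Notation leb := (@lebesgue_measure R).
Variables (a w : \bar R).
Notation J := (supp_int a w).
Implicit Types (h k : R -> R) (s t x y : R).

Lemma supp_int_open : open J.
Proof.
rewrite (_ : J = [set x | (a < x%:E)%E] `&` [set x | (x%:E < w)%E]) //.
apply: openI.
- exact: open_ereal_gt.
- exact: open_ereal_lt.
Qed.

Lemma supp_int_measurable : measurable J.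
Proof. exact: open_measurable supp_int_open. Qed.

Lemma supp_int_convex s t x : J s -> J t -> s <= x <= t -> J x.
Proof.
move=> [as_ _] [_ tw] /andP[sx xt]; split.
  by apply: lt_le_trans as_ _; rewrite lee_fin.
by apply: le_lt_trans tw; rewrite lee_fin.
Qed.

Lemma supp_int_enlarge x : J x -> exists s t, [/\ J s, J t & s < x < t].
Proof.
move=> Jx; have /= := open_nbhs_nbhs (conj supp_int_open Jx).
move=> /nbhs_ballP[r /= r0 rJ]; exists (x - r / 2), (x + r / 2).
have r2 : 0 < r / 2 by rewrite divr_gt0.
have r2r : r / 2 < r by rewrite ltr_pdivrMr// ltr_pMr// ltr1n.
split; last by rewrite ltrBlDr !ltrDl !r2.
  by apply: rJ; rewrite /ball/= opprB addrC subrK gtr0_norm.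
by apply: rJ; rewrite /ball/= opprD addNKr normrN gtr0_norm.
Qed.

Definition cont_on h := forall x, J x -> {for x, continuous h}.

Lemma cont_on_measurable h : cont_on h -> measurable_fun J h.
Proof.
move=> ch; apply: open_continuous_measurable_fun; first exact: supp_int_open.
by move=> x; rewrite inE => /ch.
Qed.

Lemma cont_on_within h s t : cont_on h -> J s -> J t -> {within `[s, t], continuous h}.
Proof.
move=> ch Js Jt; apply: continuous_in_subspaceT => x; rewrite inE/= in_itv/= => sxt.
exact/ch/(supp_int_convex Js Jt sxt).
Qed.

Lemma cont_on_bounded h s t : cont_on h -> J s -> J t ->
  exists M, forall x, s <= x <= t -> `|h x| <= M.
Proof.
move=> ch Js Jt.
have /compact_bounded[M [_ mrt]] := continuous_compact (cont_on_within ch Js Jt) (@segment_compact _ s t).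
exists (M + 1) => x sxt; apply: (mrt (M + 1)); first by rewrite ltrDl.
by exists x => //=; rewrite in_itv.
Qed.

Lemma cont_on_integrable h s t : cont_on h -> J s -> J t ->
  leb.-integrable `[s, t] (EFin \o h).
Proof.
move=> ch Js Jt; apply: continuous_compact_integrable; first exact: segment_compact.
exact: cont_on_within.
Qed.

(** A function together with a chosen version of its almost everywhere derivative. Integrability of
    [h1] is supplied at each use of [ac_on_FTC], where it comes from weighted L2 bounds. *)
Definition ac_on h h1 := [/\ forall s t, J s -> J t -> s < t -> abs_cont_on s t h,
  measurable_fun J h1 & {ae leb, forall x, J x -> is_derive x 1 h (h1 x)}].

Lemma ac_on_cont h h1 : ac_on h h1 -> cont_on h.
Proof.
move=> [ah _ _] x Jx; have [s [t [Js Jt sxt]]] := supp_int_enlarge Jx.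
have st : s < t by case/andP: sxt; exact: lt_trans.
exact: abs_cont_on_continuous (ah s t Js Jt st) sxt.
Qed.

Lemma ac_on_C1 h h1 : (forall x, J x -> is_derive x 1 h (h1 x)) -> cont_on h1 ->
  ac_on h h1.
Proof.
move=> dh ch1; split; last by apply: aeW => x; exact: dh.
- move=> s t Js Jt st; have [M hM] := cont_on_bounded ch1 Js Jt.
  apply: (@lipschitz_abs_cont_on _ _ _ _ M) => x y sx xy yt.
  have Jx : J x by apply: supp_int_convex Js Jt _; rewrite sx (le_trans xy yt).
  have Jy : J y by apply: supp_int_convex Js Jt _; rewrite yt (le_trans sx xy).
  have [z|//|z zxy ->] := MVT_segment (f := h) (df := h1) xy.
  - rewrite in_itv/= => /andP[xz zy]; apply: dh; apply: supp_int_convex Jx Jy _.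
    by rewrite !ltW.
  - apply: derivable_within_continuous => z; rewrite in_itv/= => xzy.
    by apply: ex_derive; exact: dh (supp_int_convex Jx Jy xzy).
  - rewrite normrM (ger0_norm (_ : 0 <= y - x)) ?subr_ge0// ler_wpM2r ?subr_ge0// hM//.
    by move: zxy; rewrite in_itv/= => /andP[xz zy]; rewrite (le_trans sx xz) (le_trans zy yt).
- exact: cont_on_measurable.
Qed.

Lemma ac_onM h h1 k k1 : ac_on h h1 -> ac_on k k1 ->
  ac_on (fun x => h x * k x) (fun x => h1 x * k x + h x * k1 x).
Proof.
move=> ah ak; have ch := ac_on_cont ah; have ck := ac_on_cont ak.
have mh := cont_on_measurable ch; have mk := cont_on_measurable ck.
case: ah ak => [ah mh1 dh] [ak mk1 dk]; split.
- move=> s t Js Jt st; have [M hM] := cont_on_bounded ch Js Jt.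
  have [M' kM'] := cont_on_bounded ck Js Jt.
  apply: (@abs_cont_onM _ _ _ _ _ (Num.max M M')).
  + exact: ah.
  + exact: ak.
  + by move=> x /hM; rewrite le_max => ->.
  + by move=> x /kM'; rewrite le_max => ->; rewrite orbT.
- apply: measurable_funD; exact: measurable_funM.
- move: dh dk; apply: filterS2; first exact: (ae_filter_ringOfSetsType leb).
  move=> x hx kx Jx; have hx' := hx Jx; have kx' := kx Jx.
  apply: trigger_derive; rewrite /GRing.scale/=; ring.
Qed.

Lemma ac_onB h h1 k k1 : ac_on h h1 -> ac_on k k1 ->
  ac_on (fun x => h x - k x) (fun x => h1 x - k1 x).
Proof.
move=> [ah mh1 dh] [ak mk1 dk]; split.
- by move=> s t Js Jt st; apply: abs_cont_onB; [exact: ah|exact: ak].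
- exact: measurable_funB.
- move: dh dk; apply: filterS2; first exact: (ae_filter_ringOfSetsType leb).
  by move=> x hx kx Jx; have hx' := hx Jx; have kx' := kx Jx; exact: is_deriveB.
Qed.

Lemma ac_on_FTC h h1 s t : ac_on h h1 -> J s -> J t -> s <= t ->
  leb.-integrable `[s, t] (EFin \o h1) ->
  Rintegral leb `[s, t] h1 = h t - h s.
Proof.
move=> [ah _ dh] Js Jt; rewrite le_eqVlt => /predU1P[<- _|st ih].
  by rewrite set_itv1 Rintegral_set1 subrr.
apply: abs_cont_FTC => //; first exact: ah.
move: dh; apply: filterS; first exact: (ae_filter_ringOfSetsType leb).
move=> x hx /andP[sx xt]; apply: hx; apply: supp_int_convex Js Jt _.
by rewrite !ltW.
Qed.
End OpenInterval.

(** * Real-valued integrals *)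

Section RealIntegrable.
Context {R : realType}.
Notation leb := (@lebesgue_measure R).
Implicit Types (D : set R) (h k u : R -> R).

Definition integrable_on D h := leb.-integrable D (EFin \o h).

Lemma integrable_on_measurable D h : integrable_on D h -> measurable_fun D h.
Proof. by move=> /measurable_int/measurable_EFinP. Qed.

Lemma integrable_onS D D' h : measurable D -> measurable D' -> D' `<=` D ->
  integrable_on D h -> integrable_on D' h.
Proof. by move=> mD mD' DD' ih; exact: integrableS ih. Qed.

Lemma eq_integrable_on D h k : measurable D -> (forall x, D x -> h x = k x) ->
  integrable_on D h -> integrable_on D k.
Proof.
move=> mD hk; apply: eq_integrable => // x; rewrite inE => /hk; rewrite /comp => ->.
by [].
Qed.

Lemma eq_Rint D h k : (forall x, D x -> h x = k x) -> Rintegral leb D h = Rintegral leb D k.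
Proof. by move=> hk; apply: eq_Rintegral => x; rewrite inE => /hk. Qed.

Lemma integrable_onD D h k : measurable D -> integrable_on D h -> integrable_on D k ->
  integrable_on D (fun x => h x + k x).
Proof. by move=> mD ih ik; exact: (@integrableD _ _ _ leb D mD _ _ ih ik). Qed.

Lemma integrable_onB D h k : measurable D -> integrable_on D h -> integrable_on D k ->
  integrable_on D (fun x => h x - k x).
Proof. by move=> mD ih ik; exact: (@integrableB _ _ _ leb D mD _ _ ih ik). Qed.

Lemma integrable_onZ D h r : measurable D -> integrable_on D h ->
  integrable_on D (fun x => r * h x).
Proof. by move=> mD ih; exact: (@integrableZl _ _ _ leb D mD r _ ih). Qed.

Lemma integrable_on_dom D h k : measurable D -> measurable_fun D h ->
  integrable_on D k -> (forall x, D x -> `|h x| <= k x) -> integrable_on D h.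
Proof.
move=> mD mh ik hk; apply: le_integrable ik => //; first exact/measurable_EFinP.
move=> x Dx /=; by rewrite lee_fin (le_trans (hk _ Dx))// ler_norm.
Qed.

Lemma integrable_on_norm D h : measurable D -> integrable_on D h ->
  integrable_on D (fun x => `|h x|).
Proof. by move=> mD ih; exact: integrable_norm. Qed.

(** Dominated through [|h k| <= h^2 + k^2]. *)
Lemma integrable_on_mul D h k u : measurable D -> measurable_fun D h ->
  measurable_fun D k -> measurable_fun D u -> (forall x, D x -> 0 <= u x) ->
  integrable_on D (fun x => h x ^+ 2 * u x) ->
  integrable_on D (fun x => k x ^+ 2 * u x) ->
  integrable_on D (fun x => h x * k x * u x).
Proof.
move=> mD mh mk mu u0 ih ik.
apply: integrable_on_dom (integrable_onD mD ih ik) _ => //.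
  by apply: measurable_funM => //; exact: measurable_funM.
move=> x Dx; rewrite -mulrDl normrM (ger0_norm (u0 _ Dx)) ler_wpM2r ?u0//.
rewrite normrM -(real_normK (num_real (h x))) -(real_normK (num_real (k x))).
have := normr_ge0 (h x); have := normr_ge0 (k x); nra.
Qed.

Lemma Rint_ge0 D h : (forall x, D x -> 0 <= h x) -> 0 <= Rintegral leb D h.
Proof. by move=> h0; exact: Rintegral_ge0. Qed.

(** A nonnegative integrand with zero integral vanishes almost everywhere, which is impossible on an
    interval of positive length. *)
Lemma Rint_gt0 D h c d : measurable D -> integrable_on D h ->
  (forall x, D x -> 0 <= h x) -> c < d -> (forall x, c < x < d -> D x /\ 0 < h x) ->
  0 < Rintegral leb D h.
Proof.
move=> mD ih h0 cd hpos; rewrite lt_neqAle Rint_ge0// andbT; apply/negP => /eqP/esym I0.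
have mh : measurable_fun D (EFin \o h) by exact: measurable_int ih.
have : (\int[leb]_(x in D) `|(EFin \o h) x| = 0)%E.
  rewrite -[RHS](_ : (\int[leb]_(x in D) (h x)%:E) = 0)%E; last first.
    by rewrite -[LHS]fineK ?integrable_fin_num// -/(Rintegral _ _ _) I0.
  by apply: eq_integral => x; rewrite inE => /h0 hx /=; rewrite ger0_norm.
move=> /(ae_eq_integral_abs leb mD mh).1 [N [mN N0 NP]].
have : (leb `]c, d[%classic <= leb N)%E.
  apply: le_measure; rewrite ?inE//; move=> x /=; rewrite in_itv/= => /hpos[Dx hx].
  by apply: NP => /= /(_ Dx)[] /eqP; rewrite gt_eqF.
rewrite N0 lebesgue_measure_itv/= lte_fin cd -EFinD lee_fin subr_le0 leNgt.
by rewrite cd.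
Qed.

(** Expand the integral of [(B h - A)^2 u]: this is the usual quadratic at its minimiser [A / B],
    cleared of denominators. *)
Lemma Rint_CauchySchwarz D h u : measurable D -> 0 < Rintegral leb D u ->
  (forall x, D x -> 0 <= u x) -> integrable_on D u ->
  integrable_on D (fun x => h x * u x) -> integrable_on D (fun x => h x ^+ 2 * u x) ->
  Rintegral leb D (fun x => h x * u x) ^+ 2 <=
  Rintegral leb D (fun x => h x ^+ 2 * u x) * Rintegral leb D u.
Proof.
move=> mD B0 u0 iu ihu ih2u.
set A := Rintegral leb D (fun x => h x * u x); set B := Rintegral leb D u in B0 *.
set C := Rintegral leb D (fun x => h x ^+ 2 * u x).
have : 0 <= Rintegral leb D (fun x => (B ^+ 2 * (h x ^+ 2 * u x) +
    (- (2 * A * B)) * (h x * u x)) + A ^+ 2 * u x).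
  apply: Rint_ge0 => x /u0 ux.
  rewrite (_ : _ + _ = (B * h x - A) ^+ 2 * u x); last by ring.
  by rewrite mulr_ge0// sqr_ge0.
rewrite RintegralD//; [|apply: integrable_onD => //; exact: integrable_onZ|exact: integrable_onZ].
rewrite RintegralD//; [|exact: integrable_onZ|exact: integrable_onZ].
rewrite !RintegralZl// -/A -/B -/C.
rewrite (_ : _ + _ = B * (C * B - A ^+ 2)); last by ring.
by rewrite pmulr_rge0// subr_ge0.
Qed.

(** Dominated convergence with majorant [|h|]. The limit [k] is left free: exhausting sets give [h]
    itself, shrinking tails give [0]. *)
Lemma cvg_Rint_sets D h k (A : (set R)^nat) : measurable D -> (forall n, measurable (A n)) ->
  integrable_on D h -> measurable_fun D k ->
  (forall x, D x -> \forall n \near \oo, (h \_ (A n)) x = k x) ->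
  Rintegral leb (D `&` A n) h @[n --> \oo] --> Rintegral leb D k.
Proof.
move=> mD mA ih mk hk.
have mh := integrable_on_measurable ih.
have [] := @dominated_convergence _ _ R leb D mD (fun n => EFin \o (h \_ (A n)))
  (EFin \o k) (EFin \o (fun x => `|h x|)).
- move=> n; apply/measurable_EFinP; apply/measurable_restrict => //.
    exact: mA.
  by apply: measurable_funS mh => //; exact: subIsetl.
- exact/measurable_EFinP.
- apply: aeW => x Dx; apply: cvg_near_cst; move: (hk x Dx); apply: filterS => n /= ->.
  by [].
- exact: integrable_on_norm.
- apply: aeW => x n Dx /=; rewrite lee_fin patchE; case: ifP => // _.
  by rewrite normr0.
- move=> ik _ cv.
  have /fine_cvg : (fun n => \int[leb]_(x in D) (EFin \o h \_ (A n)) x)%E @ \oo -->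
      (Rintegral leb D k)%:E.
    by rewrite /Rintegral fineK ?integrable_fin_num.
  apply: cvg_trans; apply: near_eq_cvg; apply: nearW => n /=.
  rewrite /Rintegral integral_mkcondr; congr fine; apply: eq_integral => x _ /=.
  by rewrite restrict_EFin.
Qed.

Lemma Rint_split h s x t : s <= x -> x <= t -> integrable_on `[s, t] h ->
  Rintegral leb `[s, t] h = Rintegral leb `[s, x] h + Rintegral leb `[x, t] h.
Proof.
move=> sx xt ih.
have ih' : integrable_on `]x, t] h.
  apply: integrable_onS ih => //; apply: subset_itv; rewrite bnd_simp//.
have := @Rintegral_itvB R h (BLeft s) (BRight t) x ih.
rewrite !bnd_simp sx xt => /(_ isT isT) E.
by rewrite -(Rintegral_itv_obnd_cbnd ih') -E addrC subrK.
Qed.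

(** Bounds on boundary terms arrive squared, from Cauchy-Schwarz; this form avoids square roots. *)
Lemma cvg0_sqr_le (u v : nat -> R) : (\forall n \near \oo, u n ^+ 2 <= v n) ->
  v n @[n --> \oo] --> (0 : R) -> u n @[n --> \oo] --> (0 : R).
Proof.
move=> uv v0; apply/cvgrPdist_lt => e e0.
have e20 : 0 < e ^+ 2 by rewrite exprn_gt0.
near=> n; rewrite sub0r normrN -(ltr_pXn2r (n := 2))// ?nnegrE ?ltW//.
rewrite real_normK ?num_real//; apply: (@le_lt_trans _ _ (v n)); first by near: n.
rewrite (le_lt_trans (ler_norm _))//; near: n.
by move/cvgrPdist_lt : v0 => /(_ _ e20); apply: filterS => n; rewrite sub0r normrN.
Unshelve. all: by end_near. Qed.
End RealIntegrable.

(** * Exhausting sequences and boundary terms *)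

Section Exhaustion.
Context {R : realType}.
Notation leb := (@lebesgue_measure R).
Variables (a w : \bar R).
Notation J := (supp_int a w).
Implicit Types (h g : R -> R) (x : R).

(** Boundary conditions are stated along one pair of sequences inside the support, which treats
    finite and infinite ends alike. Monotonicity serves monotone convergence and comparisons with
    [s 0] and [t 0]. *)
Definition exhausts (s t : nat -> R) := [/\ forall n, J (s n) /\ J (t n),
  forall n, s n <= t n, nonincreasing_seq s, nondecreasing_seq t &
  forall x, J x -> \forall n \near \oo, s n <= x <= t n].

Lemma exhaust_right x0 : J x0 -> exists t : nat -> R, [/\ forall k, J (t k), forall k, x0 <= t k,
  nondecreasing_seq t & forall x, J x -> \forall k \near \oo, x <= t k].
Proof.
move=> [ax0]; case: w => [r| |//] x0w.
- have d0 : 0 < r - x0 by rewrite subr_gt0 -lte_fin.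
  have x0t k : x0 <= r - (r - x0) / k.+1%:R.
    rewrite lerBrDr -lerBrDl ler_pdivrMr// ler_peMr ?(ltW d0)//.
    by rewrite ler1n.
  exists (fun k => r - (r - x0) / k.+1%:R); split => //.
  + move=> k; split; first by apply: lt_le_trans ax0 _; rewrite lee_fin.
    by rewrite lte_fin ltrBlDr ltrDl divr_gt0.
  + move=> k l kl; rewrite lerB// ler_pM2l// lef_pV2 ?posrE// ler_nat//.
  + move=> x [_]; rewrite lte_fin => xr.
    have : \forall k \near \oo, (r - x)^-1 * (r - x0) <= k%:R :> R.
      exact: nbhs_infty_ger.
    apply: filterS => k; rewrite ler_pdivrMl ?subr_gt0// => H.
    rewrite lerBrDl -lerBrDr ler_pdivrMr// (le_trans H)// ler_wpM2l ?subr_ge0 ?ltW//.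
    by rewrite ltr_nat.
- exists (fun k => x0 + k%:R); split.
  + move=> k; split; last by rewrite ltry.
    by apply: lt_le_trans ax0 _; rewrite lee_fin lerDl.
  + by move=> k; rewrite lerDl.
  + by move=> k l kl; rewrite lerD2l ler_nat.
  + move=> x _; have : \forall k \near \oo, x - x0 <= k%:R by exact: nbhs_infty_ger.
    by apply: filterS => k; rewrite lerBlDl.
Qed.

Lemma exhaust_left x0 : J x0 -> exists s : nat -> R, [/\ forall k, J (s k), forall k, s k <= x0,
  nonincreasing_seq s & forall x, J x -> \forall k \near \oo, s k <= x].
Proof.
move=> [+ x0w]; case: a => [r ax0|//|ax0].
- have d0 : 0 < x0 - r by rewrite subr_gt0 -lte_fin.
  have x0t k : r + (x0 - r) / k.+1%:R <= x0.
    rewrite -lerBrDl ler_pdivrMr// ler_peMr ?(ltW d0)//.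
    by rewrite ler1n.
  exists (fun k => r + (x0 - r) / k.+1%:R); split => //.
  + move=> k; split; last by apply: le_lt_trans x0w; rewrite lee_fin.
    by rewrite lte_fin ltrDl divr_gt0.
  + move=> k l kl; rewrite lerD2l ler_pM2l// lef_pV2 ?posrE// ler_nat//.
  + move=> x []; rewrite lte_fin => rx _.
    have : \forall k \near \oo, (x - r)^-1 * (x0 - r) <= k%:R :> R.
      exact: nbhs_infty_ger.
    apply: filterS => k; rewrite ler_pdivrMl ?subr_gt0// => H.
    rewrite -lerBrDl ler_pdivrMr// (le_trans H)// ler_wpM2l ?subr_ge0 ?ltW//.
    by rewrite ltr_nat.
- exists (fun k => x0 - k%:R); split.
  + move=> k; split; first by rewrite ltNyr.
    by apply: le_lt_trans x0w; rewrite lee_fin gerBl.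
  + by move=> k; rewrite gerBl.
  + by move=> k l kl; rewrite lerD2l lerN2 ler_nat.
  + move=> x _; have : \forall k \near \oo, x0 - x <= k%:R by exact: nbhs_infty_ger.
    by apply: filterS => k; rewrite lerBlDl lerBlDr.
Qed.

Lemma exhausts_ex x0 : J x0 -> exists s t, exhausts s t.
Proof.
move=> Jx0; have [t [Jt xt ndt tx]] := exhaust_right Jx0.
have [s [Js sx nis xs]] := exhaust_left Jx0.
exists s, t; split => //; first by move=> k; exact: le_trans (sx k) (xt k).
by move=> x Jx; near=> k; apply/andP; split; near: k; [exact: xs|exact: tx].
Unshelve. all: by end_near. Qed.

Lemma setI_supp_itv s t : J s -> J t -> J `&` `[s, t]%classic = `[s, t]%classic.
Proof.
move=> Js Jt; apply/setIidr => x /=; rewrite in_itv/=; exact: supp_int_convex.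
Qed.

Lemma cvg_Rint_exhaust h (s t : nat -> R) : exhausts s t -> integrable_on J h ->
  Rintegral leb `[s n, t n] h @[n --> \oo] --> Rintegral leb J h.
Proof.
move=> [Jst st _ _ stx] ih.
have := @cvg_Rint_sets _ J h h (fun n => `[s n, t n]%classic) (supp_int_measurable a w) _ ih (integrable_on_measurable ih) _.
have -> : (fun n => Rintegral leb `[s n, t n] h) =
    (fun n => Rintegral leb (J `&` `[s n, t n]) h).
  by apply/funext => n; rewrite (setI_supp_itv (Jst n).1 (Jst n).2).
apply=> // x /stx; apply: filterS => n sxt.
by rewrite patchE mem_set//= in_itv.
Qed.

Lemma cvg_Rint_tail_right h (s t : nat -> R) : exhausts s t -> integrable_on J h ->
  Rintegral leb (J `&` `]t n, +oo[) h @[n --> \oo] --> (0 : R).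
Proof.
move=> [Jst st _ _ stx] ih.
rewrite [X in _ --> X](_ : _ = Rintegral leb J (fun=> 0)); last by rewrite Rintegral_cst ?mul0r//; exact: supp_int_measurable.
apply: cvg_Rint_sets => //; first exact: supp_int_measurable.
move=> x /stx; apply: filterS => n /andP[_ xt].
by rewrite patchE memNset//= in_itv/= andbT ltNge xt.
Qed.

Lemma cvg_Rint_tail_left h (s t : nat -> R) : exhausts s t -> integrable_on J h ->
  Rintegral leb (J `&` `]-oo, s n]) h @[n --> \oo] --> (0 : R).
Proof.
move=> [Jst st _ _ stx] ih.
rewrite [X in _ --> X](_ : _ = Rintegral leb J (fun=> 0)); last by rewrite Rintegral_cst ?mul0r//; exact: supp_int_measurable.
apply: cvg_Rint_sets => //; first exact: supp_int_measurable.
(* This tail is closed at [s n], so [s n < x] must be strict; the exhaustion property is applied to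
   some [y < x]. *)
move=> x /supp_int_enlarge[y [z [Jy _ /andP[yx _]]]].
move: (stx y Jy); apply: filterS => n /andP[/le_lt_trans/(_ yx) xt _].
by rewrite patchE memNset//= in_itv/= leNgt xt.
Qed.

(** Monotone convergence: a uniform bound on the segments creates integrability on [J], besides
    bounding the integral. *)
Lemma integrable_on_exhaust h (s t : nat -> R) M : exhausts s t -> measurable_fun J h ->
  (forall x, J x -> 0 <= h x) ->
  (forall n, integrable_on `[s n, t n] h) ->
  (\forall n \near \oo, Rintegral leb `[s n, t n] h <= M) ->
  integrable_on J h /\ Rintegral leb J h <= M.
Proof.
move=> est mh h0 ih hM; have [Jst st nis ndt stx] := est.
have sub n : `[s n, t n] `<=` J.
  by move=> x /=; rewrite in_itv/=; exact: supp_int_convex (Jst n).1 (Jst n).2.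
suff ihJ : integrable_on J h.
  split => //; have cv := cvg_Rint_exhaust est ihJ.
  by rewrite -(cvg_lim _ cv)//; apply: limr_le => //; apply/cvg_ex; eexists; exact: cv.
have EJ : \bigcup_n `[s n, t n]%classic = J.
  apply/seteqP; split => [x [n _]|x Jx]; first exact: sub.
  have [n sxt] := filter_ex (stx x Jx).
  by exists n => //=; rewrite in_itv.
have := @ge0_nondecreasing_set_cvg_integral _ (measurableTypeR R) R (fun n => `[s n, t n]%classic) (EFin \o h) leb.
move=> /(_ _ _ _ _)/=; rewrite EJ => cv.
apply/integrableP; split; first exact/measurable_EFinP.
apply: (@le_lt_trans _ _ M%:E); last exact: ltry.
rewrite [leLHS](_ : _ = \int[leb]_(x in J) (h x)%:E)%E; last first.
  by apply: eq_integral => x; rewrite inE => /h0 hx /=; rewrite ger0_norm.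
have {}cv : (\int[leb]_(x in `[s n, t n]) (h x)%:E)%E @[n --> \oo] --> (\int[leb]_(x in J) (h x)%:E)%E.
  apply: cv.
  - move=> n m nm; apply/subsetPset; apply: subset_itv; rewrite bnd_simp; [exact: nis|exact: ndt].
  - by [].
  - move=> n; apply/measurable_EFinP; apply: measurable_funS mh => //.
    exact: supp_int_measurable.
  - by move=> n x /sub /h0; rewrite lee_fin.
rewrite -(cvg_lim _ cv)//; apply: lime_le.
  by apply/cvg_ex; eexists; exact: cv.
move: hM; apply: filterS => n; rewrite /Rintegral -lee_fin fineK//.
exact: integrable_fin_num (ih n).
Qed.

Lemma integrable_on_supp_itv h x y : integrable_on J h -> J x -> J y ->
  integrable_on `[x, y] h.
Proof.
move=> ih Jx Jy; apply: integrable_onS ih => //; first exact: supp_int_measurable.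
move=> z /=; rewrite in_itv/=; exact: supp_int_convex Jx Jy.
Qed.

Lemma ac_on_tail_right h h1 (s t : nat -> R) x : exhausts s t -> ac_on a w h h1 ->
  integrable_on J h1 -> h (t n) @[n --> \oo] --> (0 : R) -> J x ->
  Rintegral leb (J `&` `]x, +oo[) h1 = - h x.
Proof.
move=> est ach ih ht Jx; have [Jst st _ _ stx] := est.
have mJ := supp_int_measurable a w.
have mJx : measurable (J `&` `]x, +oo[) by exact: measurableI.
have ih' : integrable_on (J `&` `]x, +oo[) h1 by apply: integrable_onS ih => // y [].
have cv : Rintegral leb ((J `&` `]x, +oo[) `&` `[x, t n]) h1 @[n --> \oo] -->
    Rintegral leb (J `&` `]x, +oo[) h1.
  apply: cvg_Rint_sets => //; first exact: integrable_on_measurable.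
  move=> y [Jy]; rewrite /= in_itv/= andbT => xy; move: (stx y Jy); apply: filterS => n /andP[_ yt].
  by rewrite patchE mem_set//= in_itv/= (ltW xy).
have /cvg_lim <- // := cv; apply/cvg_lim => //.
have cv2 : (h (t n) - h x) @[n --> \oo] --> (0 - h x : R) by apply: cvgB => //; exact: cvg_cst.
rewrite -[X in _ --> X]sub0r; apply: cvg_trans cv2; apply: near_eq_cvg.
move: (stx x Jx); apply: filterS => n /andP[_ xt].
have iit := integrable_on_supp_itv ih Jx (Jst n).2.
rewrite -(ac_on_FTC ach Jx (Jst n).2 xt iit) -Rintegral_itv_obnd_cbnd; last first.
  by apply: integrable_onS iit => //; apply: subset_itvr; rewrite bnd_simp.
congr (Rintegral _ _ _); apply/seteqP; split => y /=; rewrite !in_itv/= andbT.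
  by move=> /andP[xy yt]; split; [split => //; apply: supp_int_convex Jx (Jst n).2 _; rewrite (ltW xy)|rewrite (ltW xy)].
by move=> [[_ ->] /andP[_ ->]].
Qed.

Lemma ac_on_tail_left h h1 (s t : nat -> R) x : exhausts s t -> ac_on a w h h1 ->
  integrable_on J h1 -> h (s n) @[n --> \oo] --> (0 : R) -> J x ->
  Rintegral leb (J `&` `]-oo, x]) h1 = h x.
Proof.
move=> est ach ih hs Jx; have [Jst st _ _ stx] := est.
have mJ := supp_int_measurable a w.
have mJx : measurable (J `&` `]-oo, x]) by exact: measurableI.
have ih' : integrable_on (J `&` `]-oo, x]) h1 by apply: integrable_onS ih => // y [].
have cv : Rintegral leb ((J `&` `]-oo, x]) `&` `[s n, x]) h1 @[n --> \oo] -->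
    Rintegral leb (J `&` `]-oo, x]) h1.
  apply: cvg_Rint_sets => //; first exact: integrable_on_measurable.
  move=> y [Jy]; rewrite /= in_itv/= => yx; move: (stx y Jy); apply: filterS => n /andP[sy _].
  by rewrite patchE mem_set//= in_itv/= sy.
have /cvg_lim <- // := cv; apply/cvg_lim => //.
have cv2 : (h x - h (s n)) @[n --> \oo] --> (h x - 0 : R) by apply: cvgB => //; exact: cvg_cst.
rewrite -[X in _ --> X]subr0; apply: cvg_trans cv2; apply: near_eq_cvg.
move: (stx x Jx); apply: filterS => n /andP[sx _].
have iit := integrable_on_supp_itv ih (Jst n).1 Jx.
rewrite -(ac_on_FTC ach (Jst n).1 Jx sx iit).
congr (Rintegral _ _ _); apply/seteqP; split => y /=; rewrite !in_itv/=.
  by move=> /andP[sy yx]; split; [split => //; apply: supp_int_convex (Jst n).1 Jx _; rewrite sy|rewrite sy].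
by move=> [[_ ->] /andP[-> _]].
Qed.

Lemma Rint_supp_split h x : integrable_on J h ->
  Rintegral leb J h = Rintegral leb (J `&` `]-oo, x]) h + Rintegral leb (J `&` `]x, +oo[) h.
Proof.
move=> ih; have mJ := supp_int_measurable a w.
have E : J = (J `&` `]-oo, x]) `|` (J `&` `]x, +oo[).
  rewrite -setIUr -[LHS]setIT; congr (_ `&` _); apply/esym/seteqP; split => // y _ /=.
  by rewrite !in_itv/= andbT; case: (leP y x); [left|right].
rewrite [in LHS]E Rintegral_setU//.
- exact: measurableI.
- exact: measurableI.
- by rewrite -E.
- apply/disj_setPS => y [[_ /=]]; rewrite in_itv/= => yx [_]; rewrite /= in_itv/= andbT.
  by rewrite ltNge yx.
Qed.

Lemma is_derive_Rint_left h x : integrable_on J h -> cont_on a w h -> J x ->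
  is_derive x 1 (fun y => Rintegral leb (J `&` `]-oo, y]) h) (h x).
Proof.
move=> ih ch Jx; have mJ := supp_int_measurable a w.
have ih' : leb.-integrable setT (EFin \o (h \_ J)).
  by rewrite -restrict_EFin; apply/(integrable_mkcond _ _).1.
have -> : (fun y => Rintegral leb (J `&` `]-oo, y]) h) =
    (fun y => Rintegral leb `]-oo, y] (h \_ J)).
  by apply/funext => y; rewrite setIC Rintegral_mkcondr.
have [||||dF F1] := @continuous_FTC1 R (h \_ J) -oo%O x (x + 1).
- by rewrite ltrDl.
- by apply: integrableS ih'.
- by rewrite ltNyr.
- have JJ : nbhs x J by exact: (open_nbhs_nbhs (conj (@supp_int_open R a w) Jx)).
  rewrite /prop_for /continuous_at patchE mem_set//.
  apply: cvg_trans (ch x Jx); apply: near_eq_cvg; move: JJ; apply: filterS => y Jy.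
  by rewrite patchE mem_set.
- by apply: DeriveDef => //; rewrite -derive1E F1 patchE mem_set.
Qed.

(** The form taken by integration by parts on [J]: [h] will be a product whose values vanish along
    both sequences. *)
Lemma ac_on_int0 h h1 (s t : nat -> R) : exhausts s t -> ac_on a w h h1 -> integrable_on J h1 ->
  h (s n) @[n --> \oo] --> (0 : R) -> h (t n) @[n --> \oo] --> (0 : R) -> Rintegral leb J h1 = 0.
Proof.
move=> est ach ih hs ht; have [Jst st _ _ _] := est.
have /cvg_lim <- // := cvg_Rint_exhaust est ih.
apply/cvg_lim => //; rewrite -[X in _ --> X]subr0.
have cv : (h (t n) - h (s n)) @[n --> \oo] --> (0 - 0 : R) by exact: cvgB.
apply: cvg_trans cv; apply: near_eq_cvg; apply: nearW => n /=.
rewrite (ac_on_FTC ach (Jst n).1 (Jst n).2)//.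
apply: integrable_onS ih => //; first exact: supp_int_measurable.
move=> x /=; rewrite in_itv/=; exact: supp_int_convex (Jst n).1 (Jst n).2.
Qed.
End Exhaustion.

(** For [x] outside the interval, [x - z] would keep one strict sign and the integral could not
    vanish. *)
Lemma mean_in_supp (R : realType) (a w : \bar R) (W : R -> R) x y :
  supp_int a w y -> (forall x, supp_int a w x -> 0 < W x) ->
  integrable_on (supp_int a w) (fun z => (x - z) * W z) ->
  Rintegral (@lebesgue_measure R) (supp_int a w) (fun z => (x - z) * W z) = 0 ->
  supp_int a w x.
Proof.
set J := supp_int a w; set leb := (@lebesgue_measure R).
move=> Jy W_gt0 iW I0; apply: contrapT => nJ.
have mJ : measurable J by exact: supp_int_measurable.
have [c [d [Jc Jd cd]]] := supp_int_enlarge Jy.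
have {}cd : c < d by case/andP: cd; exact: lt_trans.
have sub z : c < z < d -> J z.
  by move=> /andP[cz zd]; apply: supp_int_convex Jc Jd _; rewrite !ltW.
have [ltx|gtx] : (forall z, J z -> z < x) \/ (forall z, J z -> x < z).
  have [c0|c0] := ltP c x; [left|right] => z Jz; rewrite ltNge; apply/negP => xz; apply: nJ.
    by apply: supp_int_convex Jc Jz _; rewrite xz ltW.
  by apply: supp_int_convex Jz Jc _; rewrite xz.
- have /lt_eqF/eqP : 0 < Rintegral leb J (fun z => (x - z) * W z).
    apply: Rint_gt0 cd _ => //.
      by move=> z Jz; rewrite mulr_ge0 ?subr_ge0 ?ltW ?ltx ?W_gt0.
    by move=> z /sub Jz; split => //; rewrite mulr_gt0 ?subr_gt0 ?ltx ?W_gt0.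
  by rewrite I0.
- have /lt_eqF/eqP : 0 < Rintegral leb J (fun z => -1 * ((x - z) * W z)).
    apply: Rint_gt0 cd _ => //; first exact: integrable_onZ.
      by move=> z Jz; rewrite mulN1r -mulNr opprB mulr_ge0 ?subr_ge0 ?ltW ?gtx ?W_gt0.
    by move=> z /sub Jz; split => //; rewrite mulN1r -mulNr opprB mulr_gt0 ?subr_gt0 ?gtx ?W_gt0.
  by rewrite RintegralZl// I0 mulr0.
Qed.

(** * Spectral gap of Pearson weights *)

(** Orthogonality passes from one weight to the next through derivatives of test polynomials; this
    says that every polynomial is such a derivative, at the cost of one degree. *)
Lemma deriv_onto (K : numFieldType) (p : {poly K}) m : (size p <= m)%N ->
  exists2 P : {poly K}, (size P <= m.+1)%N & p = P^`().
Proof.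
move=> sp; exists (\poly_(i < m.+1) (p`_i.-1 / i%:R)); first exact: size_poly.
apply/polyP => i; rewrite coef_deriv coef_poly ltnS; case: ltnP => im /=.
  by rewrite -[RHS]mulr_natr divfK// pnatr_eq0.
by rewrite mul0rn nth_default// (leq_trans sp).
Qed.

Section Pearson.
Context {R : realType}.
Notation leb := (@lebesgue_measure R).
Variables (a w : \bar R).
Notation J := (supp_int a w).
Variables (s t : nat -> R) (delta beta gamma : R).
Notation q := (qpol delta beta gamma).
Hypothesis est : exhausts a w s t.
Hypothesis delta0 : delta <= 0.
Hypothesis q_gt0 : forall x, J x -> 0 < q x.
Implicit Types (W h : R -> R) (p : {poly R}) (kap x : R).

Lemma is_derive_qpol x : is_derive x 1 (q : R -> R) (2 * delta * x + beta).
Proof.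
have -> : (q : R -> R) = horner (delta *: 'X^2 + beta *: 'X + gamma%:P).
  by apply/funext => y; rewrite /qpol !hornerE.
apply: trigger_derive; rewrite !derivD !derivZ derivXn derivX derivC !hornerE/=; ring.
Qed.

Lemma qpol_horner x : q x = (delta *: 'X^2 + beta *: 'X + gamma%:P).[x].
Proof. by rewrite /qpol !hornerE. Qed.

Lemma cont_on_qpol : cont_on a w q.
Proof.
move=> x _; apply/differentiable_continuous/derivable1_diffP.
by apply: ex_derive; exact: is_derive_qpol.
Qed.

Lemma cont_on_horner p : cont_on a w (horner p).
Proof. by move=> x _; exact: continuous_horner. Qed.

Lemma cont_onM h k : cont_on a w h -> cont_on a w k -> cont_on a w (fun x => h x * k x).
Proof. by move=> ch ck x Jx; apply: cvgM; [exact: ch|exact: ck]. Qed.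

Lemma cont_onD h k : cont_on a w h -> cont_on a w k -> cont_on a w (fun x => h x + k x).
Proof. by move=> ch ck x Jx; apply: cvgD; [exact: ch|exact: ck]. Qed.

Lemma cont_onN h : cont_on a w h -> cont_on a w (fun x => - h x).
Proof. by move=> ch x Jx; apply: cvgN; exact: ch. Qed.

Lemma cont_onV h : cont_on a w h -> (forall x, J x -> h x != 0) -> cont_on a w (fun x => (h x)^-1).
Proof. by move=> ch h0 x Jx; apply: cvgV; [exact: h0|exact: ch]. Qed.

Lemma cont_onX h n : cont_on a w h -> cont_on a w (fun x => h x ^+ n).
Proof.
move=> ch; elim: n => [|n IH].
  have -> : (fun x => h x ^+ 0) = (fun=> 1) by apply/funext => x; rewrite expr0.
  by move=> x _; exact: cvg_cst.
have -> : (fun x => h x ^+ n.+1) = (fun x => h x * h x ^+ n).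
  by apply/funext => x; rewrite exprS.
exact: cont_onM.
Qed.

(** The last two clauses range over all polynomials so that the class is stable under passing from
    [W] to [q W]: the factor [q] is absorbed into [p]. *)
Definition pearson W kap x0 : Prop :=
  [/\ forall x, J x -> 0 < W x, cont_on a w W,
   forall x, J x -> is_derive x 1 (fun y => q y * W y) (kap * (x0 - x) * W x),
   forall p, integrable_on J (fun x => p.[x] * W x) &
   forall p, p.[s n] * (q (s n) * W (s n)) @[n --> \oo] --> (0 : R) /\
             p.[t n] * (q (t n) * W (t n)) @[n --> \oo] --> (0 : R)].

Let mJ : measurable J := supp_int_measurable a w.

Lemma J_nonempty : J (s 0%N). Proof. by case: est => H _ _ _ _; exact: (H 0%N).1. Qed.

(** [(q^2 W)' = (q' + kap (x0 - x)) q W] with [q' = 2 delta x + beta]: an affine function times the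
    new weight, whose slope [- (kap - 2 delta)] and root are the new constants. *)
Lemma pearson_next W kap x0 : 0 < kap -> pearson W kap x0 ->
  pearson (fun x => q x * W x) (kap - 2 * delta) ((kap * x0 + beta) / (kap - 2 * delta)).
Proof.
move=> kap0 [W0 cW dW iW bW]; have k2 : 0 < kap - 2 * delta by move: kap0 delta0; lra.
split.
- by move=> x Jx; rewrite mulr_gt0 ?q_gt0 ?W0.
- by apply: cont_onM => //; exact: cont_on_qpol.
- move=> x Jx; have := dW x Jx => dWx; have dq := is_derive_qpol x.
  apply: trigger_derive; rewrite /GRing.scale/=; field; exact: lt0r_neq0.
- move=> p; apply: eq_integrable_on (iW (p * (delta *: 'X^2 + beta *: 'X + gamma%:P))) => // x _.
  by rewrite hornerM -qpol_horner mulrA.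
- move=> p; have [bs bt] := bW (p * (delta *: 'X^2 + beta *: 'X + gamma%:P)).
  split; [move: bs|move: bt]; apply: cvg_trans; apply: near_eq_cvg; apply: nearW => n;
    by rewrite hornerM -qpol_horner !mulrA.
Qed.

Lemma Rint_le_subset (D E : set R) (g : R -> R) : measurable D -> measurable E -> D `<=` E ->
  integrable_on E g -> (forall x, E x -> 0 <= g x) -> Rintegral leb D g <= Rintegral leb E g.
Proof.
move=> mD mE DE ig g0; rewrite /Rintegral fine_le//.
- by apply: integrable_fin_num => //; exact: integrable_onS ig.
- exact: integrable_fin_num ig.
- apply: ge0_subset_integral => //; first exact: measurable_int ig.
Qed.

Definition gap (m : nat) : Prop := forall W kap x0, 0 < kap -> pearson W kap x0 ->
  forall h h1, ac_on a w h h1 -> integrable_on J (fun x => h1 x ^+ 2 * (q x * W x)) ->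
  (forall p, (size p <= m)%N -> Rintegral leb J (fun x => h x * p.[x] * W x) = 0) ->
  m%:R * (kap - (m%:R - 1) * delta) * Rintegral leb J (fun x => h x ^+ 2 * W x) <=
  Rintegral leb J (fun x => h1 x ^+ 2 * (q x * W x)).

Section Weight.
Variables (W : R -> R) (kap x0 : R).
Hypotheses (kap0 : 0 < kap) (PW : pearson W kap x0).
Let V x := q x * W x.
Let L x := kap * (x0 - x).

Lemma W_gt0 x : J x -> 0 < W x. Proof. by case: PW => + _ _ _ _; exact. Qed.
Lemma cont_W : cont_on a w W. Proof. by case: PW. Qed.
Lemma V_gt0 x : J x -> 0 < V x. Proof. by move=> Jx; rewrite mulr_gt0 ?q_gt0 ?W_gt0. Qed.
Lemma cont_V : cont_on a w V.
Proof. by apply: cont_onM; [exact: cont_on_qpol|exact: cont_W]. Qed.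
Lemma cont_L : cont_on a w L.
Proof.
have -> : L = horner (kap *: (x0%:P - 'X)) by apply/funext => x; rewrite /L !hornerE.
exact: cont_on_horner.
Qed.
Lemma is_derive_V x : J x -> is_derive x 1 V (L x * W x).
Proof. by move=> Jx; case: PW => _ _ H _ _; exact: (H x Jx). Qed.
Lemma ac_V : ac_on a w V (fun x => L x * W x).
Proof.
apply: ac_on_C1; first exact: is_derive_V.
by apply: cont_onM; [exact: cont_L|exact: cont_W].
Qed.
Lemma int_polyW p : integrable_on J (fun x => p.[x] * W x).
Proof. by case: PW. Qed.
Lemma int_polyV p : integrable_on J (fun x => p.[x] * V x).
Proof. by case: (pearson_next kap0 PW). Qed.
Lemma int_W : integrable_on J W.
Proof. by apply: eq_integrable_on (int_polyW 1) => // x _; rewrite hornerE mul1r. Qed.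
Lemma int_LW : integrable_on J (fun x => L x * W x).
Proof.
by apply: eq_integrable_on (int_polyW (kap *: (x0%:P - 'X))) => // x _; rewrite /L !hornerE.
Qed.
Lemma cvg_polyV p : p.[s n] * V (s n) @[n --> \oo] --> (0 : R) /\
             p.[t n] * V (t n) @[n --> \oo] --> (0 : R).
Proof. by case: PW. Qed.
Lemma cvg_V : V (s n) @[n --> \oo] --> (0 : R) /\ V (t n) @[n --> \oo] --> (0 : R).
Proof.
have [bs bt] := cvg_polyV 1.
split; [move: bs|move: bt]; apply: cvg_trans; apply: near_eq_cvg; apply: nearW => n;
  by rewrite -polyC1 hornerC mul1r.
Qed.

Lemma measurable_W : measurable_fun J W. Proof. by apply: cont_on_measurable; exact: cont_W. Qed.
Lemma measurable_V : measurable_fun J V. Proof. by apply: cont_on_measurable; exact: cont_V. Qed.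

Lemma V_tail_right x : J x -> Rintegral leb (J `&` `]x, +oo[) (fun x => L x * W x) = - V x.
Proof. by move=> Jx; apply: ac_on_tail_right est ac_V int_LW cvg_V.2 Jx. Qed.
Lemma V_tail_left x : J x -> Rintegral leb (J `&` `]-oo, x]) (fun x => L x * W x) = V x.
Proof. by move=> Jx; apply: ac_on_tail_left est ac_V int_LW cvg_V.1 Jx. Qed.

Lemma int_LW0 : Rintegral leb J (fun x => L x * W x) = 0.
Proof. by apply: ac_on_int0 est ac_V int_LW cvg_V.1 cvg_V.2. Qed.

(** The integral of [V' = L W] over [J] is zero, so [L] changes sign inside [J]. The estimates below
    treat the two sides of [x0] separately. *)
Lemma root_in_supp : J x0.
Proof.
apply: (@mean_in_supp _ _ _ W); [exact: J_nonempty|exact: W_gt0| |].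
  apply: eq_integrable_on (integrable_onZ kap^-1 mJ int_LW) => // x _.
  by rewrite /L -!mulrA mulKf// gt_eqF.
have := int_LW0; rewrite (eq_Rint (k := fun x => kap * ((x0 - x) * W x))); last by move=> x _; rewrite mulrA.
have ik : integrable_on J (fun x => (x0 - x) * W x).
  apply: eq_integrable_on (integrable_onZ kap^-1 mJ int_LW) => // x _.
  by rewrite /L -!mulrA mulKf// gt_eqF.
by rewrite RintegralZl// => /eqP; rewrite mulf_eq0 (gt_eqF kap0) => /eqP.
Qed.

(** As [delta <= 0], [q] lies below an affine function, whose constant part is at most a multiple of
    [|x - x0|] once [|x - x0| >= eta]. Hence [|L|] dominates [q] away from [x0]. The summand [1]
    only makes [C] positive. *)
Lemma qpol_le_dist eta : 0 < eta -> exists2 C, 0 < C & forall x, eta <= `|x - x0| ->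
  q x <= C * `|x - x0|.
Proof.
move=> eta0; exists (`|beta| + (`|beta| * `|x0| + `|gamma|) / eta + 1).
  by rewrite ltr_wpDl// addr_ge0// divr_ge0 ?(ltW eta0)// addr_ge0// mulr_ge0.
move=> x xeta; apply: (@le_trans _ _ (`|beta| * `|x - x0| + (`|beta| * `|x0| + `|gamma|))).
  rewrite /qpol; apply: (@le_trans _ _ (beta * x + gamma)).
    by rewrite -addrA gerDr; rewrite mulr_le0_ge0// sqr_ge0.
  rewrite addrA lerD ?ler_norm// -mulrDr (le_trans (ler_norm _))// normrM ler_wpM2l//.
  by rewrite -{1}(subrK x0 x) ler_normD.
have B0 : 0 <= `|beta| * `|x0| + `|gamma| by rewrite addr_ge0// mulr_ge0.
have : `|beta| * `|x0| + `|gamma| <= (`|beta| * `|x0| + `|gamma|) / eta * `|x - x0|.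
  by rewrite mulrAC ler_pdivlMr// ler_wpM2l.
by rewrite !mulrDl mul1r; have := normr_ge0 (x - x0); lra.
Qed.

(** * Hardy estimate and integration by parts against polynomials *)

Section Hardy.
Variables (h h1 : R -> R).
Hypotheses (ach : ac_on a w h h1) (ih1 : integrable_on J (fun x => h1 x ^+ 2 * V x)).
Let ch : cont_on a w h := ac_on_cont ach.
Let mh1 : measurable_fun J h1. Proof. by case: ach. Qed.
Let mh : measurable_fun J h := cont_on_measurable ch.
Let M1 := Rintegral leb J (fun x => h1 x ^+ 2 * V x).

(* From (h^2 V)' = 2 h h1 V + h^2 L W; away from x0 the last term absorbs the
   mixed one, by AM-GM and V <= C |x - x0| W. The sign sg selects the side. *)
Lemma hardy_side (sg eta C c d : R) : J c -> J d -> c <= d -> sg ^+ 2 = 1 -> 0 < C ->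
  (forall x, c <= x <= d -> sg * (x - x0) = `|x - x0| /\ eta <= `|x - x0| /\
     q x <= C * `|x - x0|) ->
  sg * (h d ^+ 2 * V d - h c ^+ 2 * V c) +
   kap * eta / 2 * Rintegral leb `[c, d] (fun x => h x ^+ 2 * W x) <= 2 * C / kap * M1.
Proof.
move=> Jc Jd cd sg1 C0 Hx.
have sub : `[c, d]%classic `<=` J.
  by move=> x /=; rewrite in_itv/=; exact: supp_int_convex Jc Jd.
have mcd (g : R -> R) : measurable_fun J g -> measurable_fun `[c, d] g.
  by apply: measurable_funS.
have ac2 := ac_onM (ac_onM ach ach) ac_V.
have i1 : integrable_on `[c, d] (fun x => h x * h1 x * V x).
  apply: integrable_on_mul => //; [exact: mcd|exact: mcd|by apply: mcd; exact: measurable_V| | |].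
  - by move=> x /sub/V_gt0/ltW.
  - apply: cont_on_integrable Jc Jd; apply: cont_onM cont_V; exact: cont_onX.
  - exact: integrable_on_supp_itv ih1 Jc Jd.
have i2 : integrable_on `[c, d] (fun x => h x ^+ 2 * (L x * W x)).
  apply: cont_on_integrable Jc Jd; apply: cont_onM; first exact: cont_onX.
  by apply: cont_onM; [exact: cont_L|exact: cont_W].
have i3 : integrable_on `[c, d] (fun x => h x ^+ 2 * W x).
  by apply: cont_on_integrable Jc Jd; apply: cont_onM cont_W; exact: cont_onX.
have ie : integrable_on `[c, d] (fun x => (h1 x * h x + h x * h1 x) * V x + (h x * h x) * (L x * W x)).
  apply: eq_integrable_on (integrable_onD _ (integrable_onZ 2 _ i1) i2) => // x _; ring.
have F := ac_on_FTC ac2 Jc Jd cd ie; rewrite !expr2 -F.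
rewrite -RintegralZl// -RintegralZl//.
have i4 : integrable_on `[c, d] (fun x => h1 x ^+ 2 * V x) by exact: integrable_on_supp_itv ih1 Jc Jd.
rewrite -RintegralD//; [|exact: integrable_onZ|exact: integrable_onZ].
apply: (@le_trans _ _ (Rintegral leb `[c, d] (fun x => 2 * C / kap * (h1 x ^+ 2 * V x)))).
  apply: le_Rintegral => //.
  - by apply: integrable_onD => //; exact: integrable_onZ.
  - exact: integrable_onZ.
  move=> x /[dup] /sub Jx /=; rewrite in_itv/= => /Hx [sgx [etax qx]].
  have B0 := W_gt0 Jx; have A0 := V_gt0 Jx.
  (* [e] is tuned so that the [h^2 V] part of AM-GM costs at most half of [|L| h^2 W]; the other
     half, at least [kap eta / 2] times [h^2 W], is what the statement keeps. *)
  pose e := kap / (2 * C); have e0 : 0 < e by rewrite divr_gt0// mulr_gt0.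
  have eC : e * C = kap / 2 by rewrite /e; field; rewrite gt_eqF.
  have ei : 2 * C / kap = e^-1 by rewrite /e invf_div.
  have sL : sg * L x = - kap * `|x - x0| by rewrite -sgx /L; ring.
  have H1 : kap * eta / 2 * (h x ^+ 2 * W x) <= kap / 2 * `|x - x0| * (h x ^+ 2 * W x).
    rewrite ler_wpM2r//; first by rewrite mulr_ge0 ?sqr_ge0// ltW.
    by rewrite mulrAC ler_wpM2l// divr_ge0// ltW.
  have H2 : e * (h x ^+ 2 * V x) <= kap / 2 * `|x - x0| * (h x ^+ 2 * W x).
    have HV : V x <= C * `|x - x0| * W x by rewrite ler_wpM2r// ltW.
    have eh : 0 <= e * h x ^+ 2 by rewrite mulr_ge0 ?sqr_ge0// ltW.
    have E2 : e * h x ^+ 2 * (C * `|x - x0| * W x) =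
      (e * C) * `|x - x0| * (h x ^+ 2 * W x) by ring.
    by rewrite mulrA; have := ler_wpM2l eh HV; rewrite E2 eC.
  have H3 : 0 <= (e * (h x - sg * h1 x / e) ^+ 2) * V x.
    by rewrite mulr_ge0 ?(ltW A0)// mulr_ge0 ?sqr_ge0// ltW.
  have E3 : (e * (h x - sg * h1 x / e) ^+ 2) * V x =
    e * (h x ^+ 2 * V x) - 2 * sg * (h x * h1 x * V x) + sg ^+ 2 * (e^-1 * (h1 x ^+ 2 * V x)).
    by field; rewrite gt_eqF.
  rewrite E3 sg1 mul1r in H3; rewrite ei.
  have -> : sg * ((h1 x * h x + h x * h1 x) * V x + h x * h x * (L x * W x)) =
    2 * sg * (h x * h1 x * V x) + (sg * L x) * (h x ^+ 2 * W x) by ring.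
  rewrite sL; move: H1 H2 H3; lra.
rewrite RintegralZl// ler_wpM2l//; first by rewrite divr_ge0 ?mulr_ge0 ?ltW.
apply: Rint_le_subset => // x Jx; by rewrite mulr_ge0 ?sqr_ge0// ltW// V_gt0.
Qed.

(** Beyond [s0] and [t0] the one-sided estimate bounds the integral and the outer endpoint value at
    once, because both enter with a plus sign; the middle segment is compact. *)
Lemma hardy : integrable_on J (fun x => h x ^+ 2 * W x) /\
  exists M, \forall n \near \oo, h (s n) ^+ 2 * V (s n) <= M /\ h (t n) ^+ 2 * V (t n) <= M.
Proof.
have [s0 [t0 [Js0 Jt0 /andP[sx xt]]]] := supp_int_enlarge root_in_supp.
pose eta := Num.min (x0 - s0) (t0 - x0).
have eta0 : 0 < eta by rewrite lt_min !subr_gt0 sx xt.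
have [C C0 qC] := qpol_le_dist eta0.
pose B := 2 * C / kap * M1; pose k := kap * eta / 2.
have k0 : 0 < k by rewrite divr_gt0// mulr_gt0.
have P0 x : J x -> 0 <= h x ^+ 2 * V x by move=> Jx; rewrite mulr_ge0 ?sqr_ge0// ltW// V_gt0.
have I0 c d : J c -> J d -> 0 <= Rintegral leb `[c, d] (fun x => h x ^+ 2 * W x).
  move=> Jc Jd; apply: Rint_ge0 => x /=; rewrite in_itv/= => /(supp_int_convex Jc Jd) Jx.
  by rewrite mulr_ge0 ?sqr_ge0// ltW// W_gt0.
have ir c d : J c -> J d -> integrable_on `[c, d] (fun x => h x ^+ 2 * W x).
  by move=> Jc Jd; apply: cont_on_integrable Jc Jd; apply: cont_onM cont_W; exact: cont_onX.
have right y : J y -> t0 <= y -> h y ^+ 2 * V y <= h t0 ^+ 2 * V t0 + B /\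
    Rintegral leb `[t0, y] (fun x => h x ^+ 2 * W x) <= (h t0 ^+ 2 * V t0 + B) / k.
  move=> Jy ty; have := @hardy_side 1 eta C t0 y Jt0 Jy ty.
  rewrite expr1n => /(_ erefl C0).
  have H x : t0 <= x <= y -> 1 * (x - x0) = `|x - x0| /\ eta <= `|x - x0| /\ q x <= C * `|x - x0|.
    move=> /andP[tx _]; have xx0 : x0 <= x by rewrite (le_trans (ltW xt)).
    have etax : eta <= `|x - x0|.
      by rewrite ger0_norm ?subr_ge0// ge_min; apply/orP; right; rewrite lerD2r.
    split; first by rewrite mul1r ger0_norm// subr_ge0.
    by split => //; exact: qC.
  move=> /(_ H); rewrite mul1r -/k -/B => HS.
  have kI := mulr_ge0 (ltW k0) (I0 t0 y Jt0 Jy); have := P0 y Jy.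
  split; first by lra.
  by rewrite ler_pdivlMr// mulrC; lra.
have left y : J y -> y <= s0 -> h y ^+ 2 * V y <= h s0 ^+ 2 * V s0 + B /\
    Rintegral leb `[y, s0] (fun x => h x ^+ 2 * W x) <= (h s0 ^+ 2 * V s0 + B) / k.
  move=> Jy ys; have := @hardy_side (-1) eta C y s0 Jy Js0 ys.
  rewrite sqrrN expr1n => /(_ erefl C0).
  have H x : y <= x <= s0 -> -1 * (x - x0) = `|x - x0| /\ eta <= `|x - x0| /\ q x <= C * `|x - x0|.
    move=> /andP[_ xs]; have xx0 : x <= x0 by rewrite (le_trans xs)// ltW.
    have etax : eta <= `|x - x0|.
      by rewrite ler0_norm ?subr_le0// opprB ge_min; apply/orP; left; rewrite lerB.
    split; first by rewrite mulN1r ler0_norm// subr_le0.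
    by split => //; exact: qC.
  move=> /(_ H); rewrite mulN1r -/k -/B => HS.
  have kI := mulr_ge0 (ltW k0) (I0 y s0 Jy Js0); have := P0 y Jy.
  split; first by lra.
  by rewrite ler_pdivlMr// mulrC; lra.
have [Jst st _ _ stx] := est; split.
  have [] // := @integrable_on_exhaust R a w (fun x => h x ^+ 2 * W x) s t
    ((h s0 ^+ 2 * V s0 + B) / k + Rintegral leb `[s0, t0] (fun x => h x ^+ 2 * W x)
     + (h t0 ^+ 2 * V t0 + B) / k) est.
  - by apply: cont_on_measurable; apply: cont_onM cont_W; exact: cont_onX.
  - by move=> x Jx; rewrite mulr_ge0 ?sqr_ge0// ltW// W_gt0.
  - by move=> n; have [? ?] := Jst n; exact: ir.
  near=> n; have [Jsn Jtn] := Jst n.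
  have ssn : s n <= s0 <= t n by near: n; exact: stx.
  have tsn : s n <= t0 <= t n by near: n; exact: stx.
  have [ss0 s0t] := andP ssn; have [st0 tt0] := andP tsn.
  rewrite (@Rint_split _ _ _ s0)//; last exact: ir.
  rewrite (@Rint_split _ _ s0 t0)//; [|by rewrite ltW// (lt_trans sx)|exact: ir].
  by rewrite addrA; apply: lerD; [apply: lerD => //; exact: (left _ Jsn ss0).2|exact: (right _ Jtn tt0).2].
exists (Num.max (h s0 ^+ 2 * V s0 + B) (h t0 ^+ 2 * V t0 + B)).
near=> n; have [Jsn Jtn] := Jst n.
have ssn : s n <= s0 <= t n by near: n; exact: stx.
have tsn : s n <= t0 <= t n by near: n; exact: stx.
have [ss0 s0t] := andP ssn; have [st0 tt0] := andP tsn.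
by rewrite !le_max (left _ Jsn ss0).1 (right _ Jtn tt0).1 orbT.
Unshelve. all: by end_near. Qed.

Lemma int_h_poly_W p : integrable_on J (fun x => h x * p.[x] * W x).
Proof.
apply: integrable_on_mul => //; [|exact: measurable_W| | |].
- by apply: cont_on_measurable; exact: cont_on_horner.
- by move=> x Jx; rewrite ltW// W_gt0.
- exact: hardy.1.
- by apply: eq_integrable_on (int_polyW (p ^+ 2)) => // x _; rewrite horner_exp.
Qed.

Lemma int_h1_poly_V p : integrable_on J (fun x => h1 x * p.[x] * V x).
Proof.
apply: integrable_on_mul => //; [|exact: measurable_V| |].
- by apply: cont_on_measurable; exact: cont_on_horner.
- by move=> x Jx; rewrite ltW// V_gt0.
- by apply: eq_integrable_on (int_polyV (p ^+ 2)) => // x _; rewrite horner_exp.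
Qed.

Lemma ac_horner p : ac_on a w (horner p) (horner p^`()).
Proof. by apply: ac_on_C1 (@cont_on_horner _) => x _; exact: is_derive_poly. Qed.

(* The Pearson operator (V p')' = (pearson_op p) W. *)
Definition pearson_op p : {poly R} :=
  (delta *: 'X^2 + beta *: 'X + gamma%:P) * p^`()^`() + kap *: (x0%:P - 'X) * p^`().

(** Integrate the derivative of [h p' V]. Its square is [h^2 V], bounded by [hardy], times [p'^2 V],
    which tends to zero at both ends. *)
Lemma pearson_IBP p :
  Rintegral leb J (fun x => h1 x * p^`().[x] * V x) =
  - Rintegral leb J (fun x => h x * (pearson_op p).[x] * W x).
Proof.
have ac := ac_onM ach (ac_onM (ac_horner p^`()) ac_V).
have i1 := int_h1_poly_V p^`(); have i2 := int_h_poly_W (pearson_op p).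
have E x : h1 x * (p^`().[x] * V x) + h x * (p^`()^`().[x] * V x + p^`().[x] * (L x * W x)) =
   h1 x * p^`().[x] * V x + h x * (pearson_op p).[x] * W x.
  rewrite /pearson_op hornerD !hornerM -qpol_horner hornerZ hornerD hornerN hornerC hornerX /V /L; ring.
have ie : integrable_on J (fun x => h1 x * (p^`().[x] * V x) + h x * (p^`()^`().[x] * V x + p^`().[x] * (L x * W x))).
  by apply: eq_integrable_on (integrable_onD mJ i1 i2) => // x _; rewrite E.
have [M hM] := hardy.2; have [bs bt] := cvg_polyV (p^`() ^+ 2).
have := ac_on_int0 est ac ie; rewrite (eq_Rint (k := fun x => h1 x * p^`().[x] * V x + h x * (pearson_op p).[x] * W x)); last by move=> x _; rewrite E.
rewrite RintegralD// => H; apply/eqP; rewrite -addr_eq0; apply/eqP; apply: H.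
- apply: (@cvg0_sqr_le _ _ (fun n => M * ((p^`() ^+ 2).[s n] * V (s n)))).
    move: hM; apply: filterS => n [hs _]; rewrite horner_exp.
    rewrite (_ : _ ^+ 2 = (h (s n) ^+ 2 * V (s n)) * (p^`().[s n] ^+ 2 * V (s n))); last by ring.
    by rewrite ler_wpM2r// mulr_ge0 ?sqr_ge0// ltW// V_gt0//; case: est => /(_ n)[].
  by rewrite -[X in _ --> X](mulr0 M); apply: cvgM => //; exact: cvg_cst.
- apply: (@cvg0_sqr_le _ _ (fun n => M * ((p^`() ^+ 2).[t n] * V (t n)))).
    move: hM; apply: filterS => n [_ ht]; rewrite horner_exp.
    rewrite (_ : _ ^+ 2 = (h (t n) ^+ 2 * V (t n)) * (p^`().[t n] ^+ 2 * V (t n))); last by ring.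
    by rewrite ler_wpM2r// mulr_ge0 ?sqr_ge0// ltW// V_gt0//; case: est => /(_ n)[].
  by rewrite -[X in _ --> X](mulr0 M); apply: cvgM => //; exact: cvg_cst.
Qed.

(** * Inductive step: the auxiliary function [v] *)

Section Step.
Hypothesis hW0 : Rintegral leb J (fun x => h x * W x) = 0.
Let H x := Rintegral leb (J `&` `]-oo, x]) (fun x => h x * W x).
Let v x := - H x / V x.
(** The derivative of [v], with [H' = h W] and [V' = L W] substituted. *)
Let v1 x := - (h x + L x * v x) / q x.

Let ih2 : integrable_on J (fun x => h x ^+ 2 * W x). Proof. exact: hardy.1. Qed.

Let ihW : integrable_on J (fun x => h x * W x).
Proof. by apply: eq_integrable_on (int_h_poly_W 1) => // x _; rewrite hornerE mulr1. Qed.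

Let chW : cont_on a w (fun x => h x * W x).
Proof. exact: cont_onM cont_W. Qed.

Let dH x : J x -> is_derive x 1 H (h x * W x).
Proof. exact: is_derive_Rint_left. Qed.

Let acH : ac_on a w H (fun x => h x * W x).
Proof. exact: ac_on_C1. Qed.

Let cH : cont_on a w H := ac_on_cont acH.

(** Mean zero lets [H] be read as a tail integral from either side, so that it is small at both
    ends. *)
Let H_right x : H x = - Rintegral leb (J `&` `]x, +oo[) (fun x => h x * W x).
Proof. by have := Rint_supp_split x ihW; rewrite hW0 -/(H x) => /esym/eqP; rewrite addr_eq0 => /eqP. Qed.

Let V_H_v x : J x -> v x * V x = - H x.
Proof. by move=> Jx; rewrite /v divfK// gt_eqF// V_gt0. Qed.

(* Cauchy-Schwarz on a tail T, with int_T W controlled by V / |L|. *)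
Let H_sqr_tail (T : set R) x k : measurable T -> T `<=` J -> (exists c d, c < d /\ (forall y, c < y < d -> T y)) ->
  0 <= k -> H x ^+ 2 = Rintegral leb T (fun x => h x * W x) ^+ 2 ->
  k * Rintegral leb T W <= V x ->
  H x ^+ 2 * k <= Rintegral leb T (fun x => h x ^+ 2 * W x) * V x.
Proof.
move=> mT TJ [c [d [cd Tcd]]] k0 -> kV.
have iTW : integrable_on T W by exact: integrable_onS int_W.
have W0 y : T y -> 0 <= W y by move=> /TJ/W_gt0/ltW.
have B0 : 0 < Rintegral leb T W.
  by apply: Rint_gt0 cd _ => // y /Tcd Ty; split => //; exact/W_gt0/TJ.
have iT1 : integrable_on T (fun x => h x * W x) by exact: integrable_onS ihW.
have iT2 : integrable_on T (fun x => h x ^+ 2 * W x) by exact: integrable_onS ih2.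
have CS := Rint_CauchySchwarz mT B0 W0 iTW iT1 iT2.
apply: le_trans (ler_wpM2r k0 CS) _.
rewrite -mulrA ler_wpM2l//; last by rewrite mulrC.
by apply: Rint_ge0 => y Ty; rewrite mulr_ge0 ?sqr_ge0// W0.
Qed.

(** Right of [x0], [|L|] increases, so [|L x|] times the tail mass of [W] is at most the tail
    integral of [- L W], that is [V x]. *)
Let H_bound_right x : J x -> x0 <= x ->
  H x ^+ 2 * `|L x| <= Rintegral leb (J `&` `]x, +oo[) (fun x => h x ^+ 2 * W x) * V x.
Proof.
move=> Jx xx0.
have mT : measurable (J `&` `]x, +oo[) by exact: measurableI.
have TJ : J `&` `]x, +oo[ `<=` J by move=> y [].
have L0 : L x <= 0 by rewrite mulr_ge0_le0 ?subr_le0// ltW.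
have nL : `|L x| = kap * (x - x0) by rewrite ler0_norm// /L; ring.
apply: H_sqr_tail => //.
- have [c [d [_ Jd /andP[_ xd]]]] := supp_int_enlarge Jx; exists x, d; split => // y /andP[xy yd].
  by split; [apply: supp_int_convex Jx Jd _; rewrite !ltW|rewrite /= in_itv/= xy].
- by rewrite H_right sqrrN.
- rewrite -[V x]opprK -V_tail_right// -mulN1r -!RintegralZl//; last 2 first.
    exact: (integrable_onS mJ mT TJ int_LW).
    exact: (integrable_onS mJ mT TJ int_W).
  apply: le_Rintegral => //.
  + by apply: integrable_onZ => //; exact: (integrable_onS mJ mT TJ int_W).
  + by apply: integrable_onZ => //; exact: (integrable_onS mJ mT TJ int_LW).
  move=> y [Jy]; rewrite /= in_itv/= andbT => xy.
  rewrite nL mulrA; apply: ler_wpM2r; first by rewrite ltW// W_gt0.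
  by rewrite mulN1r /L -mulrN opprB ler_pM2l// lerD2r ltW.
Qed.

Let H_bound_left x : J x -> x <= x0 ->
  H x ^+ 2 * `|L x| <= Rintegral leb (J `&` `]-oo, x]) (fun x => h x ^+ 2 * W x) * V x.
Proof.
move=> Jx xx0.
have mT : measurable (J `&` `]-oo, x]) by exact: measurableI.
have TJ : J `&` `]-oo, x] `<=` J by move=> y [].
have nL : `|L x| = kap * (x0 - x) by rewrite ger0_norm// mulr_ge0 ?subr_ge0// ltW.
apply: H_sqr_tail => //.
- have [c [d [Jc _ /andP[cx _]]]] := supp_int_enlarge Jx; exists c, x; split => // y /andP[cy yx].
  by split; [apply: supp_int_convex Jc Jx _; rewrite !ltW|rewrite /= in_itv/= ltW].
- rewrite -V_tail_left// -!RintegralZl//; last exact: (integrable_onS mJ mT TJ int_W).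
  apply: le_Rintegral => //.
  + by apply: integrable_onZ => //; exact: (integrable_onS mJ mT TJ int_W).
  + exact: (integrable_onS mJ mT TJ int_LW).
  move=> y [Jy]; rewrite /= in_itv/= => yx.
  rewrite nL; apply: ler_wpM2r; first by rewrite ltW// W_gt0.
  by rewrite /L ler_pM2l// lerD2l lerN2.
Qed.

(* Endpoint sequences along which all boundary terms below vanish. *)
Let good (r : nat -> R) := [/\ forall n, J (r n),
  exists2 eta, 0 < eta & exists2 tau : nat -> R, tau n @[n --> \oo] --> (0 : R) &
    \forall n \near \oo, H (r n) ^+ 2 * `|L (r n)| <= tau n * V (r n) /\ eta <= `|L (r n)|,
  exists M, \forall n \near \oo, h (r n) ^+ 2 * V (r n) <= M &
  forall p, p.[r n] * V (r n) @[n --> \oo] --> (0 : R)].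

Let good_t : good t.
Proof.
have [Jst st _ _ stx] := est; split.
- by move=> n; exact: (Jst n).2.
- have [s0 [t0 [Js0 Jt0 /andP[sx xt]]]] := supp_int_enlarge root_in_supp.
  exists (kap * (t0 - x0)); first by rewrite mulr_gt0// subr_gt0.
  exists (fun n => Rintegral leb (J `&` `]t n, +oo[) (fun x => h x ^+ 2 * W x)).
    exact: cvg_Rint_tail_right est ih2.
  move: (stx t0 Jt0); apply: filterS => n /andP[_ tt0].
  have xt0 : x0 <= t n by rewrite (le_trans _ tt0)// ltW.
  split; first by apply: H_bound_right => //; exact: (Jst n).2.
  rewrite /L ler0_norm; last by rewrite mulr_ge0_le0 ?subr_le0// ltW.
  by rewrite -mulrN opprB ler_pM2l// lerD2r.
- by have [M hM] := hardy.2; exists M; move: hM; apply: filterS => n [].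
- by move=> p; exact: (cvg_polyV p).2.
Qed.

Let good_s : good s.
Proof.
have [Jst st _ _ stx] := est; split.
- by move=> n; exact: (Jst n).1.
- have [s0 [t0 [Js0 Jt0 /andP[sx xt]]]] := supp_int_enlarge root_in_supp.
  exists (kap * (x0 - s0)); first by rewrite mulr_gt0// subr_gt0.
  exists (fun n => Rintegral leb (J `&` `]-oo, s n]) (fun x => h x ^+ 2 * W x)).
    exact: cvg_Rint_tail_left est ih2.
  move: (stx s0 Js0); apply: filterS => n /andP[ss0 _].
  have sx0 : s n <= x0 by rewrite (le_trans ss0)// ltW.
  split; first by apply: H_bound_left => //; exact: (Jst n).1.
  rewrite /L ger0_norm; last by rewrite mulr_ge0 ?subr_ge0// ltW.
  by rewrite ler_pM2l// lerD2l lerN2.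
- by have [M hM] := hardy.2; exists M; move: hM; apply: filterS => n [].
- by move=> p; exact: (cvg_polyV p).1.
Qed.

(** [h^2 V] is bounded and [H^2 / V <= tau / eta] tends to zero, since [|L|] stays above [eta]. *)
Let lim_hH r : good r -> h (r n) * H (r n) @[n --> \oo] --> (0 : R).
Proof.
move=> [Jr [eta eta0 [tau tau0 Hr]] [M hM] _].
apply: (@cvg0_sqr_le _ _ (fun n => M / eta * tau n)); last first.
  by rewrite -[X in _ --> X](mulr0 (M / eta)); apply: cvgM => //; exact: cvg_cst.
move: Hr hM; apply: filterS2 => n [HL eL] hV.
have V0 := V_gt0 (Jr n).
have tau_ge0 : 0 <= tau n.
  by rewrite -(pmulr_lge0 _ V0); apply: le_trans HL; rewrite mulr_ge0// sqr_ge0.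
rewrite mulrAC ler_pdivlMr// exprMn.
apply: (@le_trans _ _ (h (r n) ^+ 2 * (H (r n) ^+ 2 * `|L (r n)|))).
  by rewrite -mulrA !ler_wpM2l ?sqr_ge0.
apply: (@le_trans _ _ (h (r n) ^+ 2 * (tau n * V (r n)))); first by rewrite ler_wpM2l ?sqr_ge0.
by rewrite mulrCA mulrC ler_wpM2r.
Qed.

Let lim_Hp r p : good r -> H (r n) * p.[r n] @[n --> \oo] --> (0 : R).
Proof.
move=> [Jr [eta eta0 [tau tau0 Hr]] _ pV].
apply: (@cvg0_sqr_le _ _ (fun n => eta^-1 * (tau n * ((p ^+ 2).[r n] * V (r n))))); last first.
  rewrite -[X in _ --> X](mulr0 eta^-1); apply: cvgM; first exact: cvg_cst.
  by rewrite -[X in _ --> X](mulr0 (0 : R)); apply: cvgM => //; exact: pV.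
move: Hr; apply: filterS => n [HL eL].
rewrite ler_pdivlMl// horner_exp.
apply: (@le_trans _ _ (p.[r n] ^+ 2 * (H (r n) ^+ 2 * `|L (r n)|))).
  rewrite (_ : eta * _ = p.[r n] ^+ 2 * (H (r n) ^+ 2 * eta)); last by ring.
  by rewrite !ler_wpM2l ?sqr_ge0.
by rewrite [leRHS]mulrCA ler_wpM2l ?sqr_ge0.
Qed.

(** [v^2 V L = H^2 L / V] is exactly the quantity that [tau] controls. *)
Let lim_vL r : good r -> v (r n) * v (r n) * (V (r n) * L (r n)) @[n --> \oo] --> (0 : R).
Proof.
move=> [Jr [eta eta0 [tau tau0 Hr]] _ _].
apply: (@cvg0_sqr_le _ _ (fun n => tau n * tau n)); last first.
  by rewrite -[X in _ --> X](mulr0 (0 : R)); apply: cvgM.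
move: Hr; apply: filterS => n [HL eL]; have V0 := V_gt0 (Jr n).
rewrite -expr2 -real_normK ?num_real// ler_pXn2r ?nnegrE//.
  rewrite (_ : _ * (V _ * _) = H (r n) ^+ 2 * L (r n) / V (r n)); last first.
    by rewrite /v; field; rewrite gt_eqF.
  by rewrite normrM normfV (gtr0_norm V0) ler_pdivrMr// normrM (ger0_norm (sqr_ge0 _)).
by rewrite -(pmulr_lge0 _ V0); apply: le_trans HL; rewrite mulr_ge0// sqr_ge0.
Qed.

Let cv : cont_on a w v.
Proof.
apply: cont_onM; first exact: cont_onN.
by apply: cont_onV => [|x Jx]; [exact: cont_V|rewrite gt_eqF// V_gt0].
Qed.

Let cv1 : cont_on a w v1.
Proof.
apply: cont_onM; first by apply/cont_onN/cont_onD => //; apply: cont_onM => //; exact: cont_L.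
by apply: cont_onV => [|x Jx]; [exact: cont_on_qpol|rewrite gt_eqF// q_gt0].
Qed.

Let acv : ac_on a w v v1.
Proof.
apply: ac_on_C1 => // x Jx; have dHx := dH Jx; have dVx := is_derive_V Jx.
have Vn0 : V x != 0 by rewrite gt_eqF// V_gt0.
have qn0 : q x != 0 by rewrite gt_eqF// q_gt0.
have Wn0 : W x != 0 by rewrite gt_eqF// W_gt0.
have dVi := is_deriveV Vn0 dVx.
apply: trigger_derive; rewrite /v1 /v /GRing.scale/= /V; field.
by rewrite qn0 Wn0.
Qed.

(** Pointwise, [v1^2 q V + kap v^2 V = h^2 W - (v^2 V L)']; here [v1^2 q V = (h + L v)^2 W], and
    [kap] comes from [L' = - kap]. *)
Lemma step_energy :
  integrable_on J (fun x => v1 x ^+ 2 * (q x * V x)) /\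
  integrable_on J (fun x => v x ^+ 2 * V x) /\
  Rintegral leb J (fun x => v1 x ^+ 2 * (q x * V x)) +
    kap * Rintegral leb J (fun x => v x ^+ 2 * V x) <=
  Rintegral leb J (fun x => h x ^+ 2 * W x).
Proof.
pose P x := v1 x ^+ 2 * (q x * V x) + kap * (v x ^+ 2 * V x).
have c1 : cont_on a w (fun x => v1 x ^+ 2 * (q x * V x)).
  apply: cont_onM; first exact: cont_onX.
  by apply: cont_onM; [exact: cont_on_qpol|exact: cont_V].
have c2 : cont_on a w (fun x => v x ^+ 2 * V x).
  by apply: cont_onM; [exact: cont_onX|exact: cont_V].
have cP : cont_on a w P.
  by apply: cont_onD => //; apply: cont_onM => // x _; exact: cvg_cst.
have p1 x : J x -> 0 <= v1 x ^+ 2 * (q x * V x).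
  by move=> Jx; rewrite mulr_ge0 ?sqr_ge0// ltW// mulr_gt0 ?q_gt0 ?V_gt0.
have p2 x : J x -> 0 <= v x ^+ 2 * V x.
  by move=> Jx; rewrite mulr_ge0 ?sqr_ge0// ltW// V_gt0.
have P0 x : J x -> 0 <= P x.
  by move=> Jx; rewrite addr_ge0 ?p1// mulr_ge0 ?p2// ltW.
have [Jst st _ _ stx] := est.
have acL : ac_on a w L (fun=> - kap).
  apply: ac_on_C1 => [x _|x _]; last exact: cvg_cst.
  by apply: trigger_derive; rewrite /GRing.scale/=; ring.
have acF := ac_onM (ac_onM acv acv) (ac_onM ac_V acL).
have PE x : J x -> P x = h x ^+ 2 * W x - ((v1 x * v x + v x * v1 x) * (V x * L x) +
     (v x * v x) * ((L x * W x) * L x + V x * - kap)).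
  move=> Jx; have qn0 : q x != 0 by rewrite gt_eqF// q_gt0.
  by rewrite /P /v1 /V; field.
(* The slack [e] absorbs the boundary terms on late segments, which supply integrability on [J]
   together with the bound. *)
have bnd e : 0 < e -> integrable_on J P /\ Rintegral leb J P <= Rintegral leb J (fun x => h x ^+ 2 * W x) + e.
  move=> e0; apply: (integrable_on_exhaust est) => //; first exact: cont_on_measurable.
    by move=> n; exact: (cont_on_integrable cP (Jst n).1 (Jst n).2).
  have lims : (v (t n) * v (t n) * (V (t n) * L (t n)) - v (s n) * v (s n) * (V (s n) * L (s n)))
      @[n --> \oo] --> (0 - 0 : R) by exact: (cvgB (lim_vL good_t) (lim_vL good_s)).
  rewrite subr0 in lims.
  move/cvgrPdist_lt : lims => /(_ e e0); apply: filterS => n; rewrite sub0r normrN => Hn.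
  have [Jsn Jtn] := Jst n.
  have iF : integrable_on `[s n, t n] (fun x => (v1 x * v x + v x * v1 x) * (V x * L x) +
     (v x * v x) * ((L x * W x) * L x + V x * - kap)).
    apply: (cont_on_integrable _ Jsn Jtn); apply: cont_onD.
      apply: cont_onM; first by apply: cont_onD; exact: cont_onM.
      by apply: cont_onM; [exact: cont_V|exact: cont_L].
    apply: cont_onM; first exact: cont_onM.
    apply: cont_onD; last by apply: cont_onM; [exact: cont_V|move=> x _; exact: cvg_cst].
    by apply: cont_onM; [apply: cont_onM; [exact: cont_L|exact: cont_W]|exact: cont_L].
  have i2 : integrable_on `[s n, t n] (fun x => h x ^+ 2 * W x) by exact: (integrable_on_supp_itv ih2 Jsn Jtn).
  have sub x : `[s n, t n]%classic x -> J x by move=> /=; rewrite in_itv/=; exact: supp_int_convex.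
  rewrite (eq_Rint (fun x xs => PE x (sub x xs))) RintegralB//.
  have := ac_on_FTC acF Jsn Jtn (st n) iF => ->.
  apply: lerD; last by rewrite (le_trans _ (ltW Hn))// (le_trans (ler_norm _))// normrN.
  apply: Rint_le_subset => // x Jx; by rewrite mulr_ge0 ?sqr_ge0// ltW// W_gt0.
have iP := (bnd 1 ltr01).1.
have i1 : integrable_on J (fun x => v1 x ^+ 2 * (q x * V x)).
  apply: integrable_on_dom iP _ => //; first exact: cont_on_measurable.
  by move=> x Jx; rewrite ger0_norm ?p1// lerDl mulr_ge0 ?p2// ltW.
have i2 : integrable_on J (fun x => v x ^+ 2 * V x).
  apply: integrable_on_dom (integrable_onZ kap^-1 mJ iP) _ => //; first exact: cont_on_measurable.
  by move=> x Jx; rewrite ger0_norm ?p2// mulrDr mulKf ?gt_eqF// lerDr mulr_ge0 ?p1// invr_ge0 ltW.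
split => //; split => //.
rewrite -RintegralZl// -RintegralD//; last exact: integrable_onZ.
by apply/ler_addgt0Pr => e /bnd[].
Qed.

(** Integrate [(H p)' = h W p + H p'] and use [H = - v V]. *)
Lemma step_orth p : Rintegral leb J (fun x => h x * p.[x] * W x) = 0 ->
  Rintegral leb J (fun x => v x * p^`().[x] * V x) = 0.
Proof.
move=> hp0; have [_ [iv _]] := step_energy.
have i1 : integrable_on J (fun x => v x * p^`().[x] * V x).
  apply: integrable_on_mul => //; [exact: cont_on_measurable| |exact: measurable_V| |].
  - by apply: cont_on_measurable; exact: cont_on_horner.
  - by move=> x Jx; rewrite ltW// V_gt0.
  - by apply: eq_integrable_on (int_polyV (p^`() ^+ 2)) => // x _; rewrite horner_exp.
have i2 := int_h_poly_W p.
have E x : J x -> h x * W x * p.[x] + H x * p^`().[x] = h x * p.[x] * W x - v x * p^`().[x] * V x.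
  by move=> Jx; rewrite mulrAC (mulrAC (v x)) V_H_v// mulNr opprK (mulrAC (h x)).
have ie : integrable_on J (fun x => h x * W x * p.[x] + H x * p^`().[x]).
  by apply: eq_integrable_on (integrable_onB mJ i2 i1) => // x Jx; rewrite E.
have := ac_on_int0 est (ac_onM acH (ac_horner p)) ie (lim_Hp p good_s) (lim_Hp p good_t).
rewrite (eq_Rint E) RintegralB// hp0 sub0r => /eqP.
by rewrite oppr_eq0 => /eqP.
Qed.

(** Integrate [(h H)' = h1 H + h^2 W], whose boundary values vanish by [lim_hH]. *)
Lemma step_dual : integrable_on J (fun x => h1 x * v x * V x) /\
  Rintegral leb J (fun x => h x ^+ 2 * W x) = Rintegral leb J (fun x => h1 x * v x * V x).
Proof.
have [_ [iv _]] := step_energy.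
have i1 : integrable_on J (fun x => h1 x * v x * V x).
  apply: integrable_on_mul => //; [exact: cont_on_measurable|exact: measurable_V|].
  by move=> x Jx; rewrite ltW// V_gt0.
split => //.
have E x : J x -> h1 x * H x + h x * (h x * W x) = h x ^+ 2 * W x - h1 x * v x * V x.
  by move=> Jx; rewrite -(mulrA (h1 x)) V_H_v//; ring.
have ie : integrable_on J (fun x => h1 x * H x + h x * (h x * W x)).
  by apply: eq_integrable_on (integrable_onB mJ ih2 i1) => // x Jx; rewrite E.
have := ac_on_int0 est (ac_onM ach acH) ie (lim_hH good_s) (lim_hH good_t).
by rewrite (eq_Rint E) RintegralB// => /eqP; rewrite subr_eq0 => /eqP.
Qed.

Lemma gap_step m : gap m ->
  (forall p, (size p <= m.+1)%N -> Rintegral leb J (fun x => h x * p.[x] * W x) = 0) ->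
  m.+1%:R * (kap - m%:R * delta) * Rintegral leb J (fun x => h x ^+ 2 * W x) <=
  Rintegral leb J (fun x => h1 x ^+ 2 * V x).
Proof.
move=> IH orth; have [i1 [i2 E]] := step_energy; have [i3 D] := step_dual.
have k2 : 0 < kap - 2 * delta by move: kap0 delta0; lra.
have orth' p : (size p <= m)%N -> Rintegral leb J (fun x => v x * p.[x] * V x) = 0.
  by move=> /deriv_onto[P sP ->]; apply: step_orth; exact: orth.
have IHv : m%:R * (kap - 2 * delta - (m%:R - 1) * delta) * Rintegral leb J (fun x => v x ^+ 2 * V x)
    <= Rintegral leb J (fun x => v1 x ^+ 2 * (q x * V x)).
  exact: (IH _ _ _ k2 (pearson_next kap0 PW) _ _ acv i1 orth').
set A := Rintegral leb J (fun x => v1 x ^+ 2 * (q x * V x)) in E IHv.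
set B := Rintegral leb J (fun x => v x ^+ 2 * V x) in E IHv *.
set C := Rintegral leb J (fun x => h x ^+ 2 * W x) in E D *.
set F := Rintegral leb J (fun x => h1 x ^+ 2 * V x).
pose lam := m.+1%:R * (kap - m%:R * delta).
have lam0 : 0 < lam.
  rewrite mulr_gt0// subr_gt0 (le_lt_trans _ kap0)// mulr_ge0_le0//.
(* [m (kap - 2 delta - (m - 1) delta) + kap = (m + 1) (kap - m delta)]: the [m]-th eigenvalue for
   [q W] plus the energy constant is the next eigenvalue for [W]. *)
have lamB : lam * B <= C.
  apply: le_trans E; rewrite /lam (_ : _ * B = m%:R * (kap - 2 * delta - (m%:R - 1) * delta) * B + kap * B).
    by rewrite lerD2r.
  by rewrite -natr1; ring.
(* Cauchy-Schwarz as [F - 2 lam C + lam^2 B >= 0]; with [lam B <= C] this gives [lam C <= F]. *)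
have : 0 <= Rintegral leb J (fun x => (h1 x ^+ 2 * V x + (- (2 * lam)) * (h1 x * v x * V x)) +
     lam ^+ 2 * (v x ^+ 2 * V x)).
  apply: Rint_ge0 => x Jx.
  rewrite (_ : _ + _ = (h1 x - lam * v x) ^+ 2 * V x); last by ring.
  by rewrite mulr_ge0 ?sqr_ge0// ltW// V_gt0.
rewrite !RintegralD ?RintegralZl//; last 3 first.
- exact: integrable_onZ.
- by apply: integrable_onD => //; exact: integrable_onZ.
- exact: integrable_onZ.
rewrite -D -/C -/F -/B => pos.
have := ler_wpM2l (ltW lam0) lamB; rewrite -/lam mulrA -expr2; move: pos; lra.
Qed.
End Step.
End Hardy.

(** The operator multiplies the coefficient of degree [m] by [delta m (m - 1) - kap m], which the
    added multiple of [p] cancels. *)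
Lemma size_pearson_op p m : (size p <= m.+1)%N ->
  (size (pearson_op p + (m%:R * (kap - (m%:R - 1) * delta)) *: p)%R <= m)%N.
Proof.
move=> sp; apply/leq_sizeP => j mj.
(* The eigenvalue stays abstract during the coefficient rewrites; its value matters only in degree
   exactly [m]. *)
have [lam lamE] : exists l, l = m%:R * (kap - (m%:R - 1) * delta) by eexists.
rewrite -lamE.
have pE k : (m < k)%N -> p`_k = 0 by move=> mk; rewrite nth_default// (leq_trans sp).
rewrite /pearson_op coefD coefZ coefD !mulrDl !coefD -!scalerAl !coefZ mulrBl coefB !coefCM.
have dE (g : {poly R}) i : g^`()`_i = i.+1%:R * g`_i.+1 by rewrite coef_deriv mulr_natl.
rewrite coefXnM !coefXM !dE (pE j.+1)// (pE j.+2)//; last exact: leqW.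
move: mj; rewrite leq_eqVlt => /predU1P[<-|mj].
  rewrite lamE; clear lam lamE; case: m sp pE => [|[|m]] sp pE /=.
  - by ring.
  - by rewrite (pE 2%N)//; ring.
  - by rewrite subn2/= (pE m.+3)//; ring.
have {mj}pj k : (j <= k)%N -> p`_k = 0 by move=> jk; apply: pE; exact: leq_trans jk.
clear pE lamE; case: j pj => [|[|j]] pj /=; first by rewrite (pj 0%N)//; ring.
  by rewrite (pj 1%N)// (pj 2%N)//; ring.
by rewrite subn2/= (pj j.+2)// (pj j.+3)//; ring.
Qed.

(** Integrate by parts with [p] against itself: modulo lower degrees, which are orthogonal to [p],
    the operator sends [p] to minus the eigenvalue times [p]. *)
Lemma pearson_eigen p m : (size p <= m.+1)%N ->
  (forall g : {poly R}, (size g <= m)%N -> Rintegral leb J (fun x => p.[x] * g.[x] * W x) = 0) ->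
  Rintegral leb J (fun x => p^`().[x] ^+ 2 * V x) =
  m%:R * (kap - (m%:R - 1) * delta) * Rintegral leb J (fun x => p.[x] ^+ 2 * W x).
Proof.
move=> sp orth.
have ip : integrable_on J (fun x => p^`().[x] ^+ 2 * V x).
  by apply: eq_integrable_on (int_polyV (p^`() ^+ 2)) => // x _; rewrite horner_exp.
have IBP := pearson_IBP (ac_horner p) ip p.
pose lam : R := m%:R * (kap - (m%:R - 1) * delta).
have := orth _ (size_pearson_op sp); rewrite -/lam.
rewrite (eq_Rint (k := fun x => p.[x] * (pearson_op p).[x] * W x + lam * (p.[x] ^+ 2 * W x))); last first.
  by move=> x _; rewrite hornerD hornerZ; ring.
have i1 := int_h_poly_W (ac_horner p) ip (pearson_op p).
have i2 : integrable_on J (fun x => p.[x] ^+ 2 * W x).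
  by apply: eq_integrable_on (int_polyW (p ^+ 2)) => // x _; rewrite horner_exp.
rewrite RintegralD ?RintegralZl//; last exact: integrable_onZ.
have -> : Rintegral leb J (fun x => p^`().[x] ^+ 2 * V x) =
    Rintegral leb J (fun x => p^`().[x] * p^`().[x] * V x).
  by apply: eq_Rint => x _; rewrite expr2.
rewrite IBP => /eqP; rewrite addr_eq0 => /eqP ->; by rewrite opprK.
Qed.
End Weight.

Lemma gap_all m : gap m.
Proof.
elim: m => [|m IH] W kap x0 kap0 PW h h1 ach ih1 orth.
  rewrite mul0r mul0r; apply: Rint_ge0 => x Jx.
  by rewrite mulr_ge0 ?sqr_ge0// ltW// mulr_gt0 ?q_gt0//; case: PW => + _ _ _ _; exact.
have hW0 : Rintegral leb J (fun x => h x * W x) = 0.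
  have := orth 1; rewrite size_poly1 => /(_ isT).
  by under eq_Rint do rewrite hornerE mulr1.
have := gap_step kap0 PW ach ih1 hW0 IH orth.
by rewrite -[X in (X - 1) * _]natr1 addrK.
Qed.

End Pearson.

(** * The density as a Pearson weight *)

Section BasePair.
Context {R : realType}.
Notation leb := (@lebesgue_measure R).
Variables (f : R -> R) (mu delta beta gamma : R) (a w : \bar R).
Notation J := (supp_int a w).
Notation q := (qpol delta beta gamma).
Hypotheses (ip : IP f mu delta beta gamma) (supp : support_is f a w) (delta0 : delta <= 0).
Implicit Types (x : R) (p : {poly R}).

Let F x := q x * f x.
Let phi x := (mu - x) * f x.
Let mJ : measurable J := supp_int_measurable a w.

Let f_ge0 x : 0 <= f x. Proof. by case: ip => [[_ [+ _]] _]; exact. Qed.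
Let f_gt0 x : J x -> 0 < f x. Proof. by move=> Jx; case: supp => _ /(_ x)[_]; exact. Qed.
Lemma density_off_supp x : ~ J x -> f x = 0.
Proof.
move=> nJx; apply/eqP; rewrite eq_le f_ge0 andbT leNgt; apply/negP.
by case: supp => _ /(_ x)[H _] /H.
Qed.

Lemma Rint_density h : Rintegral leb setT (fun x => h x * f x) = Rintegral leb J (fun x => h x * f x).
Proof.
rewrite [RHS]Rintegral_mkcond; apply: eq_Rint => x _; rewrite patchE.
case: ifPn => //; rewrite notin_setE => /density_off_supp ->; by rewrite mulr0.
Qed.

Let if_T : integrable_on setT f.
Proof.
case: ip => [[mf [f0 f1]] _]; apply/integrableP; split; first exact/measurable_EFinP.
rewrite [ltLHS](_ : _ = 1%E) ?ltry//.
by rewrite -f1; apply: eq_integral => x _ /=; rewrite ger0_norm.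
Qed.

Let f1 : Rintegral leb setT f = 1.
Proof. by case: ip => [[_ [_ H]] _]; rewrite /Rintegral H. Qed.

Let ixf : integrable_on setT (fun x => x * f x).
Proof. by case: ip => _ []. Qed.

Let iphi : integrable_on setT phi.
Proof.
apply: eq_integrable_on (integrable_onB measurableT (integrable_onZ mu measurableT if_T) ixf) => // x _.
by rewrite /phi mulrBl.
Qed.

Let phi0 : Rintegral leb setT phi = 0.
Proof.
rewrite (eq_Rint (k := fun x => mu * f x - x * f x)); last by move=> x _; rewrite /phi mulrBl.
rewrite RintegralB//; last exact: integrable_onZ.
rewrite RintegralZl// f1 mulr1; case: ip => _ [_ [<- _]]; exact: subrr.
Qed.

Let subT (D : set R) h : measurable D -> integrable_on setT h -> integrable_on D h.
Proof. by move=> mD; apply: integrable_onS. Qed.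

Let FE x : Rintegral leb (J `&` `]-oo, x]) phi = F x.
Proof.
rewrite /F; case: ip => _ [_ [_ [_ /(_ x) <-]]]; rewrite setIC Rintegral_mkcondr; apply: eq_Rint => y _.
rewrite patchE; case: ifPn => //; rewrite notin_setE => /density_off_supp fy.
by rewrite /phi fy mulr0.
Qed.

Lemma supp_nonempty : exists x, J x.
Proof.
apply: contrapT => nJ; have f0 x : f x = 0 by apply: density_off_supp => Jx; apply: nJ; exists x.
have := f1; rewrite (eq_Rint (k := fun=> 0)); last by move=> x _; rewrite f0.
by rewrite Rintegral_cst// mul0r => /esym/eqP; rewrite oner_eq0.
Qed.

Let phiJ0 : Rintegral leb J phi = 0.
Proof. by rewrite -(Rint_density (fun x => mu - x)) phi0. Qed.

Lemma mean_supp : J mu.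
Proof.
have [y Jy] := supp_nonempty; apply: (mean_in_supp Jy f_gt0) => //.
exact: (subT mJ iphi).
Qed.

Let F_right x : F x = - Rintegral leb (J `&` `]x, +oo[) phi.
Proof.
have := Rint_supp_split x (subT mJ iphi); rewrite phiJ0 FE => /esym/eqP.
by rewrite addr_eq0 => /eqP.
Qed.

(** [F] is the integral of [phi] up to [x] and also minus the integral beyond [x]; [phi] changes
    sign only at [mu], so the tail on the far side of [x] from [mu] decides. *)
Let F_gt0 x : J x -> 0 < F x.
Proof.
move=> Jx; have [c [d [Jc Jd /andP[cx xd]]]] := supp_int_enlarge Jx.
have [xmu|mux] := leP x mu.
- rewrite -FE; apply: Rint_gt0 cx _.
  + exact: measurableI.
  + by apply: subT => //; exact: measurableI.
  + by move=> y [Jy]; rewrite /= in_itv/= => yx; rewrite mulr_ge0// subr_ge0 (le_trans yx).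
  + move=> y /andP[cy yx]; have Jy : J y by apply: supp_int_convex Jc Jx _; rewrite !ltW.
    split; first by split => //=; rewrite in_itv/= ltW.
    by rewrite mulr_gt0 ?f_gt0// subr_gt0 (lt_le_trans yx).
- rewrite F_right -mulN1r -RintegralZl//; last 2 first.
    exact: measurableI.
    by apply: subT => //; exact: measurableI.
  apply: Rint_gt0 xd _.
  + exact: measurableI.
  + by apply: integrable_onZ; [exact: measurableI|apply: subT => //; exact: measurableI].
  + move=> y [Jy]; rewrite /= in_itv/= andbT => xy; rewrite mulN1r -mulNr opprB mulr_ge0// subr_ge0.
    by rewrite ltW// (lt_trans mux).
  + move=> y /andP[xy yd]; have Jy : J y by apply: supp_int_convex Jx Jd _; rewrite !ltW.
    split; first by split => //=; rewrite in_itv/= xy.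
    by rewrite mulN1r -mulNr opprB mulr_gt0 ?f_gt0// subr_gt0 (lt_trans mux).
Qed.

Lemma qpol_supp_gt0 x : J x -> 0 < q x.
Proof. by move=> Jx; have := F_gt0 Jx; rewrite /F pmulr_lgt0 ?f_gt0. Qed.

(** The density is only measurable to begin with. The defining identity makes [q f] an integral,
    hence continuous; dividing by [q > 0] makes [f] continuous, and then [q f] is differentiable
    everywhere on [J]. *)
Let cF : cont_on a w F.
Proof.
move=> x Jx; have [s [t [Js Jt sxt]]] := supp_int_enlarge Jx.
pose G y := Rintegral leb `[s, y] phi.
have aG : abs_cont_on s t G by apply: abs_cont_on_Rintegral; exact: subT.
have aF : abs_cont_on s t F.
  move=> e e0; have [d d0 dP] := aG e e0; exists d => // k u v uv vu /(dP _ _ _ uv vu).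
  apply: le_lt_trans; apply: ler_sum => i _.
  have FG y : s <= y -> F y = F s + G y.
    move=> sy; case: ip => _ [_ [_ [_ H]]]; rewrite /F -!H.
    have ii : integrable_on `]s, y] phi by exact: subT.
    have := @Rintegral_itvB R phi -oo%O (BRight y) s (subT _ iphi).
    rewrite !bnd_simp => /(_ _ isT sy) E; rewrite /G -(Rintegral_itv_obnd_cbnd ii) -E//.
    by rewrite addrC subrK.
  have [h1 [h2 h3]] := uv i (ltn_ord i).
  rewrite (FG (v i)) ?(FG (u i))//; last exact: le_trans h2.
  by rewrite opprD addrACA subrr add0r.
exact: abs_cont_on_continuous aF sxt.
Qed.

Let cf : cont_on a w f.
Proof.
move=> x Jx.
have cq : {for x, continuous (fun y => F y / q y)}.
  apply: cvgM; first exact: cF.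
  by apply: cvgV; [rewrite gt_eqF// qpol_supp_gt0|exact: (cont_on_qpol Jx)].
have E y : J y -> F y / q y = f y.
  by move=> Jy; rewrite /F mulrAC divff ?mul1r// gt_eqF// qpol_supp_gt0.
have JJ : nbhs x J by exact: (open_nbhs_nbhs (conj (@supp_int_open R a w) Jx)).
rewrite /prop_for /continuous_at -(E x Jx).
by apply: cvg_trans cq; apply: near_eq_cvg; move: JJ; apply: filterS => y /E ->.
Qed.

Let cphi : cont_on a w phi.
Proof.
apply: cont_onM => //; have -> : (fun x => mu - x) = horner (mu%:P - 'X).
  by apply/funext => x; rewrite !hornerE.
exact: cont_on_horner.
Qed.

Let dF x : J x -> is_derive x 1 F (phi x).
Proof.
move=> Jx; have := is_derive_Rint_left (subT mJ iphi) cphi Jx.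
by rewrite (_ : (fun y => _) = F)//; apply/funext => y; exact: FE.
Qed.

Let acF : ac_on a w F phi.
Proof. exact: ac_on_C1. Qed.

(** * Polynomial moments and decay at the ends *)

Section Moments.
Variables (s t : nat -> R).
Hypothesis est : exhausts a w s t.

Let K := Rintegral leb setT (fun x => `|phi x|).
Let FK x : F x <= K.
Proof.
rewrite -FE (le_trans (ler_norm _))//.
have mI : measurable (J `&` `]-oo, x]) by exact: measurableI.
have i1 : leb.-integrable (J `&` `]-oo, x]) (EFin \o phi) by exact: subT.
apply: (le_trans (le_normr_Rintegral _ i1)); first exact: mI.
by apply: Rint_le_subset => //; exact: integrable_on_norm.
Qed.

(* Derivative of x^(2i+1) F: since delta <= 0 its leading term is at most
   - x^(2i+2) f, which bounds the next even moment. *)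
Lemma even_moment i : integrable_on J (fun x => x ^+ (2 * i) * f x).
Proof.
elim: i => [|i IH]; first by apply: eq_integrable_on (subT mJ if_T) => // x _; rewrite mul1r.
have [Jst st nis ndt stx] := est.
pose Phi x := x ^+ (2 * i).+1 * F x.
pose dPhi x := (2 * i).+1%:R * x ^+ (2 * i) * F x + x ^+ (2 * i).+1 * phi x.
have acPhi : ac_on a w Phi dPhi.
  have := ac_onM (ac_horner a w 'X^((2 * i).+1)) acF.
  have -> : (fun x => ('X^((2 * i).+1)).[x] * F x) = Phi.
    by apply/funext => x; rewrite hornerXn.
  have -> : (fun x => ('X^((2 * i).+1))^`().[x] * F x + ('X^((2 * i).+1)).[x] * phi x) = dPhi.
    by apply/funext => x; rewrite derivXn hornerXn hornerMn hornerXn /dPhi mulr_natl.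
  by [].
have cpow j : cont_on a w (fun x : R => x ^+ j) by move=> x _; exact: exprn_continuous.
have cdPhi : cont_on a w dPhi.
  apply: cont_onD; apply: cont_onM => //.
  by apply: cont_onM => // x _; exact: cvg_cst.
(* [A] collects the coefficients of [|x|]; [A |x| <= A^2 / 2 + x^2 / 2] then uses up half of the
   leading term, whence the factor [2^-1] below. *)
pose A := `|mu| + (2 * i).+1%:R * `|beta|.
pose B := A ^+ 2 / 2 + (2 * i).+1%:R * `|gamma|.
have A0 : 0 <= A by rewrite addr_ge0// mulr_ge0.
have B0 : 0 <= B by rewrite addr_ge0 ?mulr_ge0 ?invr_ge0 ?sqr_ge0.
have pw x : J x -> 2^-1 * (x ^+ (2 * i.+1) * f x) <= B * (x ^+ (2 * i) * f x) - dPhi x.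
  move=> Jx; have f0 := f_gt0 Jx; have q0 := qpol_supp_gt0 Jx.
  pose X := x ^+ (2 * i).
  have X0 : 0 <= X by rewrite /X exprM exprn_ge0// sqr_ge0.
  have E2 : x ^+ (2 * i.+1) = X * x ^+ 2 by rewrite mulnS addnC exprD.
  have E1 : x ^+ (2 * i).+1 = X * x by rewrite exprSr.
  have ED : dPhi x = ((2 * i).+1%:R * q x + x * (mu - x)) * (X * f x).
    by rewrite /dPhi E1 /F /phi /X; ring.
  have -> : 2^-1 * (x ^+ (2 * i.+1) * f x) = 2^-1 * x ^+ 2 * (X * f x) by rewrite E2; ring.
  rewrite ED -/X -mulrBl; apply: ler_wpM2r; first by rewrite mulr_ge0// ltW.
  have H1 : q x <= `|beta| * `|x| + `|gamma|.
    rewrite /qpol; apply: (@le_trans _ _ (beta * x + gamma)).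
      by rewrite -addrA gerDr mulr_le0_ge0// sqr_ge0.
    by rewrite lerD ?ler_norm// -normrM ler_norm.
  have H2 : mu * x <= `|mu| * `|x| by rewrite -normrM ler_norm.
  have H3 : A * `|x| <= A ^+ 2 / 2 + x ^+ 2 / 2.
    by rewrite -[x ^+ 2](real_normK (num_real x)); have := sqr_ge0 (A - `|x|); nra.
  have H4 : (2 * i).+1%:R * q x <= (2 * i).+1%:R * (`|beta| * `|x| + `|gamma|).
    by rewrite ler_wpM2l.
  have H5 : A * `|x| = `|mu| * `|x| + (2 * i).+1%:R * (`|beta| * `|x|) by rewrite /A; ring.
  rewrite /B mulrBr -expr2 (mulrC x mu); move: H2 H3 H4 H5; rewrite mulrDr; lra.
pose Q := Rintegral leb J (fun x => x ^+ (2 * i) * f x).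
pose S0 := `|s 0%N| ^+ (2 * i).+1 * K; pose T0 := `|t 0%N| ^+ (2 * i).+1 * K.
have K0 : 0 <= K by apply: Rint_ge0.
(* The boundary terms call for upper bounds on [Phi (s n)] and [- Phi (t n)]; an odd power is
   monotone, so [s 0] and [t 0] provide them even when the ends are infinite. *)
have odd_le (x y : R) : x <= y -> x ^+ (2 * i).+1 <= `|y| ^+ (2 * i).+1.
  move=> xy; have [x0|x0] := leP x 0.
    apply: (@le_trans _ _ 0); last by rewrite exprn_ge0.
    by rewrite exprS exprM mulr_le0_ge0// exprn_ge0// sqr_ge0.
  by rewrite lerXn2r ?nnegrE ?(ltW x0)// (le_trans xy)// ler_norm.
have [] // := @integrable_on_exhaust R a w (fun x => 2^-1 * (x ^+ (2 * i.+1) * f x)) s t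
  (B * Q + S0 + T0) est.
- by apply: cont_on_measurable; apply: cont_onM; [move=> x _; exact: cvg_cst|exact: cont_onM].
- by move=> x Jx; rewrite !mulr_ge0// exprM exprn_ge0// sqr_ge0.
- move=> n; apply: (cont_on_integrable _ (Jst n).1 (Jst n).2).
  by apply: cont_onM; [move=> x _; exact: cvg_cst|exact: cont_onM].
- apply: nearW => n; have [Jsn Jtn] := Jst n.
  have i1 : integrable_on `[s n, t n] (fun x => x ^+ (2 * i) * f x) by exact: (integrable_on_supp_itv IH).
  have i2 : integrable_on `[s n, t n] dPhi by exact: (cont_on_integrable cdPhi).
  have sub x : `[s n, t n]%classic x -> J x by move=> /=; rewrite in_itv/=; exact: supp_int_convex.
  apply: (@le_trans _ _ (Rintegral leb `[s n, t n] (fun x => B * (x ^+ (2 * i) * f x) - dPhi x))).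
    apply: le_Rintegral => //.
    + apply: (cont_on_integrable _ Jsn Jtn).
      by apply: cont_onM; [move=> x _; exact: cvg_cst|exact: cont_onM].
    + by apply: integrable_onB => //; exact: integrable_onZ.
    + by move=> x /sub/pw.
  rewrite RintegralB//; last exact: integrable_onZ.
  rewrite RintegralZl// (ac_on_FTC acPhi Jsn Jtn (st n) i2) opprB -addrA.
  apply: lerD; last apply: lerD.
  + rewrite ler_wpM2l//; apply: Rint_le_subset => // x Jx.
    by rewrite mulr_ge0// exprM exprn_ge0// sqr_ge0.
  + have := odd_le _ _ (nis 0%N n (leq0n n)); rewrite /Phi /S0 => H.
    apply: (@le_trans _ _ (`|s 0%N| ^+ (2 * i).+1 * F (s n))); last by rewrite ler_wpM2l ?exprn_ge0// FK.
    by rewrite ler_wpM2r// ltW// F_gt0.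
  + have tn := ndt 0%N n (leq0n n).
    have := odd_le (- t n) (- t 0%N); rewrite lerN2 => /(_ tn).
    rewrite normrN /Phi /T0 => H.
    have E : - (t n ^+ (2 * i).+1 * F (t n)) = (- t n) ^+ (2 * i).+1 * F (t n).
      by rewrite -mulNr; congr (_ * _); rewrite !(exprS _ (2 * i)) !exprM sqrrN mulNr.
    rewrite E; apply: (@le_trans _ _ (`|t 0%N| ^+ (2 * i).+1 * F (t n))); last by rewrite ler_wpM2l ?exprn_ge0// FK.
    by rewrite ler_wpM2r// ltW// F_gt0.
move=> ih _; apply: eq_integrable_on (integrable_onZ 2 mJ ih) => // x _.
by rewrite mulrA divff ?mul1r.
Qed.

Lemma poly_moment p : integrable_on J (fun x => p.[x] * f x).
Proof.
have im i : integrable_on J (fun x => x ^+ i * f x).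
  apply: integrable_on_dom (integrable_onD mJ (even_moment 0) (even_moment i)) _ => //.
    apply: cont_on_measurable; apply: cont_onM => //; move=> x _; exact: exprn_continuous.
  move=> x Jx; rewrite normrM (ger0_norm (f_ge0 x)) -mulrDl ler_wpM2r// expr0 mulnC exprM.
  by rewrite -(real_normK (num_real (x ^+ i))); have := normr_ge0 (x ^+ i); nra.
have isum n (c : nat -> R) : integrable_on J (fun x => (\sum_(i < n) c i * x ^+ i) * f x).
  elim: n => [|n IH].
    by apply: eq_integrable_on (integrable_onZ 0 mJ (im 0%N)) => // x _; rewrite big_ord0 !mul0r.
  apply: eq_integrable_on (integrable_onD mJ IH (integrable_onZ (c n) mJ (im n))) => // x _.
  by rewrite big_ord_recr/= mulrDl mulrA.
by apply: eq_integrable_on (isum (size p) (fun i => p`_i)) => // x _; rewrite horner_coef.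
Qed.

(** A majorant of [|x|^k] that is at least [1] and bounded on a segment by the product of its values
    at the ends, so that it can be moved inside tail integrals. *)
Let maj k x := 1 + x ^+ (2 * k).
Let maj_ge1 k x : 1 <= maj k x.
Proof. by rewrite lerDl exprM exprn_ge0// sqr_ge0. Qed.

Let maj_le k (x0 x y : R) : (x0 <= x <= y) || (y <= x <= x0) -> maj k x <= maj k x0 * maj k y.
Proof.
have aux (z z' : R) : `|z| <= `|z'| -> z ^+ (2 * k) <= z' ^+ (2 * k).
  move=> zz'; rewrite !exprM -(real_normK (num_real z)) -(real_normK (num_real z')).
  by rewrite lerXn2r ?nnegrE ?sqr_ge0// lerXn2r ?nnegrE.
move=> H; have [h|h] : `|x| <= `|x0| \/ `|x| <= `|y|.
  case/orP: H => /andP[h1 h2]; have [x0'|x0'] := leP 0 x.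
  - by right; rewrite !ger0_norm// (le_trans x0').
  - by left; rewrite !ltr0_norm// ?lerN2// (le_lt_trans h1).
  - by left; rewrite !ger0_norm// (le_trans x0').
  - by right; rewrite !ltr0_norm// ?lerN2// (le_lt_trans h1).
- apply: (@le_trans _ _ (maj k x0)); first by rewrite /maj lerD2l aux.
  by rewrite ler_peMr// (le_trans ler01).
- apply: (@le_trans _ _ (maj k y)); first by rewrite /maj lerD2l aux.
  by rewrite ler_peMl// (le_trans ler01).
Qed.

Let imaj k (h : R -> R) : (forall x, J x -> h x = `|mu - x| * maj k x * f x) -> integrable_on J h.
Proof.
move=> hE.
have i1 : integrable_on J (fun x => ((mu%:P - 'X) * (1 + 'X^(2 * k))).[x] * f x) by exact: poly_moment.
apply: eq_integrable_on (integrable_on_norm mJ i1) => // x Jx.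
rewrite hE// !normrM (ger0_norm (f_ge0 x)) hornerM hornerD hornerN hornerC hornerX.
by rewrite hornerD hornerXn -polyC1 hornerC normrM (ger0_norm (_ : 0 <= 1 + _))// (le_trans ler01)// maj_ge1.
Qed.

(** For [y > x] the point [x] lies between [t 0] and [y], so [maj k x] can be pulled into the tail
    integral that represents [F x]. What results is the tail of a convergent integral. *)
Let maj_F_right k x : J x -> mu <= x -> t 0%N <= x ->
  maj k x * F x <= maj k (t 0%N) * Rintegral leb (J `&` `]x, +oo[) (fun y => `|mu - y| * maj k y * f y).
Proof.
move=> Jx mux tx; have mI : measurable (J `&` `]x, +oo[) by exact: measurableI.
have sI : J `&` `]x, +oo[ `<=` J by move=> y [].
have im := integrable_onS mJ mI sI (imaj (fun x _ => erefl (`|mu - x| * maj k x * f x))).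
rewrite F_right -mulN1r mulrA mulrN1 -!RintegralZl//; last exact: subT.
apply: le_Rintegral => //; [exact: (integrable_onZ _ mI (subT mI iphi))|exact: integrable_onZ|].
move=> y [Jy]; rewrite /= in_itv/= andbT => xy.
have ym : mu - y <= 0 by rewrite subr_le0 ltW// (le_lt_trans mux).
rewrite (ler0_norm ym) /phi mulNr -mulrN -mulNr.
rewrite (_ : _ * (_ * _ * f y) = (maj k (t 0%N) * maj k y) * (- (mu - y) * f y)); last by ring.
rewrite ler_wpM2r//; first by rewrite mulr_ge0// oppr_ge0.
by apply: maj_le; rewrite tx (ltW xy).
Qed.

Let maj_F_left k x : J x -> x <= mu -> x <= s 0%N ->
  maj k x * F x <= maj k (s 0%N) * Rintegral leb (J `&` `]-oo, x]) (fun y => `|mu - y| * maj k y * f y).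
Proof.
move=> Jx xmu xs; have mI : measurable (J `&` `]-oo, x]) by exact: measurableI.
have sI : J `&` `]-oo, x] `<=` J by move=> y [].
have im := integrable_onS mJ mI sI (imaj (fun x _ => erefl (`|mu - x| * maj k x * f x))).
rewrite -FE -!RintegralZl//; last exact: subT.
apply: le_Rintegral => //; [exact: (integrable_onZ _ mI (subT mI iphi))|exact: integrable_onZ|].
move=> y [Jy]; rewrite /= in_itv/= => yx.
have ym : 0 <= mu - y by rewrite subr_ge0 (le_trans yx).
rewrite (ger0_norm ym) /phi.
rewrite (_ : _ * (_ * _ * f y) = (maj k (s 0%N) * maj k y) * ((mu - y) * f y)); last by ring.
rewrite ler_wpM2r//; first by rewrite mulr_ge0.
by apply: maj_le; rewrite yx xs orbT.
Qed.

Let cvg_poly (r : nat -> R) : (forall n, J (r n)) ->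
  (forall k, exists2 tau : nat -> R, tau n @[n --> \oo] --> (0 : R) &
     \forall n \near \oo, maj k (r n) * F (r n) <= tau n) ->
  forall p, p.[r n] * F (r n) @[n --> \oo] --> (0 : R).
Proof.
move=> Jr H.
have mono k : r n ^+ k * F (r n) @[n --> \oo] --> (0 : R).
  have [tau tau0 tauP] := H k; apply: (@cvg0_sqr_le _ _ (fun n => tau n * tau n)); last first.
    by rewrite -[X in _ --> X](mulr0 (0 : R)); exact: cvgM.
  move: tauP; apply: filterS => n Hn.
  rewrite -real_normK ?num_real// expr2.
  suff E : `|r n ^+ k * F (r n)| <= tau n by rewrite ler_pM.
  apply: le_trans Hn; rewrite normrM (gtr0_norm (F_gt0 (Jr n))) ler_wpM2r ?(ltW (F_gt0 (Jr n)))//.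
  rewrite /maj mulnC exprM -(real_normK (num_real (r n ^+ k))).
  by have := normr_ge0 (r n ^+ k); nra.
have isum m (c : nat -> R) : (\sum_(i < m) c i * r n ^+ i) * F (r n) @[n --> \oo] --> (0 : R).
  elim: m => [|m IH].
    by under eq_fun do rewrite big_ord0 mul0r; exact: cvg_cst.
  have cv : ((\sum_(i < m) c i * r n ^+ i) * F (r n) + c m * (r n ^+ m * F (r n)))
      @[n --> \oo] --> (0 + c m * 0 : R).
    by apply: cvgD => //; apply: cvgM => //; exact: cvg_cst.
  rewrite mulr0 addr0 in cv; apply: cvg_trans cv; apply: near_eq_cvg; apply: nearW => n.
  by rewrite big_ord_recr/= mulrDl mulrA.
move=> p; have := isum (size p) (fun i => p`_i); apply: cvg_trans; apply: near_eq_cvg.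
by apply: nearW => n; rewrite horner_coef.
Qed.

Lemma pearson_base : pearson a w s t delta beta gamma f 1 mu.
Proof.
have [Jst st nis ndt stx] := est; split => //.
- by move=> x Jx; have := dF Jx; rewrite mul1r.
- exact: poly_moment.
- move=> p; split.
  + apply: (@cvg_poly s) => [n|k]; first exact: (Jst n).1.
    exists (fun n => maj k (s 0%N) * Rintegral leb (J `&` `]-oo, s n]) (fun y => `|mu - y| * maj k y * f y)).
      rewrite -[X in _ --> X](mulr0 (maj k (s 0%N))); apply: cvgM; first exact: cvg_cst.
      exact: (cvg_Rint_tail_left est (imaj (fun x _ => erefl _))).
    move: (stx _ mean_supp); apply: filterS => n /andP[smu _].
    by apply: maj_F_left => //; [exact: (Jst n).1|exact: nis].
  + apply: (@cvg_poly t) => [n|k]; first exact: (Jst n).2.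
    exists (fun n => maj k (t 0%N) * Rintegral leb (J `&` `]t n, +oo[) (fun y => `|mu - y| * maj k y * f y)).
      rewrite -[X in _ --> X](mulr0 (maj k (t 0%N))); apply: cvgM; first exact: cvg_cst.
      exact: (cvg_Rint_tail_right est (imaj (fun x _ => erefl _))).
    move: (stx _ mean_supp); apply: filterS => n /andP[_ mut].
    by apply: maj_F_right => //; [exact: (Jst n).2|exact: ndt].
Qed.
End Moments.
End BasePair.

(** * The tower of weights q^k f *)

Section Tower.
Context {R : realType}.
Notation leb := (@lebesgue_measure R).
Variables (a w : \bar R).
Notation J := (supp_int a w).
Variables (s t : nat -> R) (delta beta gamma : R) (f : R -> R) (mu : R).
Notation q := (qpol delta beta gamma).
Hypotheses (est : exhausts a w s t) (delta0 : delta <= 0).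
Hypothesis q_gt0 : forall x, J x -> 0 < q x.
Hypothesis pb : pearson a w s t delta beta gamma f 1 mu.
Implicit Types (h : R -> R) (u : nat -> R -> R) (p e g : {poly R}) (k m n M N : nat).

Let mJ : measurable J := supp_int_measurable a w.

(* lam k m is the m-th eigenvalue of the Pearson operator of the weight wt k. *)
Definition wt k x := q x ^+ k * f x.
Definition lam k m : R := m%:R * (1 - 2 * k%:R * delta - (m%:R - 1) * delta).
Definition nrm k (u : R -> R) := Rintegral leb J (fun x => u x ^+ 2 * wt k x).
Definition mean k (u : R -> R) := Rintegral leb J (fun x => u x * wt k x).
Definition mass k := Rintegral leb J (wt k).
Definition orth k m (u : R -> R) := forall p, (size p <= m)%N -> Rintegral leb J (fun x => u x * p.[x] * wt k x) = 0.

Let kap_gt0 k : 0 < 1 - 2 * k%:R * delta.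
Proof. by rewrite subr_gt0 (le_lt_trans _ ltr01)// mulr_ge0_le0// mulr_ge0. Qed.

Lemma wtS k : wt k.+1 = (fun x => q x * wt k x).
Proof. by apply/funext => x; rewrite /wt exprS mulrA. Qed.

Lemma pearson_wt k : exists c, pearson a w s t delta beta gamma (wt k) (1 - 2 * k%:R * delta) c.
Proof.
elim: k => [|k [c IH]].
  exists mu; rewrite mulr0 mul0r subr0 (_ : wt 0 = f)//.
  by apply/funext => x; rewrite /wt mul1r.
exists (((1 - 2 * k%:R * delta) * c + beta) / (1 - 2 * k%:R * delta - 2 * delta)).
rewrite wtS (_ : 1 - 2 * k.+1%:R * delta = 1 - 2 * k%:R * delta - 2 * delta); last by rewrite -natr1; ring.
exact: pearson_next.
Qed.

Lemma wt_gt0 k x : J x -> 0 < wt k x.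
Proof. by move=> Jx; have [c H] := pearson_wt k; exact: (W_gt0 H). Qed.

Lemma cont_wt k : cont_on a w (wt k).
Proof. by have [c H] := pearson_wt k; exact: (cont_W H). Qed.

Lemma int_poly_wt k p : integrable_on J (fun x => p.[x] * wt k x).
Proof. by have [c H] := pearson_wt k; exact: (int_polyW H). Qed.

Lemma int_poly2_wt k p : integrable_on J (fun x => p.[x] ^+ 2 * wt k x).
Proof. by apply: eq_integrable_on (int_poly_wt k (p ^+ 2)) => // x _; rewrite horner_exp. Qed.

Lemma int_wt k : integrable_on J (wt k).
Proof. by apply: eq_integrable_on (int_poly_wt k 1) => // x _; rewrite -polyC1 hornerC mul1r. Qed.

Lemma J_ex : exists x, J x. Proof. exists (s 0%N); exact: J_nonempty est. Qed.

Lemma mass_gt0 k : 0 < mass k.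
Proof.
have [x Jx] := J_ex; have [c [d [Jc Jd /andP[cx xd]]]] := supp_int_enlarge Jx.
apply: (Rint_gt0 mJ (int_wt k) _ (lt_trans cx xd)) => [y Jy|y /andP[cy yd]].
  by rewrite ltW// wt_gt0.
have Jy : J y by apply: supp_int_convex Jc Jd _; rewrite !ltW.
by split => //; exact: wt_gt0.
Qed.

Lemma lam_gt0 k m : (0 < m)%N -> 0 < lam k m.
Proof.
move=> m0; rewrite mulr_gt0 ?ltr0n// -addrA -opprD -mulrDl subr_gt0 (le_lt_trans _ ltr01)//.
rewrite mulr_ge0_le0// addr_ge0// ?mulr_ge0// subr_ge0 ler1n//.
Qed.

Section Level.
Variables (k : nat) (h h1 : R -> R).
Hypotheses (ach : ac_on a w h h1) (ih1 : integrable_on J (fun x => h1 x ^+ 2 * wt k.+1 x)).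

Let ih1' : integrable_on J (fun x => h1 x ^+ 2 * (q x * wt k x)).
Proof. by move: ih1; rewrite wtS. Qed.

Lemma level_int : integrable_on J (fun x => h x ^+ 2 * wt k x).
Proof. by have [c H] := pearson_wt k; exact: (hardy est delta0 q_gt0 (kap_gt0 k) H ach ih1').1. Qed.

Lemma level_int_poly p : integrable_on J (fun x => h x * p.[x] * wt k x).
Proof. by have [c H] := pearson_wt k; exact: (int_h_poly_W est delta0 q_gt0 (kap_gt0 k) H ach ih1'). Qed.

Lemma level_gap m : orth k m h -> lam k m * nrm k h <= nrm k.+1 h1.
Proof.
have [c H] := pearson_wt k => o; rewrite /nrm wtS.
exact: (gap_all est delta0 q_gt0 (kap_gt0 k) H ach ih1' o).
Qed.

(** Integration by parts moves the derivative onto an antiderivative of the test polynomial, and the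
    Pearson operator does not raise degrees. *)
Lemma level_orth m : orth k m.+1 h -> orth k.+1 m h1.
Proof.
have [c H] := pearson_wt k => o p /deriv_onto[P sP ->].
rewrite wtS (pearson_IBP est delta0 q_gt0 (kap_gt0 k) H ach ih1').
set op := pearson_op _ _ _ _ _ _; pose b := m%:R * (1 - 2 * k%:R * delta - (m%:R - 1) * delta).
have so : (size (op + b *: P)%R <= m.+1)%N by apply: leqW; exact: size_pearson_op.
have := o _ so; rewrite (eq_Rint (k := fun x => h x * op.[x] * wt k x + b * (h x * P.[x] * wt k x))); last first.
  by move=> x _; rewrite hornerD hornerZ; ring.
rewrite RintegralD//; [|exact: level_int_poly|by apply: integrable_onZ => //; exact: level_int_poly].
rewrite RintegralZl//; last exact: level_int_poly.
by rewrite (o P sP) mulr0 addr0 => ->; rewrite oppr0.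
Qed.
End Level.

Lemma level_eigen k m p : (size p <= m.+1)%N -> orth k m (horner p) ->
  nrm k.+1 (horner p^`()) = lam k m * nrm k (horner p).
Proof.
have [c H] := pearson_wt k => sp o; rewrite /nrm wtS.
exact: (pearson_eigen est delta0 q_gt0 (kap_gt0 k) H sp o).
Qed.

(** Square integrability is stated at the top only; the Hardy estimate brings it down level by
    level. *)
Definition tower n (u : nat -> R -> R) :=
  (forall k, (k < n)%N -> ac_on a w (u k) (u k.+1)) /\ integrable_on J (fun x => u n x ^+ 2 * wt n x).

Lemma tower_int n u k : tower n u -> (k <= n)%N -> integrable_on J (fun x => u k x ^+ 2 * wt k x).
Proof.
move=> [acu iu] kn; rewrite -(subKn kn); elim: (n - k)%N (leq_subr k n) => [|j IH] jn.
  by rewrite subn0.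
have E : (n - j = (n - j.+1).+1)%N by rewrite subnSK.
have := IH (ltnW jn); rewrite E; apply: level_int; apply: acu.
by rewrite -E leq_subr.
Qed.

Lemma tower_measurable n u k : (0 < n)%N -> tower n u -> (k <= n)%N -> measurable_fun J (u k).
Proof.
move=> n0 [acu _]; rewrite leq_eqVlt => /predU1P[->|kn].
  by have := acu n.-1; rewrite prednK// => /(_ (leqnn n)) [].
exact: cont_on_measurable (ac_on_cont (acu k kn)).
Qed.

Lemma tower_int_poly n u k p : (0 < n)%N -> tower n u -> (k <= n)%N ->
  integrable_on J (fun x => u k x * p.[x] * wt k x).
Proof.
move=> n0 tu kn; apply: integrable_on_mul => //.
- exact: tower_measurable tu kn.
- by apply: cont_on_measurable; exact: cont_on_horner.
- by apply: cont_on_measurable; exact: cont_wt.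
- by move=> x Jx; rewrite ltW// wt_gt0.
- exact: tower_int tu kn.
- exact: int_poly2_wt.
Qed.

Lemma tower_sub_poly n u p : (0 < n)%N -> tower n u -> tower n (fun k x => u k x - p^`(k).[x]).
Proof.
move=> n0 tu; have [acu iu] := tu; split.
  by move=> k kn; rewrite derivnS; apply: ac_onB; [exact: acu|exact: ac_horner].
have i1 := integrable_onD mJ iu (int_poly2_wt n p^`(n)).
apply: integrable_on_dom (integrable_onZ 2 mJ i1) _ => //.
  apply: measurable_funM; last by apply: cont_on_measurable; exact: cont_wt.
  apply: measurable_funX; apply: measurable_funB; first exact: tower_measurable tu (leqnn n).
  by apply: cont_on_measurable; exact: cont_on_horner.
move=> x Jx; rewrite ger0_norm; last by rewrite mulr_ge0 ?sqr_ge0// ltW// wt_gt0.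
rewrite -mulrDl mulrA ler_wpM2r//; first by rewrite ltW// wt_gt0.
by have := sqr_ge0 (u n x + p^`(n).[x]); rewrite !expr2; lra.
Qed.

Lemma orth_tower n u N j : tower n u -> orth 0 N (u 0%N) -> (j <= n)%N -> (j <= N)%N ->
  orth j (N - j) (u j).
Proof.
move=> tu o; elim: j => [|j IH] jn jN; first by rewrite subn0.
apply: level_orth; first exact: (proj1 tu).
  exact: tower_int tu jn.
by rewrite subnSK//; apply: IH; exact: ltnW.
Qed.

Lemma orth_poly N e j : orth 0 N (horner e) -> (j <= N)%N -> orth j (N - j) (horner e^`(j)).
Proof.
move=> o; elim: j => [|j IH] jN; first by rewrite subn0.
rewrite derivnS; apply: (@level_orth j (horner e^`(j))); first exact: ac_horner.
  exact: int_poly2_wt.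
by rewrite subnSK//; apply: IH; exact: ltnW.
Qed.

(** [u j] is orthogonal to degrees below [N - j] at level [j], so climbing from [j] to [j + 1] gains
    [lam j (N - j)]. The start is level [1], the level of the energy in [S1]. *)
Lemma chain n u N M : tower n u -> orth 0 N (u 0%N) -> (n <= N)%N -> (0 < M <= n)%N ->
  (\prod_(1 <= j < M) lam j (N - j)) * nrm 1 (u 1%N) <= nrm M (u M).
Proof.
move=> tu o nN; elim: M => // -[|M] IH /andP[_ Mn]; first by rewrite big_geq// mul1r.
rewrite big_nat_recr//= mulrAC mulrC.
have MN : (M.+1 < N)%N by exact: leq_trans nN.
apply: le_trans (ler_wpM2l _ (IH _)) _.
- by rewrite ltW// lam_gt0// subn_gt0.
- exact: ltnW.
apply: level_gap; first exact: (proj1 tu).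
  exact: tower_int tu Mn.
by apply: orth_tower tu o _ _; exact: ltnW.
Qed.

Lemma size_derivn_le p j N : (size p <= N + j)%N -> (size p^`(j) <= N)%N.
Proof.
move=> sp; apply/leq_sizeP => i Ni; rewrite coef_derivn nth_default ?mul0rn//.
by apply: leq_trans sp _; rewrite addnC leq_add2l.
Qed.

(** For such [e] each gap is an equality. Besides the equality cases this evaluates the norms in
    Gram-Schmidt and in Bessel's identity. *)
Lemma chain_poly e N i M : (size e <= N.+1)%N -> orth 0 N (horner e) -> (i <= M <= N)%N ->
  (\prod_(i <= j < M) lam j (N - j)) * nrm i (horner e^`(i)) = nrm M (horner e^`(M)).
Proof.
move=> se o; elim: M => [|M IH] /andP[iM MN].
  by move: iM; rewrite leqn0 => /eqP ->; rewrite big_geq// mul1r.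
move: iM; rewrite leq_eqVlt => /predU1P[->|]; first by rewrite big_geq// mul1r.
rewrite ltnS => iM; have iMN : (i <= M <= N)%N by rewrite iM ltnW.
rewrite big_nat_recr// mulrAC (IH iMN) derivnS.
rewrite (@level_eigen M (N - M)) ?(mulrC (lam _ _))//.
  by apply: size_derivn_le; rewrite addSn subnK// ltnW.
by apply: orth_poly o _; exact: ltnW.
Qed.

Definition is_proj N (u : R -> R) p := (size p <= N)%N /\ orth 0 N (fun x => u x - p.[x]).

(** Gram-Schmidt: [e] is ['X^N] minus its projection, and the next projection adds the component of
    [u] along [e]. *)
Lemma proj_ex N (u : R -> R) : (forall p, integrable_on J (fun x => u x * p.[x] * wt 0 x)) -> exists p, is_proj N u p.
Proof.
have ipp e p : integrable_on J (fun x => e.[x] * p.[x] * wt 0 x).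
  by apply: eq_integrable_on (int_poly_wt 0 (e * p)) => // x _; rewrite hornerM.
have iup v e p : (forall p, integrable_on J (fun x => v x * p.[x] * wt 0 x)) ->
    integrable_on J (fun x => (v x - e.[x]) * p.[x] * wt 0 x).
  by move=> iv; apply: eq_integrable_on (integrable_onB mJ (iv p) (ipp e p)) => // x _; rewrite !mulrBl.
elim: N u => [|N IH] u iu.
  exists 0; split; first by rewrite size_poly0.
  move=> p; rewrite leqn0 size_poly_eq0 => /eqP ->.
  rewrite (eq_Rint (k := fun=> 0)); last by move=> x _; rewrite !horner0 mulr0 mul0r.
  by rewrite Rintegral_cst ?mul0r.
have [p1 [sp1 o1]] := IH u iu.
have [p2 [sp2 o2]] := IH (horner 'X^N) (ipp _).
pose e := 'X^N - p2.
have oe : orth 0 N (horner e).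
  move=> p sp; rewrite -(o2 p sp); apply: eq_Rint => x _; by rewrite hornerD hornerN.
have se : (size e <= N.+1)%N.
  by rewrite (leq_trans (size_polyD _ _))// geq_max size_polyXn leqnn size_polyN leqW.
have eN : e`_N = 1 by rewrite coefB coefXn eqxx nth_default// subr0.
have eNc : e^`(N) = (N`!)%:R%:P.
  apply/polyP => i; rewrite coef_derivn coefC; case: i => [|i] /=.
    by rewrite addn0 eN ffactnn.
  by rewrite nth_default ?mul0rn// (leq_trans se)// addnS ltnS leq_addr.
(* Up to the positive product of eigenvalues, the norm of [e] is that of its [N]-th derivative, the
   constant [N!]. *)
have ne : 0 < nrm 0 (horner e).
  have := @chain_poly e N 0 N se oe; rewrite leqnn => /(_ isT) E.
  rewrite -(pmulr_rgt0 _ (_ : 0 < \prod_(0 <= j < N) lam j (N - j))); last first.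
    rewrite big_seq; apply: prodr_gt0 => j; rewrite mem_index_iota => /andP[_ jN].
    by rewrite lam_gt0// subn_gt0.
  rewrite -[e in horner e]/(e^`(0)) E eNc.
  rewrite /nrm (eq_Rint (k := fun x => N`!%:R ^+ 2 * wt N x)); last by move=> x _; rewrite hornerC.
  rewrite RintegralZl//; last exact: int_wt.
  by rewrite mulr_gt0 ?mass_gt0// exprn_gt0// ltr0n fact_gt0.
pose c := Rintegral leb J (fun x => (u x - p1.[x]) * e.[x] * wt 0 x) / nrm 0 (horner e).
exists (p1 + c *: e); split.
  rewrite (leq_trans (size_polyD _ _))// geq_max (leqW sp1)/=.
  by rewrite (leq_trans (size_scale_leq _ _)).
move=> p sp.
pose p' := p - p`_N *: e.
have sp' : (size p' <= N)%N.
  apply/leq_sizeP => j; rewrite leq_eqVlt => /predU1P[<-|Nj].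
    by rewrite coefB coefZ eN mulr1 subrr.
  rewrite coefB coefZ [p`_j]nth_default ?(leq_trans sp)//.
  by rewrite [e`_j]nth_default ?(leq_trans se)// mulr0 subr0.
have i1 := iup u p1 p' iu; have i2 := iup u p1 e iu.
have i3 := ipp e p'; have i4 := int_poly2_wt 0 e.
rewrite (eq_Rint (k := fun x => (((u x - p1.[x]) * p'.[x] * wt 0 x + p`_N * ((u x - p1.[x]) * e.[x] * wt 0 x))
   + (- c) * (e.[x] * p'.[x] * wt 0 x)) + (- (c * p`_N)) * (e.[x] ^+ 2 * wt 0 x))); last first.
  have eD x : (p1 + c *: e).[x] = p1.[x] + c * e.[x] by rewrite hornerD hornerZ.
  have pD x : p.[x] = p'.[x] + p`_N * e.[x] by rewrite /p' hornerD hornerN hornerZ subrK.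
  by move=> x _; rewrite (eD x) (pD x); ring.
rewrite !RintegralD ?RintegralZl//; last 5 first.
- exact: integrable_onZ.
- by apply: integrable_onD => //; exact: integrable_onZ.
- exact: integrable_onZ.
- by apply: integrable_onD => //; [apply: integrable_onD => //; exact: integrable_onZ|exact: integrable_onZ].
- exact: integrable_onZ.
rewrite (o1 p' sp') (oe p' sp') -/(nrm 0 (horner e)) mulr0 add0r addr0 /c.
by field; rewrite gt_eqF.
Qed.

Lemma nrm_add_poly k (u : R -> R) p : integrable_on J (fun x => u x ^+ 2 * wt k x) ->
  integrable_on J (fun x => u x * p.[x] * wt k x) ->
  nrm k (fun x => u x + p.[x]) = nrm k u + 2 * Rintegral leb J (fun x => u x * p.[x] * wt k x) + nrm k (horner p).
Proof.
move=> i1 i2; have i3 := int_poly2_wt k p.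
rewrite /nrm (eq_Rint (k := fun x => (u x ^+ 2 * wt k x + 2 * (u x * p.[x] * wt k x)) + p.[x] ^+ 2 * wt k x)); last first.
  by move=> x _; ring.
rewrite !RintegralD ?RintegralZl//; first exact: integrable_onZ.
by apply: integrable_onD => //; exact: integrable_onZ.
Qed.

(** After [N] derivatives the residual is still orthogonal to constants, so the constant [p^(N)] is
    the average of [u N] for [wt N]. *)
Lemma orth_top_coef n u N p : (0 < n)%N -> tower n u -> (N <= n)%N -> (size p <= N.+1)%N ->
  orth 0 N.+1 (fun x => u 0%N x - p.[x]) ->
  exists c, p^`(N) = c%:P /\ mean N (u N) = c * mass N.
Proof.
move=> n0 tu Nn sp o.
have [c E] : exists c, p^`(N) = c%:P.
  by exists (p^`(N))`_0; apply: size1_polyC; apply: size_derivn_le; rewrite add1n.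
exists c; split => //.
have tr := tower_sub_poly p n0 tu.
have := @orth_tower n _ N.+1 N tr o Nn (leqnSn N); rewrite subSnn => /(_ 1).
rewrite size_poly1 => /(_ isT).
rewrite E (eq_Rint (k := fun x => u N x * wt N x + (- c) * wt N x)); last first.
  by move=> x _; rewrite -polyC1 !hornerC; ring.
have iu : integrable_on J (fun x => u N x * wt N x).
  by apply: eq_integrable_on (tower_int_poly 1 n0 tu Nn) => // x _; rewrite -polyC1 hornerC mulr1.
have iw := int_wt N.
rewrite RintegralD ?RintegralZl//; last exact: integrable_onZ.
by rewrite mulNr => /eqP; rewrite subr_eq0 => /eqP.
Qed.

(** Induction on [M]: consecutive projections differ by [e], whose derivative is orthogonal to that
    of the new residual. Its energy is found by climbing until [e] has become the constant of
    [orth_top_coef]. *)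
Lemma bessel n u M p : (0 < n)%N -> tower n u -> (0 < M <= n.+1)%N -> is_proj M (u 0%N) p ->
  nrm 1 (u 1%N) = nrm 1 (fun x => u 1%N x - p^`(1).[x]) +
    \sum_(1 <= i < M) mean i (u i) ^+ 2 / mass i / \prod_(1 <= j < i) lam j (i - j).
Proof.
move=> n0 tu; elim: M p => // -[|M] IH p /andP[_ Mn] [sp o].
  rewrite big_geq// addr0; apply: eq_Rint => x _.
  by have := @size_derivn_le p 1 0 sp; rewrite leqn0 size_poly_eq0 => /eqP ->; rewrite horner0 subr0.
have [pM [spM oM]] := proj_ex M.+1 (fun p => tower_int_poly p n0 tu (leq0n n)).
rewrite (IH pM (ltnW Mn) (conj spM oM)).
rewrite [in RHS]big_nat_recr//= addrA [in RHS]addrAC; congr (_ + _).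
have tr := tower_sub_poly p n0 tu.
pose e := p - pM.
have se : (size e <= M.+2)%N.
  by rewrite (leq_trans (size_polyD _ _))// geq_max sp size_polyN leqW.
have i0 := fun g => tower_int_poly g n0 (tower_sub_poly p n0 tu) (leq0n n).
have i0M := fun g => tower_int_poly g n0 (tower_sub_poly pM n0 tu) (leq0n n).
have oe : orth 0 M.+1 (horner e).
  move=> g sg; rewrite (eq_Rint (k := fun x => (u 0%N x - pM.[x]) * g.[x] * wt 0 x - (u 0%N x - p.[x]) * g.[x] * wt 0 x)); last first.
    by move=> x _; rewrite /e hornerD hornerN; ring.
  rewrite RintegralB//; [|exact: i0M|exact: i0].
  by rewrite (oM g sg) (o g (leqW sg)) subr0.
have -> : nrm 1 (fun x => u 1%N x - pM^`(1).[x]) = nrm 1 (fun x => (u 1%N x - p^`(1).[x]) + e^`(1).[x]).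
  by apply: eq_Rint => x _; rewrite /e derivnB hornerD hornerN; congr (_ ^+ 2 * _); ring.
rewrite nrm_add_poly; [|exact: (tower_int tr n0)|exact: (tower_int_poly e^`(1) n0 tr n0)].
have se1 : (size e^`(1) <= M.+1)%N by apply: (@size_derivn_le e 1 M.+1); rewrite addn1.
rewrite (@orth_tower n _ M.+2 1 tr o n0 isT _ se1) mulr0 addr0; congr (_ + _).
have CP := @chain_poly e M.+1 1 M.+1 se oe; rewrite ltnS leq0n leqnn in CP.
have {}CP := CP isT.
have P0 : 0 < \prod_(1 <= j < M.+1) lam j (M.+1 - j).
  rewrite big_seq; apply: prodr_gt0 => j; rewrite mem_index_iota => /andP[_ jN].
  by rewrite lam_gt0// subn_gt0.
apply: (mulfI (lt0r_neq0 P0)); rewrite CP mulrCA divff ?mulr1 ?gt_eqF//.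
have [c [pc uc]] := @orth_top_coef n u M.+1 p n0 tu Mn sp o.
have eE : e^`(M.+1) = c%:P.
  rewrite /e derivnB pc; have := @size_derivn_le pM M.+1 0 spM.
  by rewrite leqn0 size_poly_eq0 => /eqP ->; rewrite subr0.
have m0 := mass_gt0 M.+1.
rewrite uc eE /nrm (eq_Rint (k := fun x => c ^+ 2 * wt M.+1 x)); last by move=> x _; rewrite hornerC.
rewrite RintegralZl//; last exact: int_wt.
by rewrite -/(mass _); field; rewrite gt_eqF.
Qed.
End Tower.

(** * Comparison of the bounds *)

Section Coefficients.
Context {R : realType}.
Variable delta : R.
Hypothesis delta0 : delta <= 0.
Local Notation lam := (lam delta).
Implicit Types i j m n : nat.

Lemma one_sub_gt0 j : 0 < 1 - j%:R * delta.
Proof. by rewrite subr_gt0 (le_lt_trans _ ltr01)// mulr_ge0_le0. Qed.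

Lemma lam_sub i j : (j < i)%N -> lam j (i - j) = (i - j)%:R * (1 - (j + i.-1)%:R * delta).
Proof.
move=> ji; rewrite /lam; congr (_ * _).
have i0 : (0 < i)%N by exact: leq_ltn_trans ji.
rewrite natrB ?(ltnW ji)// natrD -{1}(prednK i0) -natr1; ring.
Qed.

(** As [lam j (i - j) = (i - j) (1 - (j + i - 1) delta)], the integers build the factorial and the
    rest the shifted product: the denominators of the theorem are products of eigenvalues. *)
Lemma prod_lam i : \prod_(0 <= j < i) lam j (i - j) =
  i`!%:R * \prod_(i.-1 <= j < (2 * i).-1) (1 - j%:R * delta).
Proof.
case: i => [|i]; first by rewrite !big_geq// mulr1.
have E : (2 * i.+1).-1 = (i + i.+1)%N by rewrite mul2n -addnn.
rewrite E [LHS](eq_big_nat _ _ (F2 := fun j => (i.+1 - j)%:R * (1 - (j + i)%:R * delta))); last first.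
  by move=> j /andP[_ ji]; rewrite (@lam_sub i.+1 j).
rewrite big_split/=; congr (_ * _).
  rewrite fact_prod natr_prod big_nat_rev/= [RHS]big_add1/=.
  by apply: eq_big_nat => j /andP[_ ji]; rewrite add0n subSS subSn ?leq_subr// subKn.
by rewrite -[in RHS](add0n i) big_addn addKn.
Qed.

Lemma prod_lam_gt0 i N M : (M <= N)%N -> 0 < \prod_(i <= j < M) lam j (N - j).
Proof.
move=> MN; rewrite big_seq; apply: prodr_gt0 => j; rewrite mem_index_iota => /andP[_ jM].
by apply: lam_gt0 => //; rewrite subn_gt0 (leq_trans jM).
Qed.

Lemma weak_denominator n : (0 < n)%N ->
  n`!%:R * \prod_(n.-1 <= j < (2 * n).-1) (1 - j%:R * delta) =
  lam 0 n * \prod_(1 <= j < n) lam j (n - j).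
Proof. by move=> n0; rewrite -prod_lam big_ltn// subn0. Qed.

(** Multiplied by [lam n 1 = 1 - 2 n delta], both sides become those of [weak_denominator] for
    [n + 1]. *)
Lemma strong_denominator n : (0 < n)%N ->
  n.+1`!%:R * \prod_(n <= j < (2 * n)%N) (1 - j%:R * delta) =
  lam 0 n.+1 * \prod_(1 <= j < n) lam j (n.+1 - j).
Proof.
move=> n0; have l1 : lam n 1 = 1 - (2 * n)%:R * delta by rewrite /lam natrM; ring.
have l0 : lam n 1 != 0 by rewrite gt_eqF ?lam_gt0.
apply: (mulIf l0); rewrite {1}l1 -mulrA -[RHS]mulrA.
have := weak_denominator (ltn0Sn n); rewrite mulnS add2n/=.
rewrite big_nat_recr ?leq_pmull// big_nat_recr//= subSnn.
by move=> ->.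
Qed.

Lemma falling_ffact m i : (i <= m)%N -> falling (m%:R : R) i = (m ^_ i)%:R.
Proof.
move=> im; rewrite /falling ffact_prod natr_prod; apply: eq_bigr => j _.
by rewrite natrB// ltnW// (leq_trans (ltn_ord j)).
Qed.

Lemma bin_falling m i : (i <= m)%N ->
  'C(m, i)%:R * i`!%:R * m.+1%:R = (m.+1 - i)%:R * falling (m.+1%:R : R) i.
Proof.
move=> im; rewrite falling_ffact ?leqW// -!natrM; congr _%:R.
by rewrite bin_ffact mulnC -ffactSS ffactnSr mulnC.
Qed.

(* Rests on (m+1-i)(1-(m+i)delta) = (m+1)(1-m delta) - i(1-(i-1)delta). *)
Lemma coef_split m i (b E : R) : (0 < i <= m)%N -> E != 0 ->
  'C(m, i)%:R * (1 - (m + i)%:R * delta) * b /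
    (falling (m.+1%:R) i * E * (\prod_(i.-1 <= j < (2 * i).-1) (1 - j%:R * delta)) * (1 - m%:R * delta)) =
  b / (i`!%:R * E * \prod_(i.-1 <= j < (2 * i).-1) (1 - j%:R * delta))
  - b / E / \prod_(1 <= j < i) lam j (i - j) / (m.+1%:R * (1 - m%:R * delta)).
Proof.
move=> /andP[i0 im] E0.
have PE := prod_lam i; have BF := bin_falling im.
rewrite big_ltn// in PE.
have L0 : lam 0 (i - 0) = i%:R * (1 - i.-1%:R * delta) by rewrite lam_sub// subn0.
rewrite L0 in PE.
set Pi := \prod_(1 <= j < i) _ in PE *; set P := \prod_(_ <= j < _) _ in PE *.
have Pi0 : Pi != 0 by rewrite gt_eqF// prod_lam_gt0.
have P0 : P != 0 by rewrite gt_eqF//; apply: prodr_gt0 => j _; exact: one_sub_gt0.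
have d1 : 1 - m%:R * delta != 0 by rewrite gt_eqF// one_sub_gt0.
have f0 : falling (m.+1%:R : R) i != 0.
  by rewrite falling_ffact ?leqW// pnatr_eq0 -lt0n ffact_gt0 leqW.
have m0 : (m.+1%:R : R) != 0 by rewrite pnatr_eq0.
have g0 : (i`!%:R : R) != 0 by rewrite pnatr_eq0 -lt0n fact_gt0.
have CE : 'C(m, i)%:R = (m.+1 - i)%:R * falling (m.+1%:R : R) i / (i`!%:R * m.+1%:R).
  by rewrite -BF; field; rewrite g0 addrC natr1 m0.
have PiE : Pi^-1 = i%:R * (1 - i.-1%:R * delta) / (i`!%:R * P).
  by rewrite -PE; field; rewrite Pi0 !gt_eqF ?one_sub_gt0 ?ltr0n.
rewrite CE PiE; have im' : (i <= m.+1)%N by exact: leqW.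
have iE : i%:R = i.-1%:R + 1 :> R by rewrite natr1 prednK.
rewrite natrB// natrD iE -natr1; rewrite -natr1 in m0.
by field; rewrite P0 d1 m0 g0 E0 natr1 f0.
Qed.
End Coefficients.

Section Assembly.
Context {R : realType}.
Notation leb := (@lebesgue_measure R).
Variables (f : R -> R) (mu delta beta gamma : R) (a w : \bar R) (n : nat)
  (g : R -> R) (gd : nat -> R -> R).
Notation J := (supp_int a w).
Notation q := (qpol delta beta gamma).
Hypotheses (ip : IP f mu delta beta gamma) (supp : support_is f a w) (delta0 : delta <= 0).
Hypotheses (n0 : (0 < n)%N) (hn : Hnn f delta beta gamma a w n g gd).

Let mJ : measurable J := supp_int_measurable a w.
Local Notation wt := (wt delta beta gamma f).
Local Notation lam := (lam delta).
Local Notation nrm := (nrm a w delta beta gamma f).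
Local Notation mean := (mean a w delta beta gamma f).
Local Notation mass := (mass a w delta beta gamma f).
Local Notation orth := (orth a w delta beta gamma f).
Local Notation is_proj := (is_proj a w delta beta gamma f).
Local Notation tower := (tower a w delta beta gamma f).

Lemma Exp_nrm i (u : R -> R) : Exp f (fun x => q x ^+ i * u x ^+ 2) = nrm i u.
Proof.
rewrite /Exp (Rint_density ip supp (fun x => q x ^+ i * u x ^+ 2)).
by apply: eq_Rint => x _; rewrite /wt; ring.
Qed.

Lemma Exp_mean i (u : R -> R) : Exp f (fun x => q x ^+ i * u x) = mean i u.
Proof.
rewrite /Exp (Rint_density ip supp (fun x => q x ^+ i * u x)).
by apply: eq_Rint => x _; rewrite /wt; ring.
Qed.

Lemma Exp_mass i : Exp f (fun x => q x ^+ i) = mass i.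
Proof. by rewrite /Exp (Rint_density ip supp (fun x => q x ^+ i)). Qed.

Lemma Hnn_tower : tower n gd.
Proof.
have [gd0 [mg [mgn [dg [cg [ag [dgn ig]]]]]]] := hn; split; last first.
  apply: eq_integrable_on (integrable_onS measurableT mJ (@subsetT _ _) ig) => // x _.
  by rewrite /wt; ring.
(* Below index [n - 1], [gd k] is C1: [gd k.+1] is continuous, being differentiable itself or, at
   index [n - 1], by assumption. *)
move=> k kn; have [kn1|] := ltnP k n.-1.
  apply: ac_on_C1; first by move=> x Jx; exact: dg.
  move: kn1; rewrite leq_eqVlt => /predU1P[->|kn1] x Jx.
    have := cg; rewrite continuous_open_subspace; last exact: supp_int_open.
    by apply; rewrite inE.
  by apply/differentiable_continuous/derivable1_diffP; apply: ex_derive; exact: dg.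
rewrite leq_eqVlt ltnNge -ltnS prednK// kn orbF => /eqP <-; rewrite prednK//.
Qed.

(** The linear approximation is tested at a nearby point [y > x] of [J]. This identifies the members
    of [gd] with derivatives of a polynomial. *)
Lemma is_derive_vanish (K : R -> R) (c x : R) : is_derive x 1 K c -> J x ->
  (forall y, J y -> K y = 0) -> c = 0.
Proof.
move=> dK Jx K0; apply/eqP; rewrite -normr_le0; apply/ler_addgt0Pl => e e0; rewrite addr0.
have [r r0 rP] := is_derive_linear_approx dK e0.
have [_ [t [_ Jt /andP[_ xt]]]] := supp_int_enlarge Jx.
pose y := Num.min t (x + r / 2).
have r2 : 0 < r / 2 by rewrite divr_gt0.
have r2r : r / 2 < r by rewrite ltr_pdivrMr// ltr_pMr// ltr1n.
have xy : x < y by rewrite lt_min xt ltrDl.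
have yt : y <= t by rewrite ge_min lexx.
have yr : y <= x + r / 2 by rewrite ge_min lexx orbT.
have Jy : J y by apply: supp_int_convex Jx Jt _; rewrite ltW.
have d0 : 0 < y - x by rewrite subr_gt0.
have := rP y; rewrite (gtr0_norm d0) !K0// subrr sub0r normrN normrM (gtr0_norm d0) ler_pM2r//.
by apply; rewrite ltrBlDl (le_lt_trans yr)// ltrD2l.
Qed.

Section PolyCase.
Variable P : {poly R}.
Hypothesis gP : forall x, J x -> g x = P.[x].

Lemma poly_derivs k x : (k < n)%N -> J x -> gd k x = P^`(k).[x].
Proof.
have [gd0 [_ [_ [dg _]]]] := hn.
elim: k x => [|k IH] x kn Jx; first by rewrite gd0 gP.
apply/eqP; rewrite -subr_eq0; apply/eqP.
have d1 := dg k _ x Jx; have d2 := is_derive_poly P^`(k) x.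
apply: (@is_derive_vanish (fun y => gd k y - P^`(k).[y]) _ x) => //; last first.
  by move=> y Jy; rewrite IH ?subrr// ltnW.
rewrite [P^`(k.+1)]derivnS; apply: is_deriveB; apply: d1.
by rewrite -ltnS prednK.
Qed.

(** The top derivative is pinned down only off a null set, which suffices under the integral. *)
Lemma poly_deriv_last : {ae leb, forall x, J x -> gd n x = P^`(n).[x]}.
Proof.
have [_ [_ [_ [_ [_ [_ [dgn _]]]]]]] := hn.
move: dgn; apply: filterS; first exact: (ae_filter_ringOfSetsType leb).
move=> x dx Jx; have d1 := dx Jx; have d2 := is_derive_poly P^`(n.-1) x.
apply/eqP; rewrite -subr_eq0; apply/eqP.
apply: (@is_derive_vanish (fun y => gd n.-1 y - P^`(n.-1).[y]) _ x) => //; last first.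
  by move=> y Jy; rewrite poly_derivs ?subrr// prednK.
have -> : P^`(n) = (P^`(n.-1))^`() by rewrite -derivnS prednK.
exact: is_deriveB.
Qed.
End PolyCase.

(** * Comparison of residual energies *)

Section Bounds.
Variables (s t : nat -> R).
Hypothesis est : exhausts a w s t.
Let q_gt0 := qpol_supp_gt0 ip supp.
Let pb := pearson_base ip supp delta0 est.
Let tg := Hnn_tower.
Let mass_pos k : 0 < mass k := mass_gt0 est delta0 q_gt0 pb k.

Variables (N : nat) (p : {poly R}).
Hypotheses (Nn : (n <= N <= n.+1)%N) (pp : is_proj N (gd 0%N) p).
Let X := nrm 1 (fun x => gd 1%N x - p^`(1).[x]).
Let Y := nrm n (fun x => gd n x - p^`(n).[x]).

Let N0 : (0 < N)%N. Proof. by case/andP: Nn => h _; exact: leq_trans h. Qed.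

(** Bessel's identity is substituted for the energy in [S1]; its sum cancels the subtracted parts
    produced by [coef_split]. The index [N - 1] fits because [lam 0 N = N (1 - (N - 1) delta)]. *)
Lemma S1_residual : S1 f delta beta gamma gd N.-1 =
  \sum_(1 <= i < N) (mean i (gd i)) ^+ 2 /
    (i`!%:R * mass i * \prod_(i.-1 <= j < (2 * i).-1) (1 - j%:R * delta)) + X / lam 0 N.
Proof.
have lamN : lam 0 N = N%:R * (1 - N.-1%:R * delta).
  by rewrite /lam mulr0 mul0r subr0 -[in N%:R - 1](prednK N0) -natr1 addrK.
have B := @bessel R a w s t delta beta gamma f mu est delta0 q_gt0 pb n gd N p n0 tg.
rewrite N0 (andP Nn).2 in B; have {}B := B isT pp.
have CS := coef_split delta0 (m := N.-1); rewrite prednK// in CS.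
rewrite /S1 prednK// lamN.
have -> : Exp f (fun x => q x * gd 1%N x ^+ 2) = nrm 1 (gd 1%N).
  by rewrite -Exp_nrm; congr (Exp f _); apply/funext => x; rewrite expr1.
rewrite B -/X.
rewrite (eq_big_nat _ _ (F2 := fun i => (mean i (gd i)) ^+ 2 /
    (i`!%:R * mass i * \prod_(i.-1 <= j < (2 * i).-1) (1 - j%:R * delta)) -
    (mean i (gd i)) ^+ 2 / mass i / \prod_(1 <= j < i) lam j (i - j) / (N%:R * (1 - N.-1%:R * delta)))); last first.
  move=> i /andP[i0 iN]; rewrite Exp_mean Exp_mass; apply: CS; last by rewrite gt_eqF.
  by rewrite i0 -ltnS prednK.
rewrite big_split/= sumrN -mulr_suml mulrDl; ring.
Qed.

Lemma residual_le : (\prod_(1 <= j < n) lam j (N - j)) * X <= Y.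
Proof.
have tr := tower_sub_poly delta0 q_gt0 pb p n0 tg.
apply: (chain est delta0 q_gt0 pb tr pp.2); first by case/andP: Nn.
by rewrite n0 leqnn.
Qed.

(** For [n = 1] the product is empty. Otherwise [P - p] has degree at most [N] and is orthogonal to
    lower degrees, so [chain_poly] applies. *)
Lemma residual_eq : n = 1%N \/ ((1 < n)%N /\ poly_on J g N) ->
  (\prod_(1 <= j < n) lam j (N - j)) * X = Y.
Proof.
case=> [n1|[n1 [P [sP gP]]]].
  by rewrite /Y /X; move: n1; clear; case: n => // -[|//] _; rewrite big_geq// mul1r.
pose e := P - p.
have se : (size e <= N.+1)%N.
  by rewrite (leq_trans (size_polyD _ _))// geq_max sP size_polyN leqW// pp.1.
have eE k x : e^`(k).[x] = P^`(k).[x] - p^`(k).[x] by rewrite /e derivnB hornerD hornerN.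
have oe : orth 0 N (horner e).
  move=> r sr; rewrite -(pp.2 r sr); apply: eq_Rint => x Jx.
  by rewrite (poly_derivs gP n0 Jx) -(eE 0%N).
have XE : X = nrm 1 (horner e^`(1)).
  by apply: eq_Rint => x Jx; rewrite (poly_derivs gP n1 Jx) eE.
have YE : Y = nrm n (horner e^`(n)).
  rewrite /Y /nrm /Rintegral; congr fine; apply: ae_eq_integral => //.
  - have tr := tower_sub_poly delta0 q_gt0 pb p n0 tg.
    by apply/measurable_EFinP; apply: integrable_on_measurable; exact: tr.2.
  - by apply/measurable_EFinP; apply: integrable_on_measurable; exact: (int_poly2_wt delta0 q_gt0 pb).
  - move: (poly_deriv_last gP); apply: filterS; first exact: (ae_filter_ringOfSetsType leb).
    by move=> x H Jx; rewrite (H Jx) eE.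
rewrite XE YE.
have := chain_poly est delta0 q_gt0 pb (i := 1) (M := n) se oe.
by rewrite n0 (andP Nn).1 => /(_ isT).
Qed.

(** Both halves of the theorem at once: [N = n + 1] is the strong bound, [N = n] the weak one, and
    [A] is the sum common to the two sides. *)
Lemma residual_compare A : let L := lam 0 N in let Pi := \prod_(1 <= j < n) lam j (N - j) in
  A + X / L <= A + Y / (L * Pi) /\
  (n = 1%N \/ ((1 < n)%N /\ poly_on J g N) -> A + X / L = A + Y / (L * Pi)).
Proof.
move=> L Pi; have L0 : 0 < L by exact: lam_gt0.
have P0 : 0 < Pi by apply: prod_lam_gt0 => //; case/andP: Nn.
split=> [|/residual_eq <-]; last by rewrite -/Pi; field; rewrite !gt_eqF.
rewrite lerD2l (_ : Y / (L * Pi) = Y / Pi / L); last by field; rewrite !gt_eqF.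
rewrite ler_pM2r ?invr_gt0//.
by rewrite ler_pdivlMr// mulrC; exact: residual_le.
Qed.
End Bounds.

Section Ends.
Variables (s t : nat -> R) (p : {poly R}).
Hypothesis est : exhausts a w s t.
Let q_gt0 := qpol_supp_gt0 ip supp.
Let pb := pearson_base ip supp delta0 est.
Let tg := Hnn_tower.

(** Here [p^(n)] is the average of [gd n] for [wt n], so the residual energy is an unnormalised
    variance; hence the correction term in [Sstr]. *)
Lemma strong_end : is_proj n.+1 (gd 0%N) p ->
  nrm n (fun x => gd n x - p^`(n).[x]) = nrm n (gd n) - mean n (gd n) ^+ 2 / mass n.
Proof.
move=> [sp o]; have [c [-> mc]] := orth_top_coef est delta0 q_gt0 pb n0 tg (leqnn n) sp o.
have m0 : 0 < mass n := mass_gt0 est delta0 q_gt0 pb n.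
have iu : integrable_on J (fun x => gd n x * wt n x).
  apply: eq_integrable_on (tower_int_poly est delta0 q_gt0 pb 1 n0 tg (leqnn n)) => // x _.
  by rewrite -polyC1 hornerC mulr1.
have ip' := tower_int_poly est delta0 q_gt0 pb (- c)%:P n0 tg (leqnn n).
have E : Rintegral leb J (fun x => gd n x * (- c)%:P.[x] * wt n x) = - c * mean n (gd n).
  rewrite (eq_Rint (k := fun x => - c * (gd n x * wt n x))); last by move=> x _; rewrite hornerC; ring.
  by rewrite RintegralZl.
have -> : nrm n (fun x => gd n x - c%:P.[x]) = nrm n (fun x => gd n x + (- c)%:P.[x]).
  by apply: eq_Rint => x _; rewrite !hornerC.
rewrite (nrm_add_poly delta0 q_gt0 pb tg.2 ip') E.
have -> : nrm n (horner (- c)%:P) = c ^+ 2 * mass n.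
  rewrite /nrm (eq_Rint (k := fun x => c ^+ 2 * wt n x)); last by move=> x _; rewrite hornerC sqrrN.
  by rewrite RintegralZl//; exact: (int_wt delta0 q_gt0 pb).
by rewrite mc; field; rewrite gt_eqF.
Qed.

(** Now [p] has degree below [n], and [n] derivatives annihilate it. *)
Lemma weak_end : is_proj n (gd 0%N) p ->
  nrm n (fun x => gd n x - p^`(n).[x]) = nrm n (gd n).
Proof.
move=> [sp _]; have := @size_derivn_le R p n 0 sp.
rewrite leqn0 size_poly_eq0 => /eqP ->.
by apply: eq_Rint => x _; rewrite horner0 subr0.
Qed.
End Ends.
End Assembly.

Theorem theorem3p2 (R : realType) (f : R -> R) (mu delta beta gamma : R)
    (a w : \bar R) (n : nat) (g : R -> R) (gd : nat -> R -> R) :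
  IP f mu delta beta gamma ->
  support_is f a w ->
  delta <= 0 ->
  (0 < n)%N ->
  (@lebesgue_measure R).-integrable setT (fun x => (`|x| ^+ (2 * n)%N * f x)%:E) ->
  Hnn f delta beta gamma a w n g gd ->
  (S1 f delta beta gamma gd n <= Sstr f delta beta gamma gd n /\
   (n = 1%N \/ ((1 < n)%N /\ poly_on (supp_int a w) g n.+1) ->
    S1 f delta beta gamma gd n = Sstr f delta beta gamma gd n)) /\
  (S1 f delta beta gamma gd n.-1 <= Sweak f delta beta gamma gd n /\
   (n = 1%N \/ ((1 < n)%N /\ poly_on (supp_int a w) g n) ->
    S1 f delta beta gamma gd n.-1 = Sweak f delta beta gamma gd n)).
Proof.
move=> ip supp delta0 n0 _ hn.
have [x0 Jx0] := supp_nonempty ip supp.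
have [s [t est]] := exhausts_ex Jx0.
have tg := Hnn_tower n0 hn.
have prj N := proj_ex est delta0 (qpol_supp_gt0 ip supp) (pearson_base ip supp delta0 est) N
  (fun p => tower_int_poly est delta0 (qpol_supp_gt0 ip supp) (pearson_base ip supp delta0 est) p n0 tg (leq0n n)).
split.
  have [p pp] := prj n.+1.
  have Nn : (n <= n.+1 <= n.+1)%N by rewrite leqnSn leqnn.
  have := S1_residual ip supp delta0 n0 hn est Nn pp; rewrite /= => ->.
  rewrite /Sstr !(Exp_nrm ip supp) !(Exp_mean ip supp) !(Exp_mass ip supp) strong_denominator//.
  rewrite -(strong_end ip supp delta0 n0 hn est pp).
  under [X in _ <= X + _]eq_bigr do rewrite (Exp_mean ip supp) (Exp_mass ip supp).
  under [X in _ = X + _]eq_bigr do rewrite (Exp_mean ip supp) (Exp_mass ip supp).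
  exact: (residual_compare ip supp delta0 n0 hn est Nn pp).
have [p pp] := prj n.
have Nn : (n <= n <= n.+1)%N by rewrite leqnSn leqnn.
have := S1_residual ip supp delta0 n0 hn est Nn pp; rewrite /= => ->.
rewrite /Sweak !(Exp_nrm ip supp) weak_denominator//.
rewrite -(weak_end pp).
under [X in _ <= X + _]eq_bigr do rewrite (Exp_mean ip supp) (Exp_mass ip supp).
under [X in _ = X + _]eq_bigr do rewrite (Exp_mean ip supp) (Exp_mass ip supp).
exact: (residual_compare ip supp delta0 n0 hn est Nn pp).
Qed.
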